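(* Let $p\ge1$ be an integer, let $M\ge1$, and let $f(z)=\sum_{k=1}^{p}|z|^{2(k-1)}G_{p-k+1}(z)$ be a $p$-harmonic mapping of $\mathbb{D}$ such that, for each $k\in\{1,\dots,p\}$, $\Delta G_{p-k+1}=0$ in $\mathbb{D}$ and $|G_{p-k+1}(z)|\le M$ for all $z\in\mathbb{D}$, and such that $f(0)=G_p(0)=J_f(0)-1=0$. Then there is a constant $\rho$ $(0<\rho<1)$ such that $D(f)$ is univalent in $\mathbb{D}_\rho$, where $\rho$ satisfies the equation $$\lambda_0(M)-\frac{T(M)}{(1-\rho)^2}\sum_{k=2}^{p}(2k-1)\rho^{2(k-1)}-\sum_{k=1}^{p}\frac{2T(M)\rho^{2k-1}}{(1-\rho)^3}-\frac{16M}{\pi^2}s_0\arctan\rho=0.$$ Moreover, the range $D(f)(\mathbb{D}_\rho)$ contains a univalent disk $\mathbb{D}_R$, where $$R=\rho\left[\lambda_0(M)-\sum_{k=2}^{p}\frac{T(M)\rho^{2(k-1)}}{(1-\rho)^2}-\frac{16M}{\pi^2}s_0\arctan\rho\right].$$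
   Context: $\mathbb{D}=\{z\in\mathbb{C}:|z|<1\}$ and $\mathbb{D}_r=\{z\in\mathbb{C}:|z|<r\}$. A $2p$-times continuously differentiable complex-valued function $f$ on $\mathbb{D}$ is $p$-harmonic if $\Delta^pf=0$, where $\Delta=4\frac{\partial^2}{\partial z\partial\overline z}$ and $\Delta^p$ is its $p$-fold iterate. $J_f=|f_z|^2-|f_{\overline z}|^2$ is the Jacobian, and $D(f)=zf_z-\overline z f_{\overline z}$. Constants: $$s_0=\left(\frac{\sqrt{17}-1}{\sqrt{17}-3}\right)\sqrt{\frac{2}{5-\sqrt{17}}}\approx4.1996,$$ $$T(M)=\begin{cases}\sqrt{2M^2-2}&\text{if }1\le M\le M_1:=\frac{\pi}{\sqrt{\pi^2-8}}\approx2.2976,\\[2pt] \frac{4M}{\pi}&\text{if }M>M_1,\end{cases}$$ $$\lambda_0(M)=\begin{cases}\frac{\sqrt2}{\sqrt{M^2-1}+\sqrt{M^2+1}}&\text{if }1\le M\le M_0,\\[2pt] \frac{\pi}{4M}&\text{if }M>M_0,\end{cases}\qquad M_0=\frac{\pi}{2\sqrt[4]{2\pi^2-16}}\approx1.1296.$$ *)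

(* Defs.v *)
(* Stdlib reals with Coquelicot; a complex number is a pair of reals. *)
From Stdlib Require Import Reals.
From Coquelicot Require Import Coquelicot.

Open Scope R_scope.

Definition disk (r : R) (z : C) : Prop := Cmod z < r.

(* Functions on the unit disk are total functions C -> C of which only the
   values on [disk 1] matter: Coquelicot's [Derive] at an interior point depends
   only on the values near that point. *)

Definition dx (f : C -> C) (z : C) : C :=
  (Derive (fun t : R => Re (f (t, Im z))) (Re z),
   Derive (fun t : R => Im (f (t, Im z))) (Re z)).

Definition dy (f : C -> C) (z : C) : C :=
  (Derive (fun t : R => Re (f (Re z, t))) (Im z),
   Derive (fun t : R => Im (f (Re z, t))) (Im z)).

Definition ex_partials (f : C -> C) (z : C) : Prop :=
  ex_derive (fun t : R => Re (f (t, Im z))) (Re z) /\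
  ex_derive (fun t : R => Im (f (t, Im z))) (Re z) /\
  ex_derive (fun t : R => Re (f (Re z, t))) (Im z) /\
  ex_derive (fun t : R => Im (f (Re z, t))) (Im z).

(* [n] times continuously differentiable, in the real sense, on the open set [U]. *)
Fixpoint Cn_on (n : nat) (U : C -> Prop) (f : C -> C) : Prop :=
  (forall z : C, U z -> @continuous C_UniformSpace C_UniformSpace f z) /\
  match n with
  | O => True
  | S m =>
      (forall z : C, U z -> ex_partials f z) /\
      Cn_on m U (dx f) /\ Cn_on m U (dy f)
  end.

Definition dz (f : C -> C) (z : C) : C := ((dx f z - Ci * dy f z) / 2)%C.
Definition dzbar (f : C -> C) (z : C) : C := ((dx f z + Ci * dy f z) / 2)%C.

Definition Laplacian (f : C -> C) (z : C) : C := (4 * dz (dzbar f) z)%C.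

Definition p_harmonic (p : nat) (f : C -> C) : Prop :=
  Cn_on (2 * p) (disk 1) f /\
  (forall z : C, disk 1 z -> Nat.iter p Laplacian f z = 0%C).

Definition harmonic (f : C -> C) : Prop := p_harmonic 1 f.

Definition Jacobian (f : C -> C) (z : C) : R :=
  Cmod (dz f z) ^ 2 - Cmod (dzbar f z) ^ 2.

Definition Dop (f : C -> C) (z : C) : C :=
  (z * dz f z - Cconj z * dzbar f z)%C.

Definition univalent_on (U : C -> Prop) (F : C -> C) : Prop :=
  forall z1 z2 : C, U z1 -> U z2 -> F z1 = F z2 -> z1 = z2.

Definition connected (U : C -> Prop) : Prop :=
  forall A B : C -> Prop,
    @open C_UniformSpace A -> @open C_UniformSpace B ->
    (forall z : C, U z -> A z \/ B z) ->
    (forall z : C, U z -> ~ (A z /\ B z)) ->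
    (forall z : C, U z -> A z) \/ (forall z : C, U z -> B z).

(* [F] maps some subdomain of [U] one-to-one onto the disk of radius [r] centred
   at 0.  The subdomain may be empty, to accommodate the degenerate radius 0. *)
Definition contains_univalent_disk (U : C -> Prop) (F : C -> C) (r : R) : Prop :=
  exists V : C -> Prop,
    @open C_UniformSpace V /\ connected V /\
    (forall z : C, V z -> U z) /\
    univalent_on V F /\
    (forall w : C, disk r w <-> exists z : C, V z /\ F z = w).

Definition s0 : R :=
  (sqrt 17 - 1) / (sqrt 17 - 3) * sqrt (2 / (5 - sqrt 17)).

Definition M1 : R := PI / sqrt (PI ^ 2 - 8).

Definition T (M : R) : R :=
  if Rle_dec M M1 then sqrt (2 * M ^ 2 - 2) else 4 * M / PI.

Definition M0 : R := PI / (2 * sqrt (sqrt (2 * PI ^ 2 - 16))).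

Definition lambda0 (M : R) : R :=
  if Rle_dec M M0
  then sqrt 2 / (sqrt (M ^ 2 - 1) + sqrt (M ^ 2 + 1))
  else PI / (4 * M).

(* Main.v *)
(* Write D(f) = L + E with L(z) = a z - conj (b z) the real-linear part at 0.  As
   D kills |z|^2, D(f) is the sum of the |z|^(2(k-1)) D(G_{p-k+1}), and for a
   harmonic G with Fourier coefficients a_n, b_n one has
   D(G) = sum_n n (a_n z^n - conj (b_n z^n)).  Parseval gives
   |a_n| + |b_n| <= sqrt 2 M always, and <= sqrt (2 M^2 - 2) for G_p and n >= 2,
   because |a_1|^2 - |b_1|^2 = 1; it also gives
   |a| - |b| = 1 / (|a| + |b|) >= 1 / (sqrt 2 M).  These constants are cruder than
   T(M) and lambda0(M), but the arctan term of the equation exceeds what the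
   series of D(G_p) costs by so much that E is still Lipschitz on the disk of
   radius rho with a constant K < |a| - |b|; in particular no Schwarz lemma is
   needed.  Hence D(f) is injective there and, by the contraction principle,
   covers a disk, with a continuous inverse. *)

Require Import Defs.
From Stdlib Require Import Reals Lra Lia Psatz Classical List ZArith Machin Ranalysis5.
From Coquelicot Require Import Coquelicot.

Open Scope R_scope.

(** * The radius equation *)

(** A harmonic [G] need not extend to the unit circle, so coefficients are taken on circles of
    radius [r < 1], and the final bounds come from continuity in [r] at 1. The analytic parts h and
    g of G = h + conj g are bypassed: [dz G] and the conjugate of [dzbar G] are holomorphic, D(G) is
    expressed by these two alone, and integration by parts on the circle ties their Fourier
    coefficients to those of [G]. Two constants measure E: a Lipschitz constant [K], which decides
    injectivity, and a bound [B] of |E(z)| / |z|, which gives the covered radius rho (|a| - |b| -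
    B). The radius equation enters twice. Its arctan term alone forces rho to be small enough for K
    < |a| - |b|. The whole equation then turns R / rho into T(M) times a sum of nonnegative terms,
    and K - B is the same sum with Parseval constants in place of T(M). As those are at least T(M),
    R / rho <= K - B < |a| - |b| - B. *)

Lemma PI_upper : PI < 3.1416.
Proof.
  destruct (PI_2_3_7_ineq 2) as [_ H].
  unfold sum_f_R0, tg_alt, PI_2_3_7_tg, Ratan_seq in H; simpl in H. lra.
Qed.

Lemma PI_lower : 3.14 < PI.
Proof.
  destruct (PI_2_3_7_ineq 2) as [H _].
  unfold sum_f_R0, tg_alt, PI_2_3_7_tg, Ratan_seq in H; simpl in H. lra.
Qed.

Lemma s0_lower : 4.199 < s0.
Proof.
  unfold s0.
  assert (Hs : 4.1231 < sqrt 17 < 4.1232).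
  { split.
    - rewrite <- (sqrt_Rsqr 4.1231) by lra. apply sqrt_lt_1; unfold Rsqr; lra.
    - rewrite <- (sqrt_Rsqr 4.1232) by lra. apply sqrt_lt_1; unfold Rsqr; lra. }
  set (s := sqrt 17) in *.
  assert (H1 : 2.7806 < (s - 1) / (s - 3)).
  { apply Rmult_lt_reg_r with (s - 3); [lra|]. unfold Rdiv.
    rewrite Rmult_assoc, Rinv_l by lra. lra. }
  assert (H2 : 1.5102 < sqrt (2 / (5 - s))).
  { rewrite <- (sqrt_Rsqr 1.5102) by lra. apply sqrt_lt_1_alt.
    split; [unfold Rsqr; lra|].
    apply Rmult_lt_reg_r with (5 - s); [lra|]. unfold Rdiv.
    rewrite Rmult_assoc, Rinv_l by lra. unfold Rsqr; lra. }
  nra.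
Qed.

(** The true value is about 6.808. A lower bound is the useful side: a large coefficient of arctan
    forces [rho] to be small. *)
Lemma atan_coef_lower : 6.8 < 16 / PI ^ 2 * s0.
Proof.
  generalize PI_upper PI_lower s0_lower; intros.
  assert (H2 : 0 < PI ^ 2 < 9.87) by nra.
  apply Rmult_lt_reg_r with (PI ^ 2); [lra|].
  replace (16 / PI ^ 2 * s0 * PI ^ 2) with (16 * s0) by (field; lra). lra.
Qed.

(** The difference vanishes at 0 and has derivative [y^4 / (1 + y^2)]. *)
Lemma atan_lower (x : R) : 0 <= x -> x - x ^ 3 / 3 <= atan x.
Proof.
  intros [Hx|<-]; [|rewrite atan_0; lra].
  set (f := fun y => atan y - y + y ^ 3 / 3).
  destruct (MVT_gen f 0 x (fun y => / (1 + y ^ 2) - 1 + y ^ 2)) as [c [Hc E]].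
  - intros y _. unfold f. auto_derive; [trivial|]. field. nra.
  - intros y _. apply continuity_pt_filterlim. apply (ex_derive_continuous f).
    unfold f. auto_derive. trivial.
  - unfold f in E. rewrite atan_0 in E.
    assert (0 <= / (1 + c ^ 2) - 1 + c ^ 2).
    { replace (/ (1 + c ^ 2) - 1 + c ^ 2) with (c ^ 4 * / (1 + c ^ 2))
        by (field; nra).
      apply Rmult_le_pos; [nra|]. left. apply Rinv_0_lt_compat. nra. }
    nra.
Qed.

Lemma T_nonneg (M : R) : 1 <= M -> 0 <= T M.
Proof.
  intros HM. unfold T. destruct (Rle_dec M M1); [apply sqrt_pos|].
  generalize PI_lower; intros. apply Rdiv_le_0_compat; lra.
Qed.

(** [M1] is where the two branches cross: squaring [4 * M / PI <= sqrt (2 * M^2 - 2)] gives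
    [PI^2 <= M^2 * (PI^2 - 8)], that is [M1 <= M]. *)
Lemma T_le_parseval (M : R) : 1 <= M -> T M <= sqrt (2 * M ^ 2 - 2).
Proof.
  intros HM. unfold T. destruct (Rle_dec M M1) as [h|h]; [lra|].
  generalize PI_lower; intros HP. apply Rnot_le_lt in h. unfold M1 in h.
  assert (Hs : 0 < sqrt (PI ^ 2 - 8)) by (apply sqrt_lt_R0; nra).
  assert (h' : PI < M * sqrt (PI ^ 2 - 8)).
  { apply Rmult_lt_compat_r with (r := sqrt (PI ^ 2 - 8)) in h; [|easy].
    unfold Rdiv in h. rewrite Rmult_assoc, Rinv_l, Rmult_1_r in h; lra. }
  assert (hs : PI ^ 2 < M ^ 2 * (PI ^ 2 - 8)).
  { replace (PI ^ 2 - 8) with (sqrt (PI ^ 2 - 8) ^ 2) by (apply pow2_sqrt; nra). nra. }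
  apply Rsqr_incr_0_var; [|apply sqrt_pos].
  rewrite Rsqr_sqrt by nra. unfold Rsqr.
  replace (4 * M / PI * (4 * M / PI)) with (16 * M ^ 2 / PI ^ 2) by (field; lra).
  apply Rmult_le_reg_r with (PI ^ 2); [nra|].
  replace (16 * M ^ 2 / PI ^ 2 * PI ^ 2) with (16 * M ^ 2) by (field; lra). nra.
Qed.

(** The dichotomy says that [M * lambda0 M] comes close to 1 only when [M] is close to 1, where the
    Parseval constant of [G_p] is small. On the first branch its square is [1 / (1 + a * b / M^2)]
    with [(a * b)^2 = M^4 - 1]; on the second branch it equals [PI / 4 < 0.8]. *)
Lemma lambda0_bound (M : R) : 1 <= M ->
  0 < M * lambda0 M <= 1 /\
  (M * lambda0 M <= 0.8 \/ (M ^ 2 - 1) < 0.1733 * M ^ 2).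
Proof.
  intros HM. unfold lambda0. destruct (Rle_dec M M0) as [_|_].
  - set (a := sqrt (M ^ 2 - 1)). set (b := sqrt (M ^ 2 + 1)).
    assert (Ha : 0 <= a) by apply sqrt_pos.
    assert (Hb : 0 < b) by (apply sqrt_lt_R0; nra).
    assert (Ea : a ^ 2 = M ^ 2 - 1) by (apply pow2_sqrt; nra).
    assert (Eb : b ^ 2 = M ^ 2 + 1) by (apply pow2_sqrt; nra).
    assert (E2 : sqrt 2 ^ 2 = 2) by (apply pow2_sqrt; lra).
    assert (H2 : 0 < sqrt 2) by (apply sqrt_lt_R0; lra).
    set (X := M * (sqrt 2 / (a + b))).
    assert (HX : 0 < X).
    { apply Rmult_lt_0_compat; [lra|]. apply Rdiv_lt_0_compat; lra. }
    assert (EX : X ^ 2 * (a + b) ^ 2 = 2 * M ^ 2).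
    { transitivity (sqrt 2 ^ 2 * M ^ 2); [unfold X; field; lra | rewrite E2; ring]. }
    assert (Hab : (a + b) ^ 2 = 2 * M ^ 2 + 2 * (a * b)) by nra.
    assert (0 <= a * b) by nra.
    split; [split; [easy|]|].
    + apply Rnot_lt_le. intros h. assert (1 < X ^ 2) by nra. nra.
    + destruct (Rle_or_lt X 0.8) as [h|h]; [now left|right].
      assert (h2 : 0.64 < X ^ 2) by nra.
      assert (h3 : a * b < 0.5625 * M ^ 2) by nra.
      assert (h4 : (a * b) ^ 2 = M ^ 4 - 1) by (replace ((a*b)^2) with (a^2*b^2) by ring; rewrite Ea, Eb; ring).
      assert (h5 : M ^ 4 - 1 < 0.31640625 * M ^ 4) by nra.
      assert (h6 : (0.8267 * M ^ 2) ^ 2 < 1) by nra. nra.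
  - generalize PI_upper PI_lower; intros.
    replace (M * (PI / (4 * M))) with (PI / 4) by (field; lra). lra.
Qed.

(* With [u = 1 / M^2], [X = M lambda0(M)] and [S = sqrt (1 - u)], the conclusion
   says that [sqrt 2 M] times the Lipschitz constant on the disk of radius [rho]
   is less than 1. *)
Lemma key_numeric (u X rho S : R) :
  0 < u <= 1 -> 0 < X <= 1 -> (X <= 0.8 \/ 1 - u < 0.1733) ->
  0 <= rho <= 0.15 -> 6.74 * rho <= X * u -> 0 <= S -> S ^ 2 = 1 - u ->
  2 * rho * (S * ((4 - 3 * rho + rho ^ 2) / (1 - rho) ^ 3) + 5 * rho) < u.
Proof.
  intros Hu HX Hc Hr Hru HS ES.
  set (g := (4 - 3 * rho + rho ^ 2) / (1 - rho) ^ 3).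
  assert (Hd : 0 < (1 - rho) ^ 3) by (apply pow_lt; lra).
  assert (Eg : g * (1 - rho) ^ 3 = 4 - 3 * rho + rho ^ 2)
    by (unfold g; field; lra).
  assert (Hg : forall B, 4 - 3 * rho + rho ^ 2 <= B * (1 - rho) ^ 3 -> g <= B).
  { intros B HB. apply Rmult_le_reg_r with ((1 - rho) ^ 3); lra. }
  destruct Hc as [Hc|Hc].
  (* Here [0.1187] is [0.8 / 6.74] rounded up, and [4 + 11.4 * rho] is a linear majorant of the
     convex [g] up to that radius. The gain [S <= 1 - u / 2] absorbs the terms linear in [rho],
     leaving [8 * rho < u]. *)
  - assert (Hr1 : rho <= 0.1187 * u) by nra.
    assert (Hr2 : rho <= 0.1187) by lra.
    assert (g <= 4 + 11.4 * rho).
    { apply Hg. assert (0 <= rho * (0.1187 - rho)) by nra.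
      assert (0 <= rho ^ 2 * (0.1187 - rho)) by nra.
      assert (0 <= rho ^ 3 * (0.1187 - rho)) by (assert (0 <= rho ^ 3) by nra; nra).
      nra. }
    assert (S <= 1 - u / 2) by nra.
    assert (Hb : S * g + 5 * rho <= 4).
    { apply Rle_trans with ((1 - u / 2) * (4 + 11.4 * rho) + 5 * rho); [|nra].
      apply Rplus_le_compat_r. apply Rle_trans with (S * (4 + 11.4 * rho)); nra. }
    nra.
  (* Only [X <= 1] is available now, so [0.1484] is [1 / 6.74] rounded up. In exchange [S] is at
     most the root of [0.1733], and the crude bound of [g] at [0.15] suffices. *)
  - assert (Hr1 : rho <= 0.1484 * u) by nra.
    assert (S <= 0.4163) by nra.
    assert (g <= 5.82).
    { apply Hg. assert (0 <= rho * (0.15 - rho)) by nra. nra. }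
    assert (0 <= g).
    { unfold g. apply Rdiv_le_0_compat; nra. }
    assert (Hb : S * g + 5 * rho <= 0.4163 * 5.82 + 0.75) by nra.
    nra.
Qed.

Lemma sum_n_m_ind (P : R -> Prop) (u : nat -> R) (n m : nat) :
  P 0 -> (forall x y, P x -> P y -> P (x + y)) ->
  (forall k, (n <= k <= m)%nat -> P (u k)) -> P (sum_n_m u n m).
Proof.
  intros H0 Hp. induction m as [|m IH]; intros Hu.
  - destruct n as [|n].
    + rewrite sum_n_n. apply Hu. lia.
    + rewrite sum_n_m_zero by lia. exact H0.
  - destruct (Nat.le_gt_cases n (S m)) as [h|h].
    + rewrite sum_n_Sm by lia. apply Hp; [apply IH|]; intros; apply Hu; lia.
    + rewrite sum_n_m_zero by lia. exact H0.
Qed.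

(** These restate the generic rules with the operations of [R], so that [apply] can unify. *)
Lemma continuous_Ropp {T : UniformSpace} (f : T -> R) (x : T) :
  continuous f x -> continuous (fun y => - f y) x.
Proof. apply (continuous_opp (V := R_NormedModule)). Qed.

Lemma continuous_Rplus {T : UniformSpace} (f g : T -> R) (x : T) :
  continuous f x -> continuous g x -> continuous (fun y => f y + g y) x.
Proof. apply (continuous_plus (V := R_NormedModule)). Qed.

Lemma continuous_Rminus {T : UniformSpace} (f g : T -> R) (x : T) :
  continuous f x -> continuous g x -> continuous (fun y => f y - g y) x.
Proof. apply (continuous_minus (V := R_NormedModule)). Qed.

Lemma continuous_Rmult {T : UniformSpace} (f g : T -> R) (x : T) :
  continuous f x -> continuous g x -> continuous (fun y => f y * g y) x.
Proof. apply (continuous_mult (K := R_AbsRing)). Qed.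

Lemma continuous_sum_n_m (f : nat -> R -> R) (n m : nat) (x : R) :
  (forall k, (n <= k <= m)%nat -> continuous (f k) x) ->
  continuous (fun y => sum_n_m (fun k => f k y) n m) x.
Proof.
  induction m as [|m IH]; intros Hf.
  - destruct n as [|n].
    + apply continuous_ext with (f 0%nat);
        [intros y; rewrite sum_n_n; reflexivity|]. apply Hf. lia.
    + apply continuous_ext with (fun _ => 0);
        [intros; rewrite sum_n_m_zero by lia; reflexivity | apply continuous_const].
  - destruct (Nat.le_gt_cases n (S m)) as [h|h].
    + apply continuous_ext with
        (fun y => plus (sum_n_m (fun k => f k y) n m) (f (S m) y)).
      * intros y. now rewrite sum_n_Sm by lia.
      * apply (continuous_plus (V := R_NormedModule));
          [apply IH; intros|]; apply Hf; lia.
    + apply continuous_ext with (fun _ => 0);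
        [intros; rewrite sum_n_m_zero by lia; reflexivity | apply continuous_const].
Qed.

(* [sum_(n >= 1) n (2 m + n) q^(2 m + n - 1)], a Lipschitz constant of
   [sum_(n >= 1) n |z|^(2 m) z^n] on the disk of radius [q]. *)
Definition lip_term (q : R) (m : nat) : R :=
  q ^ (2 * m) * (2 * INR m / (1 - q) ^ 2 + (1 + q) / (1 - q) ^ 3).

Lemma lip_term_sum (q : R) (p : nat) : 0 <= q <= 0.15 ->
  sum_n_m (fun k => lip_term q (k - 1)) 2 p <= 5 * q ^ 2.
Proof.
  intros Hq.
  assert (H1 : 0 < 1 - q) by lra.
  assert (H2 : 0 <= / (1 - q) ^ 2 <= 1.385).
  { split; [left; apply Rinv_0_lt_compat; nra|].
    apply Rmult_le_reg_r with ((1 - q) ^ 2); [nra|]. rewrite Rinv_l; nra. }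
  assert (H3' : 0.614 <= (1 - q) ^ 3) by nra.
  assert (H3 : 0 <= (1 + q) / (1 - q) ^ 3 <= 1.874).
  { split; [apply Rdiv_le_0_compat; lra|].
    apply Rmult_le_reg_r with ((1 - q) ^ 3); [nra|]. unfold Rdiv.
    rewrite Rmult_assoc, Rinv_l; nra. }
  assert (Hpos : forall m, 0 <= lip_term q m).
  { intros m. unfold lip_term. apply Rmult_le_pos; [apply pow_le; lra|].
    generalize (pos_INR m); intros. unfold Rdiv at 1. nra. }
  assert (Hstep : forall m, (1 <= m)%nat -> lip_term q (S m) <= 0.05 * lip_term q m).
  { intros m Hm. unfold lip_term.
    replace (2 * S m)%nat with (2 + 2 * m)%nat by lia. rewrite pow_add, S_INR.
    assert (1 <= INR m) by (apply (le_INR 1); easy).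
    assert (0 <= q ^ (2 * m)) by (apply pow_le; lra).
    rewrite <- (Rmult_assoc 0.05), (Rmult_comm 0.05), (Rmult_comm (q ^ 2)), !Rmult_assoc.
    apply Rmult_le_compat_l; [easy|]. unfold Rdiv at 1 3.
    assert (q ^ 2 <= 0.0225) by nra. assert (0 <= q ^ 2) by nra.
    apply Rle_trans with (0.0225 * (2 * (INR m + 1) * / (1 - q) ^ 2 + (1 + q) / (1 - q) ^ 3)).
    - apply Rmult_le_compat_r; nra.
    - nra. }
  (* The surplus of [0.06] times the last term pays for the geometric tail: the next term with its
     own surplus costs [1.06 * 0.05 <= 0.06] times the last one. At the start,
     [1.06 * (2 * 1.385 + 1.874) <= 5]. *)
  assert (H : forall n, sum_n_m (fun k => lip_term q (k - 1)) 2 (2 + n)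
      + 0.06 * lip_term q (1 + n) <= 5 * q ^ 2).
  { induction n as [|n IH].
    - change (2 + 0)%nat with 2%nat. rewrite sum_n_n.
      change (lip_term q 1 + 0.06 * lip_term q 1 <= 5 * q ^ 2).
      assert (E1 : lip_term q 1
          = q ^ 2 * (2 * / (1 - q) ^ 2 + (1 + q) / (1 - q) ^ 3))
        by (unfold lip_term, Rdiv; simpl; ring).
      rewrite E1. set (a := / (1 - q) ^ 2) in *.
      set (b := (1 + q) / (1 - q) ^ 3) in *.
      assert (0 <= q ^ 2 * (5 - 1.06 * (2 * a + b))) by (apply Rmult_le_pos; nra).
      lra.
    - replace (2 + S n)%nat with (S (2 + n)) by lia.
      rewrite sum_n_Sm by lia. change plus with Rplus.
      replace (S (2 + n) - 1)%nat with (S (1 + n)) by lia.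
      replace (1 + S n)%nat with (S (1 + n)) by lia.
      generalize (Hstep (1 + n)%nat ltac:(lia)) (Hpos (1 + n)%nat). lra. }
  destruct (Nat.le_gt_cases 2 p) as [h|h].
  - replace p with (2 + (p - 2))%nat by lia.
    generalize (H (p - 2)%nat) (Hpos (1 + (p - 2))%nat). lra.
  - rewrite sum_n_m_zero by lia. change zero with 0. nra.
Qed.

(** Intermediate values on [[0, 1/2]]: at 0 only [lambda0 M > 0] is left, and at [1/2] the arctan
    term alone exceeds [1 >= lambda0 M]. *)
Lemma radius_exists (p : nat) (M : R) : (1 <= p)%nat -> 1 <= M ->
  exists rho : R, 0 < rho < 1 /\
    lambda0 M
      - T M / (1 - rho) ^ 2
        * sum_n_m (fun k : nat => (2 * INR k - 1) * rho ^ (2 * (k - 1))) 2 p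
      - sum_n_m (fun k : nat => 2 * T M * rho ^ (2 * k - 1) / (1 - rho) ^ 3) 1 p
      - 16 * M / PI ^ 2 * s0 * atan rho = 0.
Proof.
  intros Hp HM.
  (* The sign is reversed because [IVT_interv] expects a function that goes from negative to
     positive. *)
  set (f := fun rho => - (lambda0 M
      - T M / (1 - rho) ^ 2
        * sum_n_m (fun k : nat => (2 * INR k - 1) * rho ^ (2 * (k - 1))) 2 p
      - sum_n_m (fun k : nat => 2 * T M * rho ^ (2 * k - 1) / (1 - rho) ^ 3) 1 p
      - 16 * M / PI ^ 2 * s0 * atan rho)).
  destruct (lambda0_bound M HM) as [[HX HX1] _].
  assert (HT := T_nonneg M HM).
  assert (HL : 0 < lambda0 M) by nra.
  assert (HL1 : lambda0 M <= 1) by nra.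
  assert (H0 : f 0 < 0).
  { unfold f. rewrite atan_0.
    assert (E1 : sum_n_m (fun k : nat => (2 * INR k - 1) * 0 ^ (2 * (k - 1))) 2 p = 0).
    { apply (sum_n_m_ind (fun x => x = 0)); [easy| intros; lra |].
      intros k Hk. rewrite pow_i by lia. ring. }
    assert (E2 : sum_n_m (fun k : nat => 2 * T M * 0 ^ (2 * k - 1) / (1 - 0) ^ 3) 1 p = 0).
    { apply (sum_n_m_ind (fun x => x = 0)); [easy| intros; lra |].
      intros k Hk. rewrite pow_i by lia. field. }
    rewrite E1, E2. lra. }
  assert (H1 : 0 < f (1 / 2)).
  { unfold f.
    assert (E1 : 0 <= sum_n_m (fun k : nat => (2 * INR k - 1) * (1/2) ^ (2 * (k - 1))) 2 p).
    { apply (sum_n_m_ind (fun x => 0 <= x)); [lra| intros; lra |].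
      intros k Hk. assert (1 <= INR k) by (apply (le_INR 1); lia).
      apply Rmult_le_pos; [lra|apply pow_le; lra]. }
    assert (E2 : 0 <= sum_n_m (fun k : nat => 2 * T M * (1/2) ^ (2 * k - 1) / (1 - 1/2) ^ 3) 1 p).
    { apply (sum_n_m_ind (fun x => 0 <= x)); [lra| intros; lra |].
      intros k Hk. apply Rdiv_le_0_compat; [|nra].
      apply Rmult_le_pos; [lra|apply pow_le; lra]. }
    assert (E3 : 0 <= T M / (1 - 1 / 2) ^ 2) by (apply Rdiv_le_0_compat; lra).
    assert (Ha := atan_lower (1/2) ltac:(lra)).
    assert (Hc := atan_coef_lower).
    replace (16 * M / PI ^ 2 * s0 * atan (1/2)) with
      (M * (16 / PI ^ 2 * s0) * atan (1/2)) by (unfold Rdiv; ring).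
    assert (6.8 < M * (16 / PI ^ 2 * s0)) by nra.
    assert (1 < M * (16 / PI ^ 2 * s0) * atan (1/2)) by nra.
    nra. }
  destruct (IVT_interv f 0 (1/2)) as [z [Hz Ez]]; [|lra|easy|easy|].
  - intros a Ha. apply continuity_pt_filterlim. change (continuous f a). unfold f.
    assert (Ha' : 1 - a <> 0) by lra.
    apply continuous_Ropp, continuous_Rminus;
      [apply continuous_Rminus; [apply continuous_Rminus|]|].
    + apply continuous_const.
    + apply continuous_Rmult.
      * apply (ex_derive_continuous (fun a => T M / (1 - a) ^ 2)).
        auto_derive. apply Rmult_integral_contrapositive_currified; lra.
      * apply (continuous_sum_n_m (fun k a => (2 * INR k - 1) * a ^ (2 * (k - 1)))).
        intros k Hk. apply (ex_derive_continuous (fun a => _ * a ^ _)).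
        auto_derive. easy.
    + apply (continuous_sum_n_m (fun k a => 2 * T M * a ^ (2 * k - 1) / (1 - a) ^ 3)).
      intros k Hk. apply (ex_derive_continuous (fun a => _ * a ^ _ / (1 - a) ^ 3)).
      auto_derive. repeat apply Rmult_integral_contrapositive_currified; lra.
    + apply (ex_derive_continuous (fun a => _ * atan a)). auto_derive. easy.
  - exists z. unfold f in Ez. split; [|lra].
    split; [|lra]. destruct (Req_dec z 0) as [->|]; [unfold f in H0; lra|lra].
Qed.

(** The left side is the Lipschitz constant of the nonlinear part and the right side the Parseval
    lower bound of |a| - |b|. The sums with [T M] in the equation are nonnegative and get dropped;
    what remains, [6.8 * M * atan rho <= lambda0 M], bounds [rho] in terms of [M]. Multiplication by
    [sqrt 2 * M] then leads to [key_numeric]. *)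
Lemma radius_contraction (p : nat) (M rho : R) : (1 <= p)%nat -> 1 <= M ->
  0 < rho < 1 ->
  lambda0 M
    - T M / (1 - rho) ^ 2
      * sum_n_m (fun k : nat => (2 * INR k - 1) * rho ^ (2 * (k - 1))) 2 p
    - sum_n_m (fun k : nat => 2 * T M * rho ^ (2 * k - 1) / (1 - rho) ^ 3) 1 p
    - 16 * M / PI ^ 2 * s0 * atan rho = 0 ->
  sqrt (2 * M ^ 2 - 2) * ((1 + rho) / (1 - rho) ^ 3 - 1)
    + sqrt 2 * M * sum_n_m (fun k => lip_term rho (k - 1)) 2 p < / (sqrt 2 * M).
Proof.
  intros Hp HM Hr E.
  destruct (lambda0_bound M HM) as [HX HX1].
  assert (HT := T_nonneg M HM).
  assert (E1 : 0 <= T M / (1 - rho) ^ 2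
      * sum_n_m (fun k : nat => (2 * INR k - 1) * rho ^ (2 * (k - 1))) 2 p).
  { apply Rmult_le_pos; [apply Rdiv_le_0_compat; nra|].
    apply (sum_n_m_ind (fun x => 0 <= x)); [lra| intros; lra |].
    intros k Hk. assert (1 <= INR k) by (apply (le_INR 1); lia).
    apply Rmult_le_pos; [lra|apply pow_le; lra]. }
  assert (E2 : 0 <= sum_n_m (fun k : nat => 2 * T M * rho ^ (2 * k - 1) / (1 - rho) ^ 3) 1 p).
  { apply (sum_n_m_ind (fun x => 0 <= x)); [lra| intros; lra |].
    intros k Hk. apply Rdiv_le_0_compat; [|apply pow_lt; lra].
    apply Rmult_le_pos; [lra|apply pow_le; lra]. }
  assert (Hc := atan_coef_lower).
  set (c := 16 / PI ^ 2 * s0) in *.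
  replace (16 * M / PI ^ 2 * s0 * atan rho) with (M * (c * atan rho)) in E
    by (unfold c, Rdiv; ring).
  assert (Hat := atan_lower rho ltac:(lra)).
  assert (Hat0 : 0 <= atan rho) by nra.
  assert (E3 : 6.8 * M * atan rho <= lambda0 M).
  { assert (0 <= (c - 6.8) * (M * atan rho)) by (apply Rmult_le_pos; nra). lra. }
  assert (E4 : 6.8 * (M ^ 2 * atan rho) <= M * lambda0 M) by nra.
  assert (E5 : 6.8 * atan rho <= 1).
  { assert (0 <= (M ^ 2 - 1) * atan rho) by (apply Rmult_le_pos; nra). lra. }
  (* The value fits because [6.8 * (0.15 - 0.15^3 / 3)] is just above 1. *)
  assert (Hr1 : rho <= 0.15).
  { apply Rnot_lt_le. intros h.
    assert (atan 0.15 < atan rho) by (apply atan_increasing; lra).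
    generalize (atan_lower 0.15 ltac:(lra)). lra. }
  (* For [rho <= 0.15] the cubic lower bound of [atan] loses at most the factor [1 - 0.15^2 / 3]. *)
  assert (E6 : 6.74 * rho <= 6.8 * atan rho) by nra.
  set (X := M * lambda0 M) in *. set (u := / M ^ 2).
  assert (HM2 : 1 <= M ^ 2) by nra.
  assert (Hu : 0 < u <= 1).
  { split; [apply Rinv_0_lt_compat; lra|].
    rewrite <- Rinv_1. apply Rinv_le_contravar; lra. }
  assert (EuM : u * M ^ 2 = 1) by (unfold u; field; lra).
  set (S := sqrt (1 - u)).
  assert (ES : S ^ 2 = 1 - u) by (apply pow2_sqrt; lra).
  assert (HS : 0 <= S) by apply sqrt_pos.
  assert (H2 : sqrt 2 ^ 2 = 2) by (apply pow2_sqrt; lra).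
  assert (H2' : 0 < sqrt 2) by (apply sqrt_lt_R0; lra).
  assert (ET : sqrt (2 * M ^ 2 - 2) = sqrt 2 * M * S).
  { replace (2 * M ^ 2 - 2) with (2 * (M ^ 2 * (1 - u))) by nra.
    rewrite sqrt_mult, sqrt_mult, sqrt_pow2; try nra. fold S. ring. }
  assert (HK := key_numeric u X rho S Hu HX).
  assert (H : 2 * rho * (S * ((4 - 3 * rho + rho ^ 2) / (1 - rho) ^ 3) + 5 * rho) < u).
  { apply HK; try easy; try lra; [|nra].
    destruct HX1 as [h|h]; [now left|right]. nra. }
  assert (Hl := lip_term_sum rho p ltac:(lra)).
  apply Rmult_lt_reg_l with (sqrt 2 * M); [nra|].
  rewrite Rinv_r by nra. rewrite ET.
  set (L := sum_n_m (fun k => lip_term rho (k - 1)) 2 p) in *.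
  replace ((1 + rho) / (1 - rho) ^ 3 - 1) with
    (rho * ((4 - 3 * rho + rho ^ 2) / (1 - rho) ^ 3)) by (field; lra).
  set (g := (4 - 3 * rho + rho ^ 2) / (1 - rho) ^ 3) in *.
  assert (HL : M ^ 2 * L <= M ^ 2 * (5 * rho ^ 2)) by nra.
  apply Rle_lt_trans with (M ^ 2 * (2 * rho * (S * g + 5 * rho))); [|nra].
  replace (_ * (_ + _)) with (sqrt 2 ^ 2 * (M ^ 2 * (S * (rho * g)) + M ^ 2 * L)) by ring.
  rewrite H2. lra.
Qed.

(** * Small Lipschitz perturbations of a linear map *)

Lemma im_le_Cmod (z : C) : Rabs (Im z) <= Cmod z.
Proof. eapply Rle_trans; [|apply Rmax_Cmod]. apply Rmax_r. Qed.

Lemma Cmod_le_abs (z : C) : Cmod z <= Rabs (Re z) + Rabs (Im z).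
Proof.
  generalize (Cmod2_alt z) (Cmod_ge_0 z) (Rabs_pos (Re z)) (Rabs_pos (Im z)).
  rewrite <- (pow2_abs (Re z)), <- (pow2_abs (Im z)). intros. nra.
Qed.

Lemma Cmod_minus_sym (x y : C) : Cmod (x - y) = Cmod (y - x).
Proof. rewrite <- Cmod_opp. f_equal. ring. Qed.

Lemma Cmod_minus_ge (x y : C) : Cmod x - Cmod y <= Cmod (x - y).
Proof.
  generalize (Cmod_triangle (x - y) y). replace (x - y + y)%C with x by ring. lra.
Qed.

(** Balls of [C_UniformSpace] are squares, being those of a product; round and square neighbourhoods
    contain each other after halving the radius. *)
Lemma locally_C (z : C) (P : C -> Prop) :
  @locally C_UniformSpace z P <->
  exists eps, 0 < eps /\ forall y, Cmod (y - z) < eps -> P y.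
Proof.
  split.
  - intros [e H]. exists e. split; [apply cond_pos|]. intros y Hy. apply H.
    split; [generalize (re_le_Cmod (y - z)) | generalize (im_le_Cmod (y - z))];
      intros; eapply Rle_lt_trans; [|apply Hy| |apply Hy]; easy.
  - intros [e [He H]]. exists (mkposreal _ (is_pos_div_2 (mkposreal e He))).
    intros y [H1 H2]. apply H. eapply Rle_lt_trans; [apply Cmod_le_abs|].
    change (Rabs (Re (y - z)) < e / 2) in H1.
    change (Rabs (Im (y - z)) < e / 2) in H2. lra.
Qed.

(** The sequence is [v 0] plus the partial sums of its increments, a series dominated by a geometric
    one. *)
Lemma geometric_ex_lim (v : nat -> R) (c k : R) : 0 <= k < 1 ->
  (forall n, Rabs (v (S n) - v n) <= c * k ^ n) -> exists l : R, is_lim_seq v l.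
Proof.
  intros Hk H.
  assert (He : ex_series (fun n => v (S n) - v n)).
  { apply (ex_series_le (V := R_CompleteNormedModule)) with (fun n => c * k ^ n);
      [exact H|].
    apply (ex_series_scal (V := R_NormedModule)), ex_series_geom.
    rewrite Rabs_pos_eq; lra. }
  destruct He as [l Hl]. exists (v 0%nat + l).
  apply is_lim_seq_incr_1.
  apply is_lim_seq_ext with (fun n => v 0%nat + sum_n (fun n => v (S n) - v n) n).
  - induction n as [|n IH]; [rewrite sum_O; ring|].
    rewrite sum_Sn. change plus with Rplus. lra.
  - apply (is_lim_seq_plus' _ _ (v 0%nat) l); [apply is_lim_seq_const|exact Hl].
Qed.

Lemma is_lim_seq_Cmod (u : nat -> C) (x y : R) :
  is_lim_seq (fun n => Re (u n)) x -> is_lim_seq (fun n => Im (u n)) y ->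
  is_lim_seq (fun n => Cmod (u n - (x, y))) 0.
Proof.
  intros Hx Hy.
  apply is_lim_seq_le_le with (fun _ => 0)
    (fun n => Rabs (Re (u n) - x) + Rabs (Im (u n) - y)).
  - intros n. split; [apply Cmod_ge_0|]. apply (Cmod_le_abs (u n - (x, y))).
  - apply is_lim_seq_const.
  - rewrite <- (Rplus_0_l 0) at 1.
    assert (H : forall (v : nat -> R) (l : R), is_lim_seq v l ->
      is_lim_seq (fun n => Rabs (v n - l)) 0).
    { intros v l Hv. rewrite <- Rabs_R0, <- (Rminus_diag_eq l l) by easy.
      apply (is_lim_seq_abs _ (l - l)).
      apply is_lim_seq_minus'; [easy|apply is_lim_seq_const]. }
    apply is_lim_seq_plus'; now apply H.
Qed.

(** Connectedness of [[0, 1]], stated for a locally constant predicate and proved with the supremum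
    of the initial segments on which [P] holds. It serves to move along the preimage of a
    segment. *)
Lemma interval_induction (P : R -> Prop) :
  P 0 ->
  (forall t, 0 <= t <= 1 -> exists d, 0 < d /\
    forall s, 0 <= s <= 1 -> Rabs (s - t) < d -> (P s <-> P t)) ->
  P 1.
Proof.
  intros P0 Hloc.
  set (S := fun t => 0 <= t <= 1 /\ forall s, 0 <= s <= t -> P s).
  destruct (completeness S) as [m [Hub Hl]].
  - exists 1. intros t [[_ h] _]. exact h.
  - exists 0. split; [lra|]. intros s Hs. replace s with 0 by lra. easy.
  - assert (H0 : 0 <= m).
    { apply Hub. split; [lra|]. intros s Hs. replace s with 0 by lra. easy. }
    assert (H1 : m <= 1) by (apply Hl; intros t [[_ h] _]; exact h).
    destruct (Hloc m (conj H0 H1)) as [d [Hd Hm]].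
    assert (Hlt : forall s, 0 <= s < m -> P s).
    { intros s Hs. apply NNPP. intros Hn.
      assert (m <= s); [|lra]. apply Hl. intros t [Ht Ht'].
      apply Rnot_lt_le. intros h. apply Hn, Ht'. lra. }
    assert (Pm : P m).
    { destruct (Req_dec m 0) as [->|Hm0]; [easy|].
      set (s := Rmax 0 (m - d / 2)).
      assert (Hs : 0 <= s < m /\ m - d / 2 <= s).
      { unfold s. generalize (Rmax_l 0 (m - d / 2)) (Rmax_r 0 (m - d / 2)).
        intros. split; [split; [easy|]|easy]. apply Rmax_lub_lt; lra. }
      apply (Hm s); [lra| |apply Hlt; lra]. rewrite Rabs_left; lra. }
    destruct (Req_dec m 1) as [<-|Hm1]; [easy|exfalso].
    set (s := Rmin 1 (m + d / 2)).
    assert (Hs : m < s <= 1 /\ s <= m + d / 2).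
    { unfold s. generalize (Rmin_l 1 (m + d / 2)) (Rmin_r 1 (m + d / 2)).
      intros. split; [split; [|easy]|easy]. apply Rmin_glb_lt; lra. }
    assert (s <= m); [|lra]. apply Hub. split; [lra|]. intros t Ht.
    destruct (Rlt_or_le t m); [apply Hlt; lra|].
    apply Hm; [lra| |easy]. rewrite Rabs_pos_eq; lra.
Qed.

(** [K] controls differences and yields injectivity; [B] controls growth from 0 and yields the
    covered radius [q * (Cmod a - Cmod b - B)], which the Lipschitz constant alone would give only
    with [K] in place of the smaller [B]. *)
Record near_linear (a b : C) (E F : C -> C) (q K B : R) : Prop := {
  nl_K : 0 <= K < Cmod a - Cmod b;
  nl_B : 0 <= B <= K;
  nl_lip : forall z1 z2, disk q z1 -> disk q z2 ->
    Cmod (E z1 - E z2) <= K * Cmod (z1 - z2);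
  nl_bound : forall z, disk q z -> Cmod (E z) <= B * Cmod z;
  nl_eq : forall z, disk q z -> F z = (a * z - Cconj (b * z) + E z)%C
}.

Lemma near_linear_lower a b E F q K B (z1 z2 : C) : near_linear a b E F q K B ->
  disk q z1 -> disk q z2 ->
  (Cmod a - Cmod b - K) * Cmod (z1 - z2) <= Cmod (F z1 - F z2).
Proof.
  intros [_ _ HE _ HF] H1 H2. rewrite !HF by easy.
  replace (a * z1 - Cconj (b * z1) + E z1 - (a * z2 - Cconj (b * z2) + E z2))%C
    with (a * (z1 - z2) - (Cconj (b * (z1 - z2)) - (E z1 - E z2)))%C
    by (rewrite !Cmult_conj, Cminus_conj; ring).
  eapply Rle_trans; [|apply Cmod_minus_ge].
  generalize (Cmod_triangle (Cconj (b * (z1 - z2))) (- (E z1 - E z2))).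
  rewrite Cmod_opp, Cmod_conj, !Cmod_mult.
  fold (Cminus (Cconj (b * (z1 - z2))) (E z1 - E z2)).
  generalize (HE z1 z2 H1 H2). nra.
Qed.

(** Obtained by eliminating the conjugate of z between [a * z - Cconj (b * z) = u] and the conjugate
    equation. The denominator is the determinant of this real-linear map. *)
Definition linear_inv (a b u : C) : C :=
  ((Cconj a * u + Cconj b * Cconj u) / RtoC (Cmod a ^ 2 - Cmod b ^ 2))%C.

Lemma linear_inv_correct (a b u : C) : Cmod b < Cmod a ->
  (a * linear_inv a b u - Cconj (b * linear_inv a b u))%C = u.
Proof.
  intros Hab.
  assert (Hd : RtoC (Cmod a ^ 2 - Cmod b ^ 2) <> 0%C).
  { intros h. apply RtoC_inj in h. generalize (Cmod_ge_0 b). nra. }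
  unfold linear_inv.
  rewrite Cmult_conj, Cdiv_conj, Cplus_conj, !Cmult_conj, !Cconj_conj by easy.
  replace (Cconj (RtoC (Cmod a ^ 2 - Cmod b ^ 2))) with (RtoC (Cmod a ^ 2 - Cmod b ^ 2))
    by (unfold Cconj, RtoC; simpl; f_equal; ring).
  assert (Hr : (RtoC (Cmod a ^ 2 - Cmod b ^ 2) = a * Cconj a - b * Cconj b)%C)
    by (rewrite RtoC_minus, !Cmod2_conj; easy).
  rewrite Hr in *. field. easy.
Qed.

Lemma linear_inv_minus (a b u v : C) : Cmod b < Cmod a ->
  (linear_inv a b u - linear_inv a b v)%C = linear_inv a b (u - v).
Proof.
  intros Hab. unfold linear_inv. rewrite Cminus_conj. field.
  intros h. apply RtoC_inj in h. generalize (Cmod_ge_0 b). nra.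
Qed.

Lemma linear_inv_bound (a b u : C) : Cmod b < Cmod a ->
  (Cmod a - Cmod b) * Cmod (linear_inv a b u) <= Cmod u.
Proof.
  intros Hab. rewrite <- (linear_inv_correct a b u Hab) at 2.
  eapply Rle_trans; [|apply Cmod_minus_ge].
  rewrite Cmod_conj, !Cmod_mult. lra.
Qed.

(** Picard iteration of [z = inv (w - E z)] from 0. The iterates stay within [r], the solution of
    [lam * r = Cmod w + B * r]. The hypothesis on [w] says [r < q], so the limit, again of modulus
    at most [r], is still in the open disk. The contraction ratio is [K / lam]. *)
Lemma near_linear_surj a b E F q K B (w : C) : near_linear a b E F q K B ->
  Cmod w < q * (Cmod a - Cmod b - B) -> exists z, disk q z /\ F z = w.
Proof.
  intros [HK HB HE HEB HF] Hw. set (lam := Cmod a - Cmod b) in *.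
  assert (Hlam : 0 < lam) by lra.
  assert (Hab : Cmod b < Cmod a) by (unfold lam in Hlam; lra).
  set (inv := linear_inv a b).
  set (r := Cmod w / (lam - B)).
  assert (HlB : 0 < lam - B) by lra.
  assert (Hr : 0 <= r) by (apply Rdiv_le_0_compat; [apply Cmod_ge_0|lra]).
  assert (Ew : Cmod w = r * (lam - B)) by (unfold r; field; lra).
  assert (Hrq : r < q) by nra.
  set (u := fix u (n : nat) : C := match n with O => 0%C | S m => inv (w - E (u m))%C end).
  assert (Hu : forall n, Cmod (u n) <= r).
  { induction n as [|n IH]; [simpl; now rewrite Cmod_0|]. simpl.
    generalize (linear_inv_bound a b (w - E (u n)) Hab). fold lam. fold inv.
    generalize (Cmod_triangle w (- E (u n))). rewrite Cmod_opp.
    fold (Cminus w (E (u n))).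
    assert (Hd : disk q (u n)) by (unfold disk; lra).
    generalize (HEB _ Hd). intros.
    assert (Cmod (E (u n)) <= B * r) by nra.
    apply Rmult_le_reg_l with lam; lra. }
  assert (Hd : forall n, disk q (u n)) by (intros n; unfold disk; generalize (Hu n); lra).
  set (k := K / lam).
  assert (Ek : K = k * lam) by (unfold k; field; lra).
  assert (Hk : 0 <= k < 1) by nra.
  assert (Hinv : forall x y, disk q x -> disk q y ->
    Cmod (inv (w - E x)%C - inv (w - E y)%C) <= k * Cmod (x - y)).
  { intros x y Hx Hy. unfold inv. rewrite linear_inv_minus by easy.
    generalize (linear_inv_bound a b (w - E x - (w - E y)) Hab) (HE y x Hy Hx).
    replace (w - E x - (w - E y))%C with (E y - E x)%C by ring.
    rewrite (Cmod_minus_sym y x), Ek. fold lam. intros.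
    apply Rmult_le_reg_l with lam; lra. }
  assert (Hstep : forall n, Cmod (u (S n) - u n) <= r * k ^ n).
  { induction n as [|n IH].
    - simpl (u 0%nat). replace (u 1%nat - 0)%C with (u 1%nat) by ring.
      rewrite pow_O, Rmult_1_r. apply Hu.
    - change (u (S (S n))) with (inv (w - E (u (S n)))%C).
      change (u (S n)) with (inv (w - E (u n))%C) at 2.
      eapply Rle_trans; [apply Hinv; apply Hd|]. simpl pow. nra. }
  destruct (geometric_ex_lim (fun n => Re (u n)) r k Hk) as [x Hx].
  { intros n. eapply Rle_trans; [apply (re_le_Cmod (u (S n) - u n))|apply Hstep]. }
  destruct (geometric_ex_lim (fun n => Im (u n)) r k Hk) as [y Hy].
  { intros n. eapply Rle_trans; [apply (im_le_Cmod (u (S n) - u n))|apply Hstep]. }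
  set (z := (x, y) : C).
  assert (Hz := is_lim_seq_Cmod u x y Hx Hy : is_lim_seq (fun n => Cmod (u n - z)) 0).
  (* Both the bound of [z] and the fixed-point equation are reached as inequalities whose error is a
     combination of two consecutive distances to the limit. *)
  assert (Hlim : forall A B : R,
    (forall n, A <= B + (Cmod (u n - z) + Cmod (u (S n) - z))) -> A <= B).
  { intros A B0 H. apply (is_lim_seq_le (fun _ => A) _ A B0 H).
    - apply is_lim_seq_const.
    - replace (Finite B0) with (Finite (B0 + (0 + 0))) by (f_equal; ring).
      apply is_lim_seq_plus'; [apply is_lim_seq_const|].
      apply is_lim_seq_plus'; [easy|].
      now apply (is_lim_seq_incr_1 (fun n => Cmod (u n - z))). }
  assert (Hzr : Cmod z <= r).
  { apply Hlim. intros n.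
    generalize (Cmod_minus_ge z (u n)) (Hu n) (Cmod_ge_0 (u (S n) - z)).
    rewrite (Cmod_minus_sym z). lra. }
  assert (Hzq : disk q z) by (unfold disk; lra).
  assert (Ez : z = inv (w - E z)%C).
  { apply Ceq_minus, Cmod_eq_0, Rle_antisym; [|apply Cmod_ge_0].
    apply Hlim. intros n.
    assert (H1 := Hinv _ _ (Hd n) Hzq).
    change (inv (w - E (u n))%C) with (u (S n)) in H1.
    generalize (Cmod_triangle (z - u (S n)) (u (S n) - inv (w - E z)%C)).
    replace (z - u (S n) + (u (S n) - inv (w - E z)))%C
      with (z - inv (w - E z)%C)%C by ring.
    rewrite (Cmod_minus_sym z (u (S n))).
    generalize (Cmod_ge_0 (u n - z)). nra. }
  exists z. split; [easy|]. rewrite HF by easy.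
  assert (Hi := linear_inv_correct a b (w - E z) Hab). fold inv in Hi.
  rewrite <- Ez in Hi. rewrite Hi. ring.
Qed.

(** The subdomain is the preimage [V] of the disk of radius [r]. It is open because [F] is
    Lipschitz, and connected because the inverse of [F] is Lipschitz with constant [/ c], so that
    segments to 0 lift to [V]. *)
Lemma near_linear_univalent_disk a b E F q K B (r : R) :
  near_linear a b E F q K B -> r <= q * (Cmod a - Cmod b - B) ->
  contains_univalent_disk (disk q) F r.
Proof.
  intros HN Hr. assert (HN' := HN). destruct HN' as [HK HB HE HEB HF].
  set (c := Cmod a - Cmod b - K). assert (Hc : 0 < c) by (unfold c; lra).
  assert (Hlow : forall z1 z2, disk q z1 -> disk q z2 ->
    c * Cmod (z1 - z2) <= Cmod (F z1 - F z2))
    by (intros z1 z2; apply (near_linear_lower _ _ _ _ _ _ _ z1 z2 HN)).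
  assert (Hinj : forall z1 z2, disk q z1 -> disk q z2 -> F z1 = F z2 -> z1 = z2).
  { intros z1 z2 H1 H2 H. apply Ceq_minus, Cmod_eq_0.
    generalize (Hlow z1 z2 H1 H2) (Cmod_ge_0 (z1 - z2)).
    rewrite H. replace (F z2 - F z2)%C with (RtoC 0) by ring. rewrite Cmod_0. nra. }
  assert (Hup : forall z1 z2, disk q z1 -> disk q z2 ->
    Cmod (F z1 - F z2) <= (Cmod a + Cmod b + K) * Cmod (z1 - z2)).
  { intros z1 z2 H1 H2. rewrite !HF by easy.
    replace (a * z1 - Cconj (b * z1) + E z1 - (a * z2 - Cconj (b * z2) + E z2))%C
      with (a * (z1 - z2) + - Cconj (b * (z1 - z2)) + (E z1 - E z2))%C
      by (rewrite !Cmult_conj, Cminus_conj; ring).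
    eapply Rle_trans; [apply Cmod_triangle|].
    generalize (Cmod_triangle (a * (z1 - z2)) (- Cconj (b * (z1 - z2)))).
    rewrite Cmod_opp, Cmod_conj, !Cmod_mult. generalize (HE z1 z2 H1 H2). nra. }
  set (V := fun z => disk q z /\ Cmod (F z) < r).
  assert (Hsurj : forall w, Cmod w < r -> exists z, V z /\ F z = w).
  { intros w Hw. destruct (near_linear_surj _ _ _ _ _ _ _ w HN) as [z [Hz Ez]];
      [lra|]. exists z. unfold V. now rewrite Ez. }
  exists V. split; [|split; [|split; [|split]]].
  - intros z [Hz Hz']. apply locally_C. unfold disk in Hz.
    set (L := Cmod a + Cmod b + K + 1).
    assert (HL : 0 < L) by (unfold L; generalize (Cmod_ge_0 a) (Cmod_ge_0 b); lra).
    exists (Rmin (q - Cmod z) ((r - Cmod (F z)) / L)).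
    assert (Hp : 0 < (r - Cmod (F z)) / L) by (apply Rdiv_lt_0_compat; lra).
    split; [apply Rmin_glb_lt; lra|].
    intros y Hy. assert (Hyq : disk q y).
    { unfold disk. generalize (Rmin_l (q - Cmod z) ((r - Cmod (F z)) / L)).
      generalize (Cmod_minus_ge y z). lra. }
    split; [easy|].
    generalize (Rmin_r (q - Cmod z) ((r - Cmod (F z)) / L)). intros Hm.
    assert (H1 : Cmod (y - z) * L < r - Cmod (F z)).
    { replace (r - Cmod (F z)) with ((r - Cmod (F z)) / L * L) by (field; lra).
      apply Rmult_lt_compat_r; lra. }
    generalize (Hup y z Hyq Hz) (Cmod_minus_ge (F y) (F z)) (Cmod_ge_0 (y - z)).
    unfold L in H1. nra.
  (* The preimage of the segment from 0 to [F z] starts at [z0], in [A]. Membership in [A] is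
     locally constant along it, since the lift is continuous and [A] and [B'] are open, so it
     persists up to [z]. *)
  - assert (Hpath : forall A B : C -> Prop,
      @open C_UniformSpace A -> @open C_UniformSpace B ->
      (forall z, V z -> A z \/ B z) -> (forall z, V z -> ~ (A z /\ B z)) ->
      forall z0, V z0 -> F z0 = 0%C -> A z0 -> forall z, V z -> A z).
    { intros A B' HA HB' Hcov Hdis z0 Hz0 E0 A0 z Hz.
      set (P := fun t : R => exists y, V y /\ F y = (t * F z)%C /\ A y).
      assert (P 1) as [y [Hy [Ey Ay]]].
      { apply interval_induction.
        - exists z0. split; [easy|split; [|easy]]. rewrite E0. ring.
        - intros t Ht.
          assert (Hw : forall s, 0 <= s <= 1 -> Cmod (s * F z) < r).
          { intros s Hs. rewrite Cmod_mult, Cmod_R, Rabs_pos_eq by easy.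
            destruct Hz as [_ Hz]. generalize (Cmod_ge_0 (F z)). nra. }
          destruct (Hsurj _ (Hw t Ht)) as [y [Hy Ey]].
          assert (Hnear : forall s x eps, 0 <= s <= 1 -> V x -> F x = (s * F z)%C ->
            0 < eps -> Rabs (s - t) < eps * c / (Cmod (F z) + 1) -> Cmod (x - y) < eps).
          { intros s x eps Hs [Hx _] Ex Heps Hst.
            destruct Hy as [Hy _].
            generalize (Hlow x y Hx Hy). rewrite Ex, Ey.
            replace (s * F z - t * F z)%C with (RtoC (s - t) * F z)%C
              by (rewrite RtoC_minus; ring).
            rewrite Cmod_mult, Cmod_R. generalize (Cmod_ge_0 (F z)). intros H0 H1.
            assert (Rabs (s - t) * (Cmod (F z) + 1) < eps * c).
            { replace (eps * c) with (eps * c / (Cmod (F z) + 1) * (Cmod (F z) + 1))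
                by (field; lra). apply Rmult_lt_compat_r; lra. }
            generalize (Rabs_pos (s - t)). intros.
            apply Rmult_lt_reg_l with c; [easy|]. lra. }
          assert (Hd : forall eps, 0 < eps -> 0 < eps * c / (Cmod (F z) + 1)).
          { intros. generalize (Cmod_ge_0 (F z)). intros.
            apply Rdiv_lt_0_compat; nra. }
          destruct (Hcov y Hy) as [Ay|By].
          + destruct (proj1 (locally_C _ _) (HA y Ay)) as [eps [Heps HAe]].
            exists (eps * c / (Cmod (F z) + 1)). split; [now apply Hd|].
            intros s Hs Hst. split; intros _.
            * exists y. easy.
            * destruct (Hsurj _ (Hw s Hs)) as [x [Hx Ex]].
              exists x. split; [easy|split; [easy|]]. apply HAe.
              now apply (Hnear s).
          + destruct (proj1 (locally_C _ _) (HB' y By)) as [eps [Heps HBe]].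
            exists (eps * c / (Cmod (F z) + 1)). split; [now apply Hd|].
            intros s Hs Hst. split; intros [x [Hx [Ex Ax]]]; exfalso.
            * apply (Hdis x Hx). split; [easy|]. apply HBe. now apply (Hnear s).
            * assert (x = y) as -> by (apply Hinj; [apply Hx|apply Hy|congruence]).
              now apply (Hdis y Hy). }
      replace z with y; [easy|]. apply Hinj; [apply Hy|apply Hz|].
      rewrite Ey. ring. }
    intros A B' HA HB' Hcov Hdis.
    (* When [r <= 0], [V] is empty and there is no preimage of 0 to start from. *)
    destruct (classic (exists z, V z)) as [[z Hz]|Hn].
    + assert (0 < r) by (destruct Hz as [_ Hz]; generalize (Cmod_ge_0 (F z)); lra).
      destruct (Hsurj 0%C) as [z0 [Hz0 E0]]; [now rewrite Cmod_0|].
      destruct (Hcov z0 Hz0) as [A0|B0].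
      * left. intros y Hy. now apply (Hpath A B' HA HB' Hcov Hdis z0).
      * right. intros y Hy. apply (Hpath B' A) with z0; try easy.
        -- intros x Hx. destruct (Hcov x Hx); auto.
        -- intros x Hx [H1 H2]. now apply (Hdis x Hx).
    + left. intros z Hz. exfalso. apply Hn. now exists z.
  - now intros z [Hz _].
  - intros z1 z2 [H1 _] [H2 _]. now apply Hinj.
  - intros w. split; [apply Hsurj|]. intros [z [[_ Hz] <-]]. exact Hz.
Qed.

(** * Continuity of complex-valued maps, coordinate by coordinate *)

Definition ccont {T : UniformSpace} (g : T -> C) (x : T) : Prop :=
  continuous (fun y => Re (g y)) x /\ continuous (fun y => Im (g y)) x.

Lemma ccont_iff {T : UniformSpace} (g : T -> C) (x : T) :
  @continuous T C_UniformSpace g x <-> ccont g x.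
Proof.
  split.
  - intros H. split.
    + apply (continuous_comp g Re x H). apply (continuous_fst (U := R_UniformSpace)).
    + apply (continuous_comp g Im x H). apply (continuous_snd (U := R_UniformSpace)).
  - intros [H1 H2].
    apply (continuous_ext_loc g (fun y => (Re (g y), Im (g y)) : C)).
    + apply filter_forall. intros y. now destruct (g y).
    + intros P [e HP]. simpl in HP.
      specialize (H1 (ball (Re (g x)) e) (locally_ball _ e)).
      specialize (H2 (ball (Im (g x)) e) (locally_ball _ e)).
      unfold filtermap in *. generalize (filter_and _ _ H1 H2).
      apply filter_imp. intros y [h1 h2]. apply HP. now split.
Qed.

Lemma ccont_ext {T : UniformSpace} (g h : T -> C) (x : T) :
  (forall y, g y = h y) -> ccont g x -> ccont h x.
Proof.
  intros H [H1 H2]. split; [eapply continuous_ext; [|exact H1] | eapply continuous_ext; [|exact H2]];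
    intros y; simpl; now rewrite H.
Qed.

Lemma ccont_const {T : UniformSpace} (c : C) (x : T) : ccont (fun _ => c) x.
Proof. split; apply continuous_const. Qed.

Lemma ccont_plus {T : UniformSpace} (g h : T -> C) (x : T) :
  ccont g x -> ccont h x -> ccont (fun y => (g y + h y)%C) x.
Proof.
  intros [H1 H2] [H3 H4]. split; apply continuous_Rplus; easy.
Qed.

Lemma ccont_opp {T : UniformSpace} (g : T -> C) (x : T) :
  ccont g x -> ccont (fun y => (- g y)%C) x.
Proof.
  intros [H1 H2]. split; apply (continuous_opp (V := R_NormedModule)); easy.
Qed.

Lemma ccont_minus {T : UniformSpace} (g h : T -> C) (x : T) :
  ccont g x -> ccont h x -> ccont (fun y => (g y - h y)%C) x.
Proof. intros H1 H2. now apply ccont_plus, ccont_opp. Qed.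

Lemma ccont_mult {T : UniformSpace} (g h : T -> C) (x : T) :
  ccont g x -> ccont h x -> ccont (fun y => (g y * h y)%C) x.
Proof.
  intros [H1 H2] [H3 H4]. split.
  - apply (continuous_minus (V := R_NormedModule)); apply continuous_Rmult; easy.
  - apply continuous_Rplus; apply continuous_Rmult; easy.
Qed.

Lemma ccont_conj {T : UniformSpace} (g : T -> C) (x : T) :
  ccont g x -> ccont (fun y => Cconj (g y)) x.
Proof.
  intros [H1 H2]. split; [easy|]. now apply (continuous_opp (V := R_NormedModule)).
Qed.

Lemma ccont_RtoC {T : UniformSpace} (g : T -> R) (x : T) :
  continuous g x -> ccont (fun y => RtoC (g y)) x.
Proof. intros H. split; [easy|apply continuous_const]. Qed.

Lemma continuous_Cmod2 {T : UniformSpace} (g : T -> C) (x : T) :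
  ccont g x -> continuous (fun y => Cmod (g y) ^ 2) x.
Proof.
  intros [H1 H2].
  apply continuous_ext with (fun y => Re (g y) * Re (g y) + Im (g y) * Im (g y)).
  - intros y. rewrite Cmod2_alt. simpl. ring.
  - apply continuous_Rplus; apply continuous_Rmult; easy.
Qed.

Lemma continuous_Cmod {T : UniformSpace} (g : T -> C) (x : T) :
  ccont g x -> continuous (fun y => Cmod (g y)) x.
Proof.
  intros H. apply continuous_ext with (fun y => sqrt (Cmod (g y) ^ 2)).
  - intros y. apply sqrt_pow2, Cmod_ge_0.
  - apply (continuous_comp (fun y => Cmod (g y) ^ 2) sqrt).
    + now apply continuous_Cmod2.
    + apply continuous_sqrt.
Qed.

Lemma ccont_inv {T : UniformSpace} (g : T -> C) (x : T) :
  ccont g x -> g x <> 0%C -> ccont (fun y => (/ g y)%C) x.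
Proof.
  intros H H0. assert (H2 := continuous_Cmod2 g x H).
  assert (Hn : Cmod (g x) ^ 2 <> 0).
  { apply pow_nonzero. intros h. apply H0. now apply Cmod_eq_0. }
  assert (H3 : continuous (fun y => / Cmod (g y) ^ 2) x).
  { apply (continuous_comp (fun y => Cmod (g y) ^ 2) Rinv); [easy|].
    now apply continuous_Rinv. }
  apply ccont_ext with (fun y => (Cconj (g y) * RtoC (/ Cmod (g y) ^ 2))%C).
  - intros y. rewrite Cmod2_alt. destruct (g y) as [u v].
    unfold Cinv, Cconj, RtoC, Cmult, Re, Im, Rdiv; simpl. f_equal; ring.
  - apply ccont_mult; [now apply ccont_conj|now apply ccont_RtoC].
Qed.

Lemma ccont_comp {T : UniformSpace} (f : C -> C) (g : T -> C) (x : T) :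
  ccont g x -> @ccont C_UniformSpace f (g x) -> ccont (fun y => f (g y)) x.
Proof.
  intros Hg Hf. apply ccont_iff. apply ccont_iff in Hg. apply ccont_iff in Hf.
  now apply (continuous_comp g f).
Qed.

Lemma ccont_id (z : C) : @ccont C_UniformSpace (fun z => z) z.
Proof. apply (ccont_iff (T := C_UniformSpace)), continuous_id. Qed.

(** * Derivatives and integrals of complex functions of a real variable *)

Definition cderiv (g : R -> C) (t : R) (l : C) : Prop :=
  is_derive (fun s => Re (g s)) t (Re l) /\ is_derive (fun s => Im (g s)) t (Im l).

Lemma cderiv_ext (g h : R -> C) (t : R) (l : C) :
  (forall s, g s = h s) -> cderiv g t l -> cderiv h t l.
Proof.
  intros H [H1 H2]. split; [eapply is_derive_ext; [|exact H1] | eapply is_derive_ext; [|exact H2]];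
    intros y; simpl; now rewrite H.
Qed.

Lemma cderiv_ccont (g : R -> C) (t : R) (l : C) : cderiv g t l -> ccont g t.
Proof.
  intros [H1 H2]. split; apply (ex_derive_continuous (V := R_NormedModule));
    [now exists (Re l)|now exists (Im l)].
Qed.

Lemma cderiv_const (c : C) (t : R) : cderiv (fun _ => c) t 0.
Proof. split; apply (is_derive_const (V := R_NormedModule)). Qed.

Lemma cderiv_plus (g h : R -> C) (t : R) (l m : C) :
  cderiv g t l -> cderiv h t m -> cderiv (fun s => (g s + h s)%C) t (l + m)%C.
Proof.
  intros [H1 H2] [H3 H4]. split; apply (is_derive_plus (V := R_NormedModule)); easy.
Qed.

Lemma cderiv_mult (g h : R -> C) (t : R) (l m : C) :
  cderiv g t l -> cderiv h t m ->
  cderiv (fun s => (g s * h s)%C) t (l * h t + g t * m)%C.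
Proof.
  intros [H1 H2] [H3 H4].
  assert (P : forall (u v : R -> R) a b, is_derive u t a -> is_derive v t b ->
    is_derive (fun s => u s * v s) t (a * v t + u t * b)).
  { intros u v a b Hu Hv. apply (is_derive_mult u v t a b Hu Hv).
    intros; apply Rmult_comm. }
  split.
  - replace (Re _) with ((Re l * Re (h t) + Re (g t) * Re m)
      - (Im l * Im (h t) + Im (g t) * Im m)) by (simpl; unfold Re, Im; ring).
    apply (is_derive_minus (V := R_NormedModule)); now apply P.
  - replace (Im _) with ((Re l * Im (h t) + Re (g t) * Im m)
      + (Im l * Re (h t) + Im (g t) * Re m)) by (simpl; unfold Re, Im; ring).
    apply (is_derive_plus (V := R_NormedModule)); now apply P.
Qed.

Lemma cderiv_scal (c : C) (g : R -> C) (t : R) (l : C) :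
  cderiv g t l -> cderiv (fun s => (c * g s)%C) t (c * l)%C.
Proof.
  intros H. replace (c * l)%C with (0 * g t + c * l)%C by ring.
  apply cderiv_mult; [apply cderiv_const|easy].
Qed.

Lemma cderiv_conj (g : R -> C) (t : R) (l : C) :
  cderiv g t l -> cderiv (fun s => Cconj (g s)) t (Cconj l).
Proof.
  intros [H1 H2]. split; [easy|]. now apply (is_derive_opp (V := R_NormedModule)).
Qed.

Definition circle_int (h : R -> C) : C :=
  (RInt (fun t => Re (h t)) 0 (2 * PI), RInt (fun t => Im (h t)) 0 (2 * PI)).

Lemma ex_RInt_cont (f : R -> R) (a b : R) :
  (forall t, continuous f t) -> ex_RInt f a b.
Proof.
  intros H. apply (ex_RInt_continuous (V := R_CompleteNormedModule)). intros t _. apply H.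
Qed.

Lemma circle_int_ext (g h : R -> C) : (forall t, g t = h t) -> circle_int g = circle_int h.
Proof.
  intros H. unfold circle_int. f_equal; apply RInt_ext; intros t _; now rewrite H.
Qed.

Lemma circle_int_plus (g h : R -> C) : (forall t, ccont g t) -> (forall t, ccont h t) ->
  circle_int (fun t => (g t + h t)%C) = (circle_int g + circle_int h)%C.
Proof.
  intros Hg Hh. unfold circle_int, Cplus; simpl. f_equal.
  - apply (RInt_plus (V := R_CompleteNormedModule) (fun t => Re (g t)) (fun t => Re (h t)));
      apply ex_RInt_cont; intros t; [exact (proj1 (Hg t))|exact (proj1 (Hh t))].
  - apply (RInt_plus (V := R_CompleteNormedModule) (fun t => Im (g t)) (fun t => Im (h t)));
      apply ex_RInt_cont; intros t; [exact (proj2 (Hg t))|exact (proj2 (Hh t))].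
Qed.

Lemma circle_int_scal (c : C) (g : R -> C) : (forall t, ccont g t) ->
  circle_int (fun t => (c * g t)%C) = (c * circle_int g)%C.
Proof.
  intros Hg.
  assert (H1 : ex_RInt (fun t => Re (g t)) 0 (2 * PI))
    by (apply ex_RInt_cont; intros t; exact (proj1 (Hg t))).
  assert (H2 : ex_RInt (fun t => Im (g t)) 0 (2 * PI))
    by (apply ex_RInt_cont; intros t; exact (proj2 (Hg t))).
  unfold circle_int, Cmult; simpl. f_equal.
  - erewrite (RInt_minus (V := R_CompleteNormedModule) (fun t => fst c * Re (g t))
      (fun t => snd c * Im (g t))).
    + rewrite !(RInt_scal (V := R_CompleteNormedModule)) by easy. reflexivity.
    + now apply (ex_RInt_scal (V := R_CompleteNormedModule)).
    + now apply (ex_RInt_scal (V := R_CompleteNormedModule)).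
  - erewrite (RInt_plus (V := R_CompleteNormedModule) (fun t => fst c * Im (g t))
      (fun t => snd c * Re (g t))).
    + rewrite !(RInt_scal (V := R_CompleteNormedModule)) by easy. reflexivity.
    + now apply (ex_RInt_scal (V := R_CompleteNormedModule)).
    + now apply (ex_RInt_scal (V := R_CompleteNormedModule)).
Qed.

Lemma circle_int_minus (g h : R -> C) : (forall t, ccont g t) -> (forall t, ccont h t) ->
  circle_int (fun t => (g t - h t)%C) = (circle_int g - circle_int h)%C.
Proof.
  intros Hg Hh.
  rewrite (circle_int_ext _ (fun t => (g t + (- (1)) * h t)%C)) by (intros; ring).
  rewrite circle_int_plus, circle_int_scal; try easy; [ring|].
  intros t. apply ccont_mult; [apply ccont_const|apply Hh].
Qed.

Lemma circle_int_conj (g : R -> C) : (forall t, ccont g t) ->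
  circle_int (fun t => Cconj (g t)) = Cconj (circle_int g).
Proof.
  intros Hg. unfold circle_int, Cconj; simpl. f_equal.
  apply (RInt_opp (V := R_CompleteNormedModule)).
  apply ex_RInt_cont. intros t. exact (proj2 (Hg t)).
Qed.

Lemma circle_int_const (c : C) : circle_int (fun _ => c) = (2 * PI * c)%C.
Proof.
  unfold circle_int. rewrite !RInt_const. unfold scal; simpl; unfold mult; simpl.
  unfold RtoC, Cmult, Re, Im; simpl. f_equal; ring.
Qed.

Lemma circle_int_derive (g g' : R -> C) :
  (forall t, cderiv g t (g' t)) -> (forall t, ccont g' t) ->
  circle_int g' = (g (2 * PI)%R - g 0%R)%C.
Proof.
  intros Hg Hg'. unfold circle_int. destruct (g (2 * PI)) as [x2 y2] eqn:E2.
  destruct (g 0) as [x0 y0] eqn:E0. unfold Cminus, Cplus, Copp; simpl. f_equal.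
  - apply is_RInt_unique.
    replace (x2 + - x0) with (minus (Re (g (2 * PI))) (Re (g 0)))
      by (rewrite E2, E0; reflexivity).
    apply (is_RInt_derive (V := R_CompleteNormedModule) (fun t => Re (g t)));
      intros t _; [exact (proj1 (Hg t))|exact (proj1 (Hg' t))].
  - apply is_RInt_unique.
    replace (y2 + - y0) with (minus (Im (g (2 * PI))) (Im (g 0)))
      by (rewrite E2, E0; reflexivity).
    apply (is_RInt_derive (V := R_CompleteNormedModule) (fun t => Im (g t)));
      intros t _; [exact (proj2 (Hg t))|exact (proj2 (Hg' t))].
Qed.

(** The factor 2 comes from treating the coordinates separately. It is harmless, as the bound is
    only used in front of powers that tend to 0. *)
Lemma circle_int_bound (h : R -> C) : (forall t, ccont h t) ->
  Cmod (circle_int h) <= 2 * RInt (fun t => Cmod (h t)) 0 (2 * PI).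
Proof.
  intros Hh. assert (HP := PI_RGT_0).
  assert (HC : ex_RInt (fun t => Cmod (h t)) 0 (2 * PI))
    by (apply ex_RInt_cont; intros t; now apply continuous_Cmod).
  assert (H : forall f : R -> R, (forall t, continuous f t) ->
    (forall t, Rabs (f t) <= Cmod (h t)) ->
    Rabs (RInt f 0 (2 * PI)) <= RInt (fun t => Cmod (h t)) 0 (2 * PI)).
  { intros f Hf Hb.
    apply Rle_trans with (RInt (fun t => Rabs (f t)) 0 (2 * PI)).
    - apply (abs_RInt_le f); [lra|now apply ex_RInt_cont].
    - apply RInt_le; [lra| |easy|intros; apply Hb].
      apply ex_RInt_cont. intros t. apply (continuous_comp f Rabs); [apply Hf|].
      apply continuous_Rabs. }
  eapply Rle_trans; [apply Cmod_le_abs|].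
  assert (H1 := H (fun t => Re (h t)) (fun t => proj1 (Hh t)) (fun t => re_le_Cmod _)).
  assert (H2 := H (fun t => Im (h t)) (fun t => proj2 (Hh t)) (fun t => im_le_Cmod _)).
  unfold circle_int. simpl Re. simpl Im. lra.
Qed.

(** * Fourier coefficients on the circle *)

(** The character e^(ikt); negative frequencies carry the antiholomorphic half of a harmonic
    function. *)
Definition cis (k : Z) (t : R) : C := (cos (IZR k * t), sin (IZR k * t)).

Lemma cis_add (k l : Z) (t : R) : cis (k + l) t = (cis k t * cis l t)%C.
Proof.
  unfold cis, Cmult; simpl. rewrite plus_IZR, Rmult_plus_distr_r, cos_plus, sin_plus.
  f_equal; ring.
Qed.

Lemma cis_conj (k : Z) (t : R) : Cconj (cis k t) = cis (- k) t.
Proof.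
  unfold cis, Cconj; simpl. rewrite opp_IZR.
  replace (- IZR k * t) with (- (IZR k * t)) by ring. now rewrite cos_neg, sin_neg.
Qed.

Lemma cis_0 (t : R) : cis 0 t = 1%C.
Proof. unfold cis. rewrite Rmult_0_l, cos_0, sin_0. reflexivity. Qed.

Lemma cis_opp (k : Z) (t : R) : (cis k t * cis (- k) t)%C = 1%C.
Proof. rewrite <- cis_add, Z.add_opp_diag_r. apply cis_0. Qed.

Lemma Cmod_cis (k : Z) (t : R) : Cmod (cis k t) = 1.
Proof.
  assert (H : Cmod (cis k t) ^ 2 = 1).
  { rewrite Cmod2_alt. unfold cis, Re, Im; simpl.
    generalize (sin2_cos2 (IZR k * t)). unfold Rsqr. lra. }
  generalize (Cmod_ge_0 (cis k t)). nra.
Qed.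

Lemma cis_of_nat (n : nat) (t : R) : cis (Z.of_nat n) t = (cis 1 t ^ n)%C.
Proof.
  induction n as [|n IH]; [apply cis_0|].
  rewrite Nat2Z.inj_succ, <- Z.add_1_l, cis_add, IH. reflexivity.
Qed.

Lemma cderiv_cis (k : Z) (t : R) : cderiv (cis k) t (IZR k * Ci * cis k t)%C.
Proof.
  split; unfold cis, Ci, RtoC, Cmult, Re, Im; simpl; auto_derive; trivial; ring.
Qed.

Lemma ccont_cis (k : Z) (t : R) : ccont (cis k) t.
Proof. eapply cderiv_ccont, cderiv_cis. Qed.

Lemma cis_at_0 (k : Z) : cis k 0 = 1%C.
Proof. unfold cis. rewrite Rmult_0_r, cos_0, sin_0. reflexivity. Qed.

Lemma cis_2PI (k : Z) : cis k (2 * PI) = 1%C.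
Proof.
  assert (H : forall n : nat, cis (Z.of_nat n) (2 * PI) = 1%C).
  { intros n. rewrite cis_of_nat. unfold cis. rewrite Rmult_1_l, cos_2PI, sin_2PI.
    apply Cpow_1_l. }
  destruct (Z.le_gt_cases 0 k) as [h|h].
  - rewrite <- (Z2Nat.id k h). apply H.
  - rewrite <- (Z.opp_involutive k), <- cis_conj, <- (Z2Nat.id (- k)) by lia.
    rewrite H. unfold Cconj, RtoC; simpl. f_equal. ring.
Qed.

Lemma circle_int_cis (k : Z) : k <> 0%Z -> circle_int (cis k) = 0%C.
Proof.
  intros Hk.
  assert (Hc : (IZR k * Ci)%C <> 0%C).
  { apply Cmult_neq_0.
    - intros h. apply RtoC_inj in h. now apply eq_IZR in h.
    - intros h. injection h. lra. }
  assert (H : circle_int (fun t => (IZR k * Ci * cis k t)%C) = 0%C).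
  { rewrite (circle_int_derive (cis k)).
    - rewrite cis_2PI, cis_at_0. ring.
    - intros t. apply cderiv_cis.
    - intros t. apply ccont_mult; [apply ccont_const|apply ccont_cis]. }
  rewrite circle_int_scal in H by (intros; apply ccont_cis).
  destruct (classic (circle_int (cis k) = 0%C)) as [|Hn]; [easy|].
  exfalso. now apply (Cmult_neq_0 _ _ Hc Hn).
Qed.

Definition fcoef (h : R -> C) (k : Z) : C :=
  (circle_int (fun t => (h t * cis (- k) t)%C) / RtoC (2 * PI))%C.

Lemma RtoC_2PI_neq_0 : RtoC (2 * PI) <> 0%C.
Proof. intros h. apply RtoC_inj in h. generalize PI_RGT_0. lra. Qed.

Lemma circle_int_fcoef (h : R -> C) (k : Z) :
  circle_int (fun t => (h t * cis (- k) t)%C) = (RtoC (2 * PI) * fcoef h k)%C.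
Proof. unfold fcoef. field. apply RtoC_2PI_neq_0. Qed.

Lemma fcoef_ext (g h : R -> C) (k : Z) : (forall t, g t = h t) -> fcoef g k = fcoef h k.
Proof.
  intros H. unfold fcoef. f_equal. apply circle_int_ext. intros t. now rewrite H.
Qed.

Lemma fcoef_minus (g h : R -> C) (k : Z) :
  (forall t, ccont g t) -> (forall t, ccont h t) ->
  fcoef (fun t => (g t - h t)%C) k = (fcoef g k - fcoef h k)%C.
Proof.
  intros Hg Hh. unfold fcoef, Cdiv.
  rewrite (circle_int_ext _ (fun t => (g t * cis (- k) t - h t * cis (- k) t)%C))
    by (intros; ring).
  rewrite circle_int_minus; [ring| |]; intros t; apply ccont_mult;
    first [exact (Hg t)|exact (Hh t)|apply ccont_cis].
Qed.

Lemma fcoef_scal (c : C) (h : R -> C) (k : Z) : (forall t, ccont h t) ->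
  fcoef (fun t => (c * h t)%C) k = (c * fcoef h k)%C.
Proof.
  intros Hh. unfold fcoef, Cdiv.
  rewrite (circle_int_ext _ (fun t => (c * (h t * cis (- k) t))%C)) by (intros; ring).
  rewrite circle_int_scal; [ring|]. intros t. apply ccont_mult; [exact (Hh t)|apply ccont_cis].
Qed.

Lemma fcoef_conj (h : R -> C) (k : Z) : (forall t, ccont h t) ->
  fcoef (fun t => Cconj (h t)) k = Cconj (fcoef h (- k)).
Proof.
  intros Hh. unfold fcoef.
  rewrite Cdiv_conj by apply RtoC_2PI_neq_0.
  rewrite <- circle_int_conj.
  - f_equal.
    + apply circle_int_ext. intros t. now rewrite Z.opp_involutive, Cmult_conj, cis_conj.
    + unfold Cconj, RtoC; simpl. f_equal. ring.
  - intros t. apply ccont_mult; [exact (Hh t)|apply ccont_cis].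
Qed.

Lemma fcoef_cis (k l : Z) : k <> l -> fcoef (cis k) l = 0%C.
Proof.
  intros H. unfold fcoef. rewrite (circle_int_ext _ (cis (k + - l))).
  - rewrite circle_int_cis by lia. unfold Cdiv. ring.
  - intros t. now rewrite cis_add.
Qed.

Definition energy (h : R -> C) : R := RInt (fun t => Cmod (h t) ^ 2) 0 (2 * PI).

(** Pythagoras: since [Cmod (cis k t) = 1], the square expands into |h|^2 + |c|^2 minus a cross
    term, whose integral is twice that of |c|^2. *)
Lemma energy_remove (h : R -> C) (k : Z) : (forall t, ccont h t) ->
  energy (fun t => (h t - fcoef h k * cis k t)%C)
  = energy h - 2 * PI * Cmod (fcoef h k) ^ 2.
Proof.
  intros Hh. set (c := fcoef h k). unfold energy.
  set (g := fun t => (Cconj c * (h t * cis (- k) t))%C).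
  assert (Hg : forall t, ccont g t).
  { intros t. apply ccont_mult; [apply ccont_const|].
    apply ccont_mult; [exact (Hh t)|apply ccont_cis]. }
  rewrite (RInt_ext _ (fun t => minus (plus (Cmod (h t) ^ 2) (Cmod c ^ 2))
    (scal 2 (Re (g t))))).
  - rewrite (RInt_minus (V := R_CompleteNormedModule)
      (fun t => plus (Cmod (h t) ^ 2) (Cmod c ^ 2)) (fun t => scal 2 (Re (g t)))).
    rewrite (RInt_plus (V := R_CompleteNormedModule) (fun t => Cmod (h t) ^ 2)
      (fun _ => Cmod c ^ 2)).
    rewrite (RInt_scal (V := R_CompleteNormedModule) (fun t => Re (g t))).
    rewrite RInt_const.
    + assert (E : RInt (fun t => Re (g t)) 0 (2 * PI) = 2 * PI * Cmod c ^ 2).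
      { change (Re (circle_int g) = 2 * PI * Cmod c ^ 2). unfold g.
        rewrite circle_int_scal, circle_int_fcoef. fold c.
        - rewrite Cmod2_alt. destruct c as [x y]. unfold Re, Im, Cconj, Cmult; simpl. ring.
        - intros t. apply ccont_mult; [exact (Hh t)|apply ccont_cis]. }
      rewrite E. unfold minus, plus, opp, scal; simpl. unfold mult; simpl. ring.
    + apply ex_RInt_cont. intros t. exact (proj1 (Hg t)).
    + apply ex_RInt_cont. intros t. now apply continuous_Cmod2.
    + apply ex_RInt_const.
    + apply ex_RInt_cont. intros t. apply continuous_Rplus;
        [now apply continuous_Cmod2|apply continuous_const].
    + apply ex_RInt_cont. intros t. apply continuous_Rmult;
        [apply continuous_const|exact (proj1 (Hg t))].
  - intros t _.
    change (Cmod (h t - c * cis k t) ^ 2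
      = Cmod (h t) ^ 2 + Cmod c ^ 2 - 2 * Re (Cconj c * (h t * cis (- k) t))).
    assert (H2 : Cmod (cis k t) ^ 2 = 1) by (rewrite Cmod_cis; ring).
    rewrite <- cis_conj.
    transitivity (Cmod (h t) ^ 2 + Cmod c ^ 2 * Cmod (cis k t) ^ 2
      - 2 * Re (Cconj c * (h t * Cconj (cis k t)))); [|rewrite H2; ring].
    clear H2. rewrite !Cmod2_alt.
    destruct (h t) as [a b], c as [x y], (cis k t) as [u v].
    unfold Re, Im, Cconj, Cmult, Cminus, Copp, Cplus; simpl. ring.
Qed.

Lemma energy_nonneg (h : R -> C) : (forall t, ccont h t) -> 0 <= energy h.
Proof.
  intros Hh. generalize PI_RGT_0; intros. apply RInt_ge_0; [lra| |].
  - apply ex_RInt_cont. intros t. now apply continuous_Cmod2.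
  - intros t _. apply pow2_ge_0.
Qed.

(** Frequencies are removed one at a time. Orthogonality leaves the other coefficients unchanged,
    and the remaining energy is nonnegative. This finite half of Parseval's identity is applied to
    two or four frequencies. *)
Lemma bessel (l : list Z) : NoDup l -> forall h : R -> C, (forall t, ccont h t) ->
  2 * PI * fold_right (fun k s => Cmod (fcoef h k) ^ 2 + s) 0 l <= energy h.
Proof.
  induction 1 as [|k l Hk Hl IH]; intros h Hh; cbn [fold_right].
  - rewrite Rmult_0_r. now apply energy_nonneg.
  - set (g := fun t => (h t - fcoef h k * cis k t)%C).
    assert (Hck : forall t, ccont (fun t => (fcoef h k * cis k t)%C) t)
      by (intros t; apply ccont_mult; [apply ccont_const|apply ccont_cis]).
    assert (Hg : forall t, ccont g t) by (intros t; apply ccont_minus; auto).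
    assert (E : fold_right (fun k s => Cmod (fcoef g k) ^ 2 + s) 0 l
        = fold_right (fun k s => Cmod (fcoef h k) ^ 2 + s) 0 l).
    { clear - Hk Hh Hck. induction l as [|j l IH]; [easy|]. cbn [fold_right].
      rewrite IH by (intros h'; apply Hk; now right).
      do 3 f_equal. unfold g. rewrite fcoef_minus, fcoef_scal, fcoef_cis; auto.
      - ring.
      - intros ->. apply Hk. now left.
      - intros t. apply ccont_cis. }
    generalize (IH g Hg) (energy_remove h k Hh). fold g. rewrite E. lra.
Qed.

Lemma bessel_bounded (l : list Z) (h : R -> C) (M : R) : NoDup l ->
  (forall t, ccont h t) -> (forall t, Cmod (h t) <= M) ->
  fold_right (fun k s => Cmod (fcoef h k) ^ 2 + s) 0 l <= M ^ 2.
Proof.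
  intros Hl Hh HM. generalize PI_RGT_0 (bessel l Hl h Hh). intros HP HB.
  assert (energy h <= 2 * PI * M ^ 2).
  { unfold energy.
    replace (2 * PI * M ^ 2) with (RInt (fun _ => M ^ 2) 0 (2 * PI))
      by (rewrite RInt_const; unfold scal; simpl; unfold mult; simpl; ring).
    apply RInt_le; [lra| |apply ex_RInt_const|].
    - apply ex_RInt_cont. intros t. now apply continuous_Cmod2.
    - intros t _. generalize (HM t) (Cmod_ge_0 (h t)). nra. }
  apply Rmult_le_reg_l with (2 * PI); lra.
Qed.

(** * Partial derivatives on the unit disk and the chain rule along curves *)

Lemma ccont_comp_R {T : UniformSpace} (g : R -> C) (h : T -> R) (x : T) :
  continuous h x -> ccont g (h x) -> ccont (fun y => g (h y)) x.
Proof.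
  intros Hh [H1 H2]. split.
  - exact (continuous_comp h (fun s => Re (g s)) x Hh H1).
  - exact (continuous_comp h (fun s => Im (g s)) x Hh H2).
Qed.

Lemma is_derive_Rid (t : R) : is_derive (fun s : R => s) t 1.
Proof. apply (is_derive_id (K := R_AbsRing)). Qed.

Lemma is_derive_Rconst (c t : R) : is_derive (fun _ : R => c) t 0.
Proof. apply (is_derive_const (V := R_NormedModule)). Qed.

Lemma cderiv_hline (y t : R) : cderiv (fun s => (s, y)) t 1.
Proof. exact (conj (is_derive_Rid t) (is_derive_Rconst y t)). Qed.

Lemma cderiv_vline (x t : R) : cderiv (fun s => (x, s)) t Ci.
Proof. exact (conj (is_derive_Rconst x t) (is_derive_Rid t)). Qed.

Lemma cderiv_RtoC (t : R) : cderiv RtoC t 1.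
Proof. apply cderiv_hline. Qed.

Definition partials (f : C -> C) (z a b : C) : Prop :=
  cderiv (fun t => f (t, Im z)) (Re z) a /\ cderiv (fun t => f (Re z, t)) (Im z) b.

(** The partials are parameters and not [dx f], [dy f], so that formulas such as [Ci * f' z] can
    take their place. *)
Record C1_disk (f fx fy : C -> C) : Prop := {
  C1_partials : forall z, disk 1 z -> partials f z (fx z) (fy z);
  C1_cont : forall z, disk 1 z -> @ccont C_UniformSpace f z;
  C1_cont_x : forall z, disk 1 z -> @ccont C_UniformSpace fx z;
  C1_cont_y : forall z, disk 1 z -> @ccont C_UniformSpace fy z
}.

Lemma disk_locally (r : R) (z : C) : disk r z -> @locally C_UniformSpace z (disk r).
Proof.
  intros Hz. unfold disk in *. apply locally_C. exists (r - Cmod z). split; [lra|].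
  intros y Hy. generalize (Cmod_minus_ge y z). lra.
Qed.

Lemma chain_real (f fx fy : R -> R -> R) (x y : R -> R) (t x' y' : R) :
  locally (x t, y t) (fun u : R * R =>
    is_derive (fun z => f z (snd u)) (fst u) (fx (fst u) (snd u))) ->
  is_derive (fun z => f (x t) z) (y t) (fy (x t) (y t)) ->
  continuous (fun u : R * R => fx (fst u) (snd u)) (x t, y t) ->
  is_derive x t x' -> is_derive y t y' ->
  is_derive (fun s => f (x s) (y s)) t (fx (x t) (y t) * x' + fy (x t) (y t) * y').
Proof.
  intros H1 H2 H3 Hx Hy. apply is_derive_Reals. apply derivable_pt_lim_comp_2d.
  - apply filterdiff_differentiable_pt_lim.
    apply (is_derive_filterdiff f (x t) (y t) fx (fy (x t) (y t))); easy.
  - now apply is_derive_Reals.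
  - now apply is_derive_Reals.
Qed.

Lemma C1_chain (f fx fy : C -> C) (g : R -> C) (t : R) (l : C) :
  C1_disk f fx fy -> disk 1 (g t) -> cderiv g t l ->
  cderiv (fun s => f (g s)) t (fx (g t) * RtoC (Re l) + fy (g t) * RtoC (Im l))%C.
Proof.
  intros Hf Hg [Hg1 Hg2].
  assert (HP := C1_partials _ _ _ Hf).
  assert (Hl := disk_locally 1 _ Hg).
  assert (Hc := C1_cont_x _ _ _ Hf _ Hg).
  assert (Ep : forall z : C, (Re z, Im z) = z) by (intros [u v]; reflexivity).
  split.
  - replace (Re _) with (Re (fx (g t)) * Re l + Re (fy (g t)) * Im l)
      by (unfold Re, Im; simpl; ring).
    apply is_derive_ext with (fun s => Re (f (Re (g s), Im (g s)))).
    { intros s. now rewrite Ep. }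
    rewrite <- (Ep (g t)) at 1 2.
    apply (chain_real (fun x y => Re (f (x, y))) (fun x y => Re (fx (x, y)))
      (fun x y => Re (fy (x, y))) (fun s => Re (g s)) (fun s => Im (g s)) t); try easy.
    + rewrite Ep. revert Hl. apply filter_imp. intros [u v] Hu.
      apply (proj1 (HP _ Hu)).
    + rewrite Ep. apply (proj2 (HP _ Hg)).
    + rewrite Ep. apply continuous_ext with (fun z => Re (fx z)); [|apply Hc].
      now intros [u v].
  - replace (Im _) with (Im (fx (g t)) * Re l + Im (fy (g t)) * Im l)
      by (unfold Re, Im; simpl; ring).
    apply is_derive_ext with (fun s => Im (f (Re (g s), Im (g s)))).
    { intros s. now rewrite Ep. }
    rewrite <- (Ep (g t)) at 1 2.
    apply (chain_real (fun x y => Im (f (x, y))) (fun x y => Im (fx (x, y)))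
      (fun x y => Im (fy (x, y))) (fun s => Re (g s)) (fun s => Im (g s)) t); try easy.
    + rewrite Ep. revert Hl. apply filter_imp. intros [u v] Hu.
      apply (proj1 (HP _ Hu)).
    + rewrite Ep. apply (proj2 (HP _ Hg)).
    + rewrite Ep. apply continuous_ext with (fun z => Im (fx z)); [|apply Hc].
      now intros [u v].
Qed.

(** * Holomorphic functions: Cauchy's formula *)

(** The Cauchy-Riemann equation f_y = i f_x. Continuity of [f'] is built in, which permits
    differentiation under the integral sign. *)
Definition hol (f f' : C -> C) : Prop := C1_disk f f' (fun z => (Ci * f' z)%C).

Lemma hol_chain (f f' : C -> C) (g : R -> C) (t : R) (l : C) :
  hol f f' -> disk 1 (g t) -> cderiv g t l -> cderiv (fun s => f (g s)) t (f' (g t) * l)%C.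
Proof.
  intros Hf Hg Hl. assert (H := C1_chain _ _ _ _ _ _ Hf Hg Hl).
  replace (f' (g t) * l)%C with (f' (g t) * RtoC (Re l) + Ci * f' (g t) * RtoC (Im l))%C;
    [easy|]. destruct (f' (g t)), l. unfold Ci, RtoC, Cmult, Cplus, Re, Im; simpl. f_equal; ring.
Qed.

Lemma hol_mult_id (f f' : C -> C) : hol f f' ->
  hol (fun z => (z * f z)%C) (fun z => (f z + z * f' z)%C).
Proof.
  intros [HP H0 Hx Hy]. split.
  - intros z Hz. destruct (HP z Hz) as [H1 H2]. split.
    + replace (f z + z * f' z)%C with (1 * f (Re z, Im z) + (Re z, Im z) * f' z)%C
        by (destruct z; unfold Re, Im; simpl; ring).
      apply (cderiv_mult (fun t => (t, Im z)) (fun t => f (t, Im z))); [|easy].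
      apply cderiv_hline.
    + replace (Ci * (f z + z * f' z))%C
        with (Ci * f (Re z, Im z) + (Re z, Im z) * (Ci * f' z))%C
        by (destruct z; unfold Re, Im; simpl; ring).
      apply (cderiv_mult (fun t => (Re z, t)) (fun t => f (Re z, t))); [|easy].
      apply cderiv_vline.
  - intros z Hz. apply ccont_mult; [apply ccont_id|auto].
  - intros z Hz. apply ccont_plus; [auto|]. apply ccont_mult; [apply ccont_id|auto].
  - intros z Hz. apply ccont_mult; [apply ccont_const|].
    apply ccont_plus; [auto|]. apply ccont_mult; [apply ccont_id|auto].
Qed.

Lemma hol_mult_pow (n : nat) (f f' : C -> C) : hol f f' ->
  exists g', hol (fun z => (z ^ n * f z)%C) g'.
Proof.
  induction n as [|n IH]; intros Hf.
  - exists f'. destruct Hf as [HP H0 Hx Hy]. split; [|intros z Hz|easy|easy].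
    + intros z Hz. destruct (HP z Hz) as [H1 H2].
      split; [eapply cderiv_ext; [|exact H1]|eapply cderiv_ext; [|exact H2]];
        intros s; simpl; ring.
    + eapply ccont_ext; [|apply (H0 z Hz)]. intros y; simpl; ring.
  - destruct (IH Hf) as [g' Hg]. exists (fun z => (z ^ n * f z + z * g' z)%C).
    destruct (hol_mult_id _ _ Hg) as [HP H0 Hx Hy]. split; [|intros z Hz|easy|easy].
    + intros z Hz. destruct (HP z Hz) as [H1 H2].
      split; [eapply cderiv_ext; [|exact H1]|eapply cderiv_ext; [|exact H2]];
        intros s; simpl; ring.
    + eapply ccont_ext; [|apply (H0 z Hz)]. intros y; simpl; ring.
Qed.

Definition circ (r : R) (t : R) : C := (r * cis 1 t)%C.

Lemma Cmod_circ (r t : R) : 0 <= r -> Cmod (circ r t) = r.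
Proof. intros. unfold circ. rewrite Cmod_mult, Cmod_R, Cmod_cis, Rabs_pos_eq; lra. Qed.

Lemma cderiv_circ (r t : R) : cderiv (circ r) t (Ci * circ r t)%C.
Proof.
  replace (Ci * circ r t)%C with (r * (IZR 1 * Ci * cis 1 t))%C by (unfold circ; ring).
  apply cderiv_scal, cderiv_cis.
Qed.

Lemma ccont_circ (r t : R) : ccont (circ r) t.
Proof. eapply cderiv_ccont, cderiv_circ. Qed.

(** The margin lets [s] run over an open interval around [[0, 1]], so that derivatives in [s] at 0
    and 1 are two-sided. It is chosen so that the modulus stays below [r * (2 - r) < 1] or equals it
    at most. *)
Lemma disk_segment (a w : C) (r s : R) : Cmod a < r -> Cmod w = r -> r < 1 ->
  - ((1 - r) / 2) < s < 1 + (1 - r) / 2 -> disk 1 (a + s * (w - a))%C.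
Proof.
  intros Ha Hw Hr Hs. unfold disk.
  replace (a + s * (w - a))%C with (RtoC (1 - s) * a + s * w)%C
    by (rewrite RtoC_minus; ring).
  eapply Rle_lt_trans; [apply Cmod_triangle|]. rewrite !Cmod_mult, !Cmod_R, Hw.
  generalize (Cmod_ge_0 a). intros.
  assert (Rabs (1 - s) + Rabs s < 1 + (1 - r)).
  { unfold Rabs. destruct (Rcase_abs (1 - s)), (Rcase_abs s); lra. }
  assert (Rabs (1 - s) * Cmod a <= Rabs (1 - s) * r)
    by (apply Rmult_le_compat_l; [apply Rabs_pos|lra]).
  generalize (Rabs_pos s) (Rabs_pos (1 - s)). nra.
Qed.

(* The integral of [f (a + s (w - a)) k], [w] on the circle, has derivative in
   [s] the integral of [c w f' (a + s (w - a))], which vanishes because the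
   integrand is the derivative of a periodic function. *)
Lemma cauchy_homotopy (f f' : C -> C) (r : R) (a c : C) (k : R -> C) :
  hol f f' -> Cmod a < r < 1 -> (forall t, ccont k t) ->
  (forall t, ((circ r t - a) * k t = c * circ r t)%C) ->
  RInt (fun t => Re (f (circ r t) * k t)%C) 0 (2 * PI)
  = RInt (fun t => Re (f a * k t)%C) 0 (2 * PI).
Proof.
  intros Hf Hr Hk Ek.
  assert (Hr0 : 0 <= r) by (generalize (Cmod_ge_0 a); lra).
  set (g := fun (s t : R) => (a + s * (circ r t - a))%C).
  set (H := fun s t => Re (f (g s t) * k t)%C).
  set (J := fun s => RInt (fun t => H s t) 0 (2 * PI)).
  set (d := (1 - r) / 2). assert (Hd : 0 < d) by (unfold d; lra).
  assert (Hin : forall s t, - d < s < 1 + d -> disk 1 (g s t)).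
  { intros s t Hs. apply (disk_segment a (circ r t) r s); try easy. now apply Cmod_circ. }
  assert (Hgs : forall s t, cderiv (fun u => g u t) s (circ r t - a)%C).
  { intros s t. replace (circ r t - a)%C with (0 + (1 * (circ r t - a) + s * 0))%C by ring.
    apply cderiv_plus; [apply cderiv_const|].
    apply (cderiv_mult RtoC); [apply cderiv_RtoC|apply cderiv_const]. }
  assert (HHs : forall s t, - d < s < 1 + d ->
    is_derive (fun u => H u t) s (Re (c * (f' (g s t) * circ r t))%C)).
  { intros s t Hs.
    replace (c * (f' (g s t) * circ r t))%C
      with (f' (g s t) * (circ r t - a) * k t + f (g s t) * 0)%C.
    - apply (cderiv_mult (fun u => f (g u t)) (fun _ => k t)); [|apply cderiv_const].
      apply (hol_chain f f' (fun u => g u t)); auto.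
    - rewrite <- Cmult_assoc, Ek. ring. }
  assert (Hct : forall s t, ccont (fun u => g s u) t).
  { intros s t. apply ccont_plus; [apply ccont_const|].
    apply ccont_mult; [apply ccont_const|].
    apply ccont_minus; [apply ccont_circ|apply ccont_const]. }
  assert (HJ : forall s, 0 <= s <= 1 -> is_derive J s 0).
  { intros s Hs.
    assert (Hnear : forall Q : R -> Prop, (forall u, - d < u < 1 + d -> Q u) -> locally s Q).
    { intros Q HQ. exists (mkposreal d Hd). intros u Hu. apply HQ.
      change (Rabs (u - s) < d) in Hu. apply Rabs_def2 in Hu. lra. }
    replace 0 with (RInt (fun t => Derive (fun u => H u t) s) 0 (2 * PI)).
    - apply is_derive_RInt_param.
      + apply Hnear. intros u Hu t _. eexists. apply (HHs u t Hu).
      + intros t _.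
        apply continuity_2d_pt_ext_loc with
          (fun u v => Re (c * (f' (g u v) * circ r v))%C).
        { exists (mkposreal d Hd). intros u v Hu _. simpl in Hu.
          apply Rabs_def2 in Hu. symmetry. apply is_derive_unique, HHs. lra. }
        apply continuity_2d_pt_filterlim.
        assert (HC : ccont (fun u : R * R => (c * (f' (g (fst u) (snd u)) * circ r (snd u)))%C) (s, t)).
        { assert (Hw : ccont (fun u : R * R => circ r (snd u)) (s, t)).
          { apply (ccont_comp_R (circ r) (fun u : R * R => snd u)); [|apply ccont_circ].
            apply (continuous_snd (U := R_UniformSpace) (V := R_UniformSpace)). }
          apply ccont_mult; [apply ccont_const|]. apply ccont_mult; [|exact Hw].
          apply (ccont_comp f' (fun u : R * R => g (fst u) (snd u))).
          - apply ccont_plus; [apply ccont_const|]. apply ccont_mult.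
            + apply (ccont_RtoC (fun u : R * R => fst u)).
              apply (continuous_fst (U := R_UniformSpace) (V := R_UniformSpace)).
            + apply ccont_minus; [exact Hw|apply ccont_const].
          - apply (C1_cont_x _ _ _ Hf). apply Hin. simpl. lra. }
        exact (proj1 HC).
      + apply Hnear. intros u Hu. apply ex_RInt_cont. intros t.
        assert (HC : ccont (fun v => (f (g u v) * k v)%C) t).
        { apply ccont_mult; [|auto]. apply (ccont_comp f (fun v => g u v)); [auto|].
          apply (C1_cont _ _ _ Hf). now apply Hin. }
        exact (proj1 HC).
    - rewrite (RInt_ext _ (fun t => Re (c * (f' (g s t) * circ r t))%C)).
      2:{ intros t _. apply is_derive_unique, HHs. lra. }
      assert (HC : forall t, ccont (fun v => (f' (g s v) * circ r v)%C) t).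
      { intros t. apply ccont_mult; [|apply ccont_circ].
        apply (ccont_comp f' (fun v => g s v)); [auto|].
        apply (C1_cont_x _ _ _ Hf). apply Hin. lra. }
      change (Re (circle_int (fun t => (c * (f' (g s t) * circ r t))%C)) = 0).
      rewrite circle_int_scal by exact HC.
      replace (circle_int _) with (RtoC 0); [unfold RtoC, Cmult, Re; simpl; ring|symmetry].
      assert (E2 : circ r (2 * PI) = circ r 0)
        by (unfold circ; now rewrite cis_2PI, cis_at_0).
      (* The primitive [f (g s t) / (s * Ci)] is lost at [s = 0]; there [f'] is evaluated at the
         fixed point [a] and the integrand is a constant multiple of the derivative of [circ r]. *)
      destruct (Req_dec s 0) as [->|Hs0].
      + rewrite (circle_int_ext _ (fun t => (f' a / Ci * (Ci * circ r t))%C)).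
        * assert (HCi : forall t, ccont (fun t => (Ci * circ r t)%C) t)
            by (intros t; apply ccont_mult; [apply ccont_const|apply ccont_circ]).
          rewrite circle_int_scal, (circle_int_derive (circ r)); try easy.
          -- rewrite E2. ring.
          -- apply cderiv_circ.
        * intros t. replace (g 0 t) with a by (unfold g; ring). field.
          intros h. injection h. lra.
      + assert (Hsc : (s * Ci)%C <> 0%C).
        { apply Cmult_neq_0; [|intros h; injection h; lra].
          intros h. now apply RtoC_inj in h. }
        assert (E : circle_int (fun t => (s * Ci * (f' (g s t) * circ r t))%C) = 0%C).
        { rewrite (circle_int_derive (fun t => f (g s t))).
          - unfold g. rewrite E2. ring.
          - intros t.
            replace (s * Ci * (f' (g s t) * circ r t))%C
              with (f' (g s t) * (0 + s * (Ci * circ r t)))%C by ring.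
            apply (hol_chain f f' (fun v => g s v)); [easy|apply Hin; lra|].
            apply cderiv_plus; [apply cderiv_const|]. apply cderiv_scal.
            replace (Ci * circ r t)%C with (Ci * circ r t + 0)%C by ring.
            apply (cderiv_plus (circ r) (fun _ => (- a)%C)); [apply cderiv_circ|apply cderiv_const].
          - intros t. apply ccont_mult; [apply ccont_const|apply HC]. }
        rewrite circle_int_scal in E by exact HC.
        destruct (classic (circle_int (fun t => (f' (g s t) * circ r t)%C) = 0%C)) as [|Hn]; [easy|].
        exfalso. now apply (Cmult_neq_0 _ _ Hsc Hn). }
  transitivity (J 1).
  - apply RInt_ext. intros t _. unfold H. do 3 f_equal. unfold g. ring.
  - rewrite <- (eq_is_derive J 0 1 HJ) by lra.
    apply RInt_ext. intros t _. unfold H. do 3 f_equal. unfold g. ring.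
Qed.

Lemma cauchy_circle_int (f f' : C -> C) (r : R) (a : C) (k : R -> C) :
  hol f f' -> Cmod a < r < 1 -> (forall t, ccont k t) ->
  (forall t, ((circ r t - a) * k t = circ r t)%C) ->
  circle_int (fun t => (f (circ r t) * k t)%C) = (f a * circle_int k)%C.
Proof.
  intros Hf Hr Hk Ek. rewrite <- circle_int_scal by easy. unfold circle_int. f_equal.
  - apply (cauchy_homotopy f f' r a 1 k); try easy. intros t. rewrite Ek. ring.
  (* The imaginary part of x is the real part of -i x, so the same lemma applies to the kernel
     [- Ci * k]; this is why it carries the constant [c]. *)
  - assert (E := cauchy_homotopy f f' r a (- Ci) (fun t => (- Ci * k t)%C) Hf Hr).
    rewrite (RInt_ext _ (fun t => Re (f (circ r t) * (- Ci * k t))%C)).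
    + rewrite E.
      * apply RInt_ext. intros t _. destruct (f a), (k t).
        unfold Ci, Copp, Cmult, Re, Im; simpl. ring.
      * intros t. apply ccont_mult; [apply ccont_const|auto].
      * intros t. rewrite <- (Ek t) at 2. ring.
    + intros t _. destruct (f (circ r t)), (k t).
      unfold Ci, Copp, Cmult, Re, Im; simpl. ring.
Qed.

Fixpoint csum (u : nat -> C) (N : nat) : C :=
  match N with O => 0%C | S n => (csum u n + u n)%C end.

Lemma csum_ext (u v : nat -> C) (N : nat) : (forall n, u n = v n) -> csum u N = csum v N.
Proof. intros H. induction N as [|N IH]; simpl; now rewrite ?IH, ?H. Qed.

Lemma csum_scal (c : C) (u : nat -> C) (N : nat) :
  csum (fun n => (c * u n)%C) N = (c * csum u N)%C.
Proof. induction N as [|N IH]; simpl; [ring|]. rewrite IH. ring. Qed.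

(** The kernel satisfies [k = 1 + a / r * cis (-1) * k]. Substituting this [N] times gives the
    geometric expansion with an exact remainder, so no sum and integral have to be interchanged. *)
Lemma kernel_expansion (r : R) (a : C) (k h : R -> C) (N : nat) :
  0 < r -> (forall t, ccont k t) -> (forall t, ccont h t) ->
  (forall t, ((circ r t - a) * k t = circ r t)%C) ->
  circle_int (fun t => (h t * k t)%C)
  = (csum (fun n => (a / r) ^ n * circle_int (fun t => h t * cis (- Z.of_nat n) t)) N
    + (a / r) ^ N * circle_int (fun t => h t * cis (- Z.of_nat N) t * k t))%C.
Proof.
  intros Hr Hk Hh Ek.
  assert (Hr' : RtoC r <> 0%C) by (intros e; apply RtoC_inj in e; lra).
  assert (Hhc : forall n t, ccont (fun t => (h t * cis n t)%C) t)
    by (intros n t; apply ccont_mult; [exact (Hh t)|apply ccont_cis]).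
  assert (Ek' : forall t, k t = (1 + a / r * cis (- (1)) t * k t)%C).
  { intros t. transitivity (circ r t * k t * cis (- (1)) t / r)%C.
    - unfold circ. transitivity (r * (cis 1 t * cis (- (1)) t) * k t / r)%C;
        [rewrite cis_opp|]; field; easy.
    - replace (circ r t * k t)%C with (circ r t + a * k t)%C
        by (rewrite <- (Ek t) at 1; ring).
      unfold circ. transitivity ((cis 1 t * cis (- (1)) t) + a / r * cis (- (1)) t * k t)%C;
        [field; easy|rewrite cis_opp; easy]. }
  induction N as [|N IH].
  - simpl csum. rewrite (circle_int_ext (fun t => h t * k t)%C (fun t => (h t * cis (- Z.of_nat 0) t * k t)%C)).
    + simpl. ring.
    + intros t. simpl. rewrite cis_0. ring.
  - rewrite IH. cbn [csum]. rewrite <- Cplus_assoc. f_equal.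
    rewrite (circle_int_ext _ (fun t => (h t * cis (- Z.of_nat N) t
      + a / r * (h t * cis (- Z.of_nat (S N)) t * k t))%C)).
    + rewrite circle_int_plus, circle_int_scal.
      * rewrite Cpow_S. ring.
      * intros t. apply ccont_mult; [apply Hhc|exact (Hk t)].
      * intros t. apply Hhc.
      * intros t. apply ccont_mult; [apply ccont_const|].
        apply ccont_mult; [apply Hhc|exact (Hk t)].
    + intros t. rewrite (Ek' t) at 1.
      replace (- Z.of_nat (S N))%Z with (- Z.of_nat N + - (1))%Z by lia.
      rewrite cis_add. ring.
Qed.

Lemma kernel_remainder (r : R) (k h : R -> C) (n : Z) :
  (forall t, ccont k t) -> (forall t, ccont h t) ->
  Cmod (circle_int (fun t => (h t * cis n t * k t)%C))
  <= 2 * RInt (fun t => Cmod (h t * k t)) 0 (2 * PI).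
Proof.
  intros Hk Hh. eapply Rle_trans; [apply circle_int_bound|].
  - intros t. apply ccont_mult; [|exact (Hk t)].
    apply ccont_mult; [exact (Hh t)|apply ccont_cis].
  - apply Req_le. f_equal. apply RInt_ext. intros t _.
    change (@eq R (Cmod (h t * cis n t * k t)) (Cmod (h t * k t))).
    rewrite !Cmod_mult, Cmod_cis. ring.
Qed.

Lemma geometric_zero (x A K : R) : 0 <= x < 1 ->
  (forall N, A <= K * x ^ N) -> A <= 0.
Proof.
  intros Hx H.
  apply (is_lim_seq_le (fun _ => A) (fun N => K * x ^ N) A 0 H).
  - apply is_lim_seq_const.
  - replace (Finite 0) with (Rbar_mult K 0) by (simpl; f_equal; ring).
    apply is_lim_seq_scal_l, is_lim_seq_geom. rewrite Rabs_pos_eq; lra.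
Qed.

(** The kernel is [circ r t / (circ r t - a)]. Its integral follows from its own expansion against
    the constant 1, in which only frequency 0 survives. *)
Lemma cauchy_kernel (r : R) (a : C) : Cmod a < r ->
  exists k : R -> C, (forall t, ccont k t) /\
    (forall t, ((circ r t - a) * k t = circ r t)%C) /\ circle_int k = RtoC (2 * PI).
Proof.
  intros Ha. assert (Hr : 0 < r) by (generalize (Cmod_ge_0 a); lra).
  assert (Hn : forall t, (circ r t - a)%C <> 0%C).
  { intros t h. generalize (Cmod_minus_ge (circ r t) a).
    rewrite h, Cmod_0, Cmod_circ; lra. }
  set (k := fun t => (circ r t * / (circ r t - a))%C).
  assert (Hk : forall t, ccont k t).
  { intros t. apply ccont_mult; [apply ccont_circ|]. apply ccont_inv; [|apply Hn].
    apply ccont_minus; [apply ccont_circ|apply ccont_const]. }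
  assert (Ek : forall t, ((circ r t - a) * k t = circ r t)%C)
    by (intros t; unfold k; field; apply Hn).
  assert (H1 : forall t : R, ccont (fun _ : R => RtoC 1) t) by (intros; apply ccont_const).
  exists k. split; [easy|split; [easy|]].
  apply Ceq_minus, Cmod_eq_0, Rle_antisym; [|apply Cmod_ge_0].
  assert (Hx : 0 <= Cmod a / r < 1).
  { split; [apply Rdiv_le_0_compat; [apply Cmod_ge_0|easy]|].
    apply Rmult_lt_reg_r with r; [easy|]. unfold Rdiv. rewrite Rmult_assoc, Rinv_l; lra. }
  apply (geometric_zero (Cmod a / r) _
    (2 * RInt (fun t => Cmod (1 * k t)) 0 (2 * PI) * (Cmod a / r)) Hx).
  intros N.
  (* With [S N] terms the one for [n = 0], the only nonzero one, is always present. *)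
  assert (E := kernel_expansion r a k (fun _ => 1%C) (S N) Hr Hk H1 Ek).
  rewrite (circle_int_ext _ k) in E by (intros; ring).
  assert (Es : forall N, csum (fun n => (a / r) ^ n
    * circle_int (fun t => 1 * cis (- Z.of_nat n) t))%C (S N) = RtoC (2 * PI)).
  { induction N0 as [|m IH].
    - simpl. rewrite (circle_int_ext _ (fun _ => 1%C)) by (intros; rewrite cis_0; ring).
      rewrite circle_int_const, RtoC_mult. ring.
    - change (csum ?u (S (S m))) with (csum u (S m) + u (S m))%C. cbv beta.
      rewrite IH, (circle_int_ext _ (cis (- Z.of_nat (S m)))) by (intros; ring).
      rewrite circle_int_cis by lia. ring. }
  rewrite E, Es.
  replace (RtoC (2 * PI) + _ - RtoC (2 * PI))%C with
    ((a / r) ^ S N * circle_int (fun t => (1 * cis (- Z.of_nat (S N)) t * k t)))%C by ring.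
  rewrite Cmod_mult, Cmod_pow, Cmod_div, Cmod_R, Rabs_pos_eq
    by (try lra; intros h; apply RtoC_inj in h; lra).
  generalize (kernel_remainder r k (fun _ => 1%C) (- Z.of_nat (S N)) Hk H1).
  intros HR. simpl pow.
  assert (0 <= Cmod a / r * (Cmod a / r) ^ N)
    by (apply Rmult_le_pos; [lra|apply pow_le; lra]). nra.
Qed.

(** Cauchy's formula on the circle of radius [r] combined with the kernel expansion. [K] may depend
    on [a] and [r]; what counts is that it is the same for all [N]. *)
Lemma hol_taylor (f f' : C -> C) (r : R) (a : C) : hol f f' -> Cmod a < r < 1 ->
  exists K, forall N,
  Cmod (f a - csum (fun n => (a / r) ^ n * fcoef (fun t => f (circ r t)) (Z.of_nat n)) N)%C
  <= K * (Cmod a / r) ^ N.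
Proof.
  intros Hf Ha. assert (Hr : 0 < r) by (generalize (Cmod_ge_0 a); lra).
  destruct (cauchy_kernel r a (proj1 Ha)) as [k [Hk [Ek Ik]]].
  set (h := fun t => f (circ r t)).
  assert (Hh : forall t, ccont h t).
  { intros t. apply (ccont_comp f (circ r)); [apply ccont_circ|].
    apply (C1_cont _ _ _ Hf). unfold disk. rewrite Cmod_circ; lra. }
  exists (2 * RInt (fun t => Cmod (h t * k t)) 0 (2 * PI) / (2 * PI)). intros N.
  assert (E : circle_int (fun t => (h t * k t)%C) = (f a * circle_int k)%C)
    by exact (cauchy_circle_int f f' r a k Hf Ha Hk Ek).
  rewrite Ik, (kernel_expansion r a k h N Hr Hk Hh Ek) in E.
  assert (HP := RtoC_2PI_neq_0).
  replace (f a - _)%C with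
    ((a / r) ^ N * circle_int (fun t => h t * cis (- Z.of_nat N) t * k t) / RtoC (2 * PI))%C.
  - rewrite Cmod_div by easy. rewrite Cmod_mult, Cmod_pow, Cmod_div by
      (intros e; apply RtoC_inj in e; lra).
    rewrite !Cmod_R, !Rabs_pos_eq by (generalize PI_RGT_0; lra).
    generalize (kernel_remainder r k h (- Z.of_nat N) Hk Hh). intros HR.
    assert (0 < / (2 * PI)) by (apply Rinv_0_lt_compat; generalize PI_RGT_0; lra).
    assert (0 <= (Cmod a / r) ^ N).
    { apply pow_le, Rdiv_le_0_compat; [apply Cmod_ge_0|easy]. }
    set (X := (Cmod a / r) ^ N) in *. set (B := RInt _ _ _) in *.
    apply Rle_trans with (X * (2 * B) * / (2 * PI)); [|right; unfold Rdiv; ring].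
    apply Rmult_le_compat_r; [lra|]. now apply Rmult_le_compat_l.
  - transitivity ((f a * RtoC (2 * PI)) / RtoC (2 * PI)
      - csum (fun n => (a / r) ^ n * fcoef h (Z.of_nat n)) N)%C; [|field; easy].
    rewrite <- E.
    rewrite (csum_ext _ (fun n => RtoC (2 * PI) * ((a / r) ^ n * fcoef h (Z.of_nat n)))%C)
      by (intros n; rewrite circle_int_fcoef; ring).
    rewrite csum_scal. field. easy.
Qed.

(** * Harmonic functions *)

(* [G = h + conj g] with [h' = phi] and [g' = psi]. *)
Record harmonic_pair (G phi psi : C -> C) : Prop := {
  hp_C1 : C1_disk G (fun z => (phi z + Cconj (psi z))%C)
                    (fun z => (Ci * (phi z - Cconj (psi z)))%C);
  hp_phi : exists phi', hol phi phi';
  hp_psi : exists psi', hol psi psi'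
}.

(** Conjugation exchanges the two halves, so whatever is shown for [phi] transfers to [psi]. *)
Lemma hp_conj (G phi psi : C -> C) : harmonic_pair G phi psi ->
  harmonic_pair (fun z => Cconj (G z)) psi phi.
Proof.
  intros [[HP H0 Hx Hy] Hphi Hpsi]. split; [split| |]; try easy.
  - intros z Hz. destruct (HP z Hz) as [H1 H2]. split.
    + replace (psi z + Cconj (phi z))%C with (Cconj (phi z + Cconj (psi z)))%C
        by (rewrite Cplus_conj, Cconj_conj; ring).
      now apply (cderiv_conj (fun t => G (t, Im z))).
    + replace (Ci * (psi z - Cconj (phi z)))%C
        with (Cconj (Ci * (phi z - Cconj (psi z))))%C.
      * now apply (cderiv_conj (fun t => G (Re z, t))).
      * rewrite Cmult_conj, Cminus_conj, Cconj_conj.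
        replace (Cconj Ci) with (- Ci)%C
          by (unfold Ci, Cconj, Copp; simpl; f_equal; ring). ring.
  - intros z Hz. apply ccont_conj; auto.
  - intros z Hz. eapply ccont_ext; [|apply ccont_conj, (Hx z Hz)].
    intros y. cbv beta. rewrite Cplus_conj, Cconj_conj. ring.
  - intros z Hz. eapply ccont_ext; [|apply ccont_conj, (Hy z Hz)].
    intros y. cbv beta. rewrite Cmult_conj, Cminus_conj, Cconj_conj.
    replace (Cconj Ci) with (- Ci)%C
      by (unfold Ci, Cconj, Copp; simpl; f_equal; ring). ring.
Qed.

Lemma partials_unique (f : C -> C) (z a b : C) : partials f z a b ->
  dx f z = a /\ dy f z = b.
Proof.
  destruct a, b. intros [[H1 H2] [H3 H4]].
  split; unfold dx, dy; f_equal; now apply is_derive_unique.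
Qed.

Lemma Cn_on_partials (n : nat) (f : C -> C) (z : C) :
  Cn_on (S n) (disk 1) f -> disk 1 z -> partials f z (dx f z) (dy f z).
Proof.
  intros [_ [H _]] Hz. destruct (H z Hz) as [H1 [H2 [H3 H4]]].
  split; split; unfold dx, dy, Re, Im; simpl; now apply Derive_correct.
Qed.

Lemma Cn_on_ccont (n : nat) (f : C -> C) (z : C) :
  Cn_on n (disk 1) f -> disk 1 z -> @ccont C_UniformSpace f z.
Proof. intros H Hz. apply ccont_iff. destruct n; now apply H. Qed.

Lemma Cn_on_C1 (n : nat) (f : C -> C) :
  Cn_on (S n) (disk 1) f -> C1_disk f (dx f) (dy f).
Proof.
  intros H. split; intros z Hz.
  - now apply (Cn_on_partials n).
  - now apply (Cn_on_ccont (S n)).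
  - destruct H as [_ [_ [Hx _]]]. now apply (Cn_on_ccont n).
  - destruct H as [_ [_ [_ Hy]]]. now apply (Cn_on_ccont n).
Qed.

Lemma partials_lin (f g : C -> C) (z a b a' b' c d : C) :
  partials f z a b -> partials g z a' b' ->
  partials (fun z => (c * f z + d * g z)%C) z (c * a + d * a')%C (c * b + d * b')%C.
Proof.
  intros [H1 H2] [H3 H4]. split.
  - apply (cderiv_plus (fun t => (c * f (t, Im z))%C) (fun t => (d * g (t, Im z))%C));
      [now apply (cderiv_scal c (fun t => f (t, Im z)))|now apply (cderiv_scal d (fun t => g (t, Im z)))].
  - apply (cderiv_plus (fun t => (c * f (Re z, t))%C) (fun t => (d * g (Re z, t))%C));
      [now apply (cderiv_scal c (fun t => f (Re z, t)))|now apply (cderiv_scal d (fun t => g (Re z, t)))].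
Qed.

Lemma partials_ext (f g : C -> C) (z a b : C) : (forall y, f y = g y) ->
  partials f z a b -> partials g z a b.
Proof.
  intros E [H1 H2].
  split; [eapply cderiv_ext; [|exact H1]|eapply cderiv_ext; [|exact H2]]; intros s; apply E.
Qed.

Lemma mixed_partials (f : C -> C) (z : C) : Cn_on 2 (disk 1) f -> disk 1 z ->
  dx (dy f) z = dy (dx f) z.
Proof.
  intros [H0 [H1 [[Hxc [Hx [Hxx Hxy]]] [Hyc [Hy [Hyx Hyy]]]]]] Hz.
  assert (Hloc : locally_2d (fun u v => disk 1 (u, v)) (Re z) (Im z)).
  { apply locally_2d_locally. generalize (disk_locally 1 z Hz).
    replace (Re z, Im z) with z by now destruct z.
    apply filter_imp. now intros [u v]. }
  assert (Cx := Cn_on_ccont 0 _ z Hyx Hz). assert (Cy := Cn_on_ccont 0 _ z Hxy Hz).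
  assert (Ez : z = (Re z, Im z)) by now destruct z.
  apply injective_projections.
  - apply (Schwarz (fun x y => Re (f (x, y))) (Re z) (Im z)).
    + revert Hloc. apply locally_2d_impl, locally_2d_forall. intros u v Huv.
      destruct (H1 _ Huv) as [h1 [h2 [h3 h4]]]. destruct (Hx _ Huv) as [h5 [h6 [h7 h8]]].
      destruct (Hy _ Huv) as [h9 [h10 [h11 h12]]]. repeat split; easy.
    + apply continuity_2d_pt_filterlim.
      apply (continuous_ext (fun u : R * R => Re (dx (dy f) u))); [now intros [u v]|].
      rewrite <- Ez. apply Cx.
    + apply continuity_2d_pt_filterlim.
      apply (continuous_ext (fun u : R * R => Re (dy (dx f) u))); [now intros [u v]|].
      rewrite <- Ez. apply Cy.
  - apply (Schwarz (fun x y => Im (f (x, y))) (Re z) (Im z)).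
    + revert Hloc. apply locally_2d_impl, locally_2d_forall. intros u v Huv.
      destruct (H1 _ Huv) as [h1 [h2 [h3 h4]]]. destruct (Hx _ Huv) as [h5 [h6 [h7 h8]]].
      destruct (Hy _ Huv) as [h9 [h10 [h11 h12]]]. repeat split; easy.
    + apply continuity_2d_pt_filterlim.
      apply (continuous_ext (fun u : R * R => Im (dx (dy f) u))); [now intros [u v]|].
      rewrite <- Ez. apply Cx.
    + apply continuity_2d_pt_filterlim.
      apply (continuous_ext (fun u : R * R => Im (dy (dx f) u))); [now intros [u v]|].
      rewrite <- Ez. apply Cy.
Qed.

Lemma two_neq_0 : RtoC 2 <> 0%C.
Proof. intros h. apply RtoC_inj in h. lra. Qed.

Lemma Ci_sqr : (Ci * Ci)%C = (- (1))%C.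
Proof. unfold Ci, Cmult, Copp, RtoC; simpl. f_equal; ring. Qed.

(** With equal mixed partials, G_xx + G_yy = 0 is exactly the Cauchy-Riemann equation for [dz G] and
    for the conjugate of [dzbar G]. *)
Lemma harmonic_is_pair (G : C -> C) : harmonic G ->
  harmonic_pair G (dz G) (fun z => Cconj (dzbar G z)).
Proof.
  intros [HC HL]. change (2 * 1)%nat with 2%nat in HC.
  assert (HG := Cn_on_C1 1 G HC).
  assert (Hx := Cn_on_C1 0 (dx G) (proj1 (proj2 (proj2 HC)))).
  assert (Hy := Cn_on_C1 0 (dy G) (proj2 (proj2 (proj2 HC)))).
  assert (H2 := two_neq_0). assert (Hi := Ci_sqr).
  assert (Lap : forall z, disk 1 z -> (dx (dx G) z + dy (dy G) z)%C = 0%C).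
  { intros z Hz. specialize (HL z Hz). simpl in HL. unfold Laplacian, dz in HL.
    destruct (partials_unique (dzbar G) z
      (/ 2 * dx (dx G) z + Ci / 2 * dx (dy G) z)%C
      (/ 2 * dy (dx G) z + Ci / 2 * dy (dy G) z)%C) as [E1 E2].
    { apply partials_ext with (fun z => (/ 2 * dx G z + Ci / 2 * dy G z)%C).
      - intros y. unfold dzbar. field; easy.
      - apply partials_lin; [apply (C1_partials _ _ _ Hx)|apply (C1_partials _ _ _ Hy)]; easy. }
    rewrite E1, E2, (mixed_partials G z HC Hz) in HL.
    rewrite <- HL.
    transitivity ((dx (dx G) z - (Ci * Ci) * dy (dy G) z))%C; [rewrite Hi; ring|field; easy]. }
  assert (Ec : Cconj Ci = (- Ci)%C) by (unfold Ci, Cconj, Copp; simpl; f_equal; ring).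
  assert (E2c : Cconj 2 = RtoC 2) by (unfold Cconj, RtoC; simpl; f_equal; ring).
  assert (Cphi : forall f g c d z, @ccont C_UniformSpace f z -> @ccont C_UniformSpace g z ->
    @ccont C_UniformSpace (fun z => (c * f z + d * g z)%C) z).
  { intros. apply ccont_plus; (apply ccont_mult; [apply ccont_const|easy]). }
  split.
  - destruct HG as [HP H0 Hcx Hcy].
    assert (E1 : forall z, dx G z = (dz G z + Cconj (Cconj (dzbar G z)))%C).
    { intros z. rewrite Cconj_conj. unfold dz, dzbar. field; easy. }
    assert (E2 : forall z, dy G z = (Ci * (dz G z - Cconj (Cconj (dzbar G z))))%C).
    { intros z. rewrite Cconj_conj. unfold dz, dzbar.
      transitivity (- (Ci * Ci) * dy G z)%C; [rewrite Hi; ring|field; easy]. }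
    split; try easy.
    + intros z Hz. rewrite <- E1, <- E2. auto.
    + intros z Hz. eapply ccont_ext; [apply E1|auto].
    + intros z Hz. eapply ccont_ext; [apply E2|auto].
  - exists (fun z => (/ 2 * dx (dx G) z + - (Ci / 2) * dx (dy G) z)%C).
    assert (E : forall z, (/ 2 * dx G z + - (Ci / 2) * dy G z)%C = dz G z)
      by (intros z; unfold dz; field; easy).
    split.
    + intros z Hz. apply (partials_ext _ _ _ _ _ E).
      replace (Ci * (/ 2 * dx (dx G) z + - (Ci / 2) * dx (dy G) z))%C
        with (/ 2 * dy (dx G) z + - (Ci / 2) * dy (dy G) z)%C.
      * apply partials_lin; [apply (C1_partials _ _ _ Hx)|apply (C1_partials _ _ _ Hy)]; easy.
      * rewrite (mixed_partials G z HC Hz).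
        transitivity (/ 2 * dy (dx G) z + - (Ci / 2) * (dx (dx G) z + dy (dy G) z)
          + Ci / 2 * dx (dx G) z)%C; [field; easy|]. rewrite Lap by easy.
        transitivity (/ 2 * - (Ci * Ci) * dy (dx G) z + Ci / 2 * dx (dx G) z)%C;
          [rewrite Hi; field; easy|field; easy].
    + intros z Hz. eapply ccont_ext; [apply E|].
      apply Cphi; [apply (C1_cont_x _ _ _ HG)|apply (C1_cont_y _ _ _ HG)]; easy.
    + intros z Hz. apply Cphi; [apply (C1_cont_x _ _ _ Hx)|apply (C1_cont_x _ _ _ Hy)]; easy.
    + intros z Hz. apply ccont_mult; [apply ccont_const|].
      apply Cphi; [apply (C1_cont_x _ _ _ Hx)|apply (C1_cont_x _ _ _ Hy)]; easy.
  - exists (fun z => Cconj (/ 2 * dx (dx G) z + (Ci / 2) * dx (dy G) z)%C).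
    assert (E : forall z, Cconj (/ 2 * dx G z + (Ci / 2) * dy G z)%C = Cconj (dzbar G z))
      by (intros z; unfold dzbar; f_equal; field; easy).
    assert (HPc : forall f z a b, partials f z a b ->
      partials (fun z => Cconj (f z)) z (Cconj a) (Cconj b)).
    { intros f z a b [h1 h2]. split; [now apply (cderiv_conj (fun t => f (t, Im z)))
      |now apply (cderiv_conj (fun t => f (Re z, t)))]. }
    split.
    + intros z Hz. apply (partials_ext _ _ _ _ _ E).
      replace (Ci * Cconj (/ 2 * dx (dx G) z + (Ci / 2) * dx (dy G) z))%C
        with (Cconj (/ 2 * dy (dx G) z + (Ci / 2) * dy (dy G) z)%C).
      * apply (HPc (fun z => (/ 2 * dx G z + (Ci / 2) * dy G z)%C)).
        apply partials_lin; [apply (C1_partials _ _ _ Hx)|apply (C1_partials _ _ _ Hy)]; easy.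
      * rewrite <- (Cconj_conj Ci) at 2. rewrite <- Cmult_conj, Ec. f_equal.
        rewrite (mixed_partials G z HC Hz).
        transitivity (/ 2 * dy (dx G) z + (Ci / 2) * (dx (dx G) z + dy (dy G) z)
          - Ci / 2 * dx (dx G) z)%C; [field; easy|]. rewrite Lap by easy.
        transitivity (/ 2 * - (Ci * Ci) * dy (dx G) z - Ci / 2 * dx (dx G) z)%C;
          [rewrite Hi; field; easy|field; easy].
    + intros z Hz. eapply ccont_ext; [apply E|]. apply ccont_conj.
      apply Cphi; [apply (C1_cont_x _ _ _ HG)|apply (C1_cont_y _ _ _ HG)]; easy.
    + intros z Hz. apply ccont_conj.
      apply Cphi; [apply (C1_cont_x _ _ _ Hx)|apply (C1_cont_x _ _ _ Hy)]; easy.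
    + intros z Hz. apply ccont_mult; [apply ccont_const|]. apply ccont_conj.
      apply Cphi; [apply (C1_cont_x _ _ _ Hx)|apply (C1_cont_x _ _ _ Hy)]; easy.
Qed.

Lemma ccont_circle (f : C -> C) (r : R) : 0 < r < 1 ->
  (forall z, disk 1 z -> @ccont C_UniformSpace f z) ->
  forall t, ccont (fun t => f (circ r t)) t.
Proof.
  intros Hr Hf t. apply (ccont_comp f (circ r)); [apply ccont_circ|].
  apply Hf. unfold disk. rewrite Cmod_circ; lra.
Qed.

(** Integration by parts over a period; periodicity removes the boundary term. *)
Lemma fcoef_derive (h h' : R -> C) (k : Z) :
  (forall t, cderiv h t (h' t)) -> (forall t, ccont h' t) -> h (2 * PI) = h 0 ->
  fcoef h' k = (Ci * IZR k * fcoef h k)%C.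
Proof.
  intros Hh Hc Ep.
  assert (Hhc : forall t, ccont h t) by (intros t; eapply cderiv_ccont, Hh).
  assert (H1 : forall t, ccont (fun t => (h' t * cis (- k) t)%C) t)
    by (intros t; apply ccont_mult; [exact (Hc t)|apply ccont_cis]).
  assert (H2 : forall t, ccont (fun t => (h t * cis (- k) t)%C) t)
    by (intros t; apply ccont_mult; [exact (Hhc t)|apply ccont_cis]).
  assert (H3 : forall t, ccont (fun t => (IZR (- k) * Ci * (h t * cis (- k) t))%C) t)
    by (intros t; apply ccont_mult; [apply ccont_const|exact (H2 t)]).
  assert (E : circle_int (fun t => (h' t * cis (- k) t + IZR (- k) * Ci * (h t * cis (- k) t))%C) = 0%C).
  { rewrite (circle_int_derive (fun t => (h t * cis (- k) t)%C)).
    - rewrite cis_2PI, cis_at_0, Ep. ring.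
    - intros t. replace (h' t * cis (- k) t + IZR (- k) * Ci * (h t * cis (- k) t))%C
        with (h' t * cis (- k) t + h t * (IZR (- k) * Ci * cis (- k) t))%C by ring.
      apply cderiv_mult; [apply Hh|apply cderiv_cis].
    - intros t. apply ccont_plus; [exact (H1 t)|exact (H3 t)]. }
  rewrite circle_int_plus, circle_int_scal in E by assumption.
  rewrite opp_IZR, RtoC_opp in E. unfold fcoef.
  replace (circle_int (fun t => (h' t * cis (- k) t)%C))
    with (IZR k * Ci * circle_int (fun t => (h t * cis (- k) t)%C))%C.
  - field. apply RtoC_2PI_neq_0.
  - symmetry. apply Ceq_minus. rewrite <- E. ring.
Qed.

Lemma circ_2PI (r : R) : circ r (2 * PI) = circ r 0.
Proof. unfold circ. now rewrite cis_2PI, cis_at_0. Qed.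

(** Up to the factor [r^n], the integrand is z^(n+1) f(z) on the circle, and Cauchy's formula at the
    centre, with kernel 1, returns its value 0 there. *)
Lemma fcoef_hol_neg (f f' : C -> C) (r : R) (n : nat) : hol f f' -> 0 < r < 1 -> (1 <= n)%nat ->
  fcoef (fun t => (circ r t * f (circ r t))%C) (- Z.of_nat n) = 0%C.
Proof.
  intros Hf Hr Hn.
  assert (Hr' : RtoC r <> 0%C) by (intros e; apply RtoC_inj in e; lra).
  destruct (hol_mult_pow (S n) f f' Hf) as [g' Hg].
  assert (E : circle_int (fun t => (circ r t ^ S n * f (circ r t) * 1)%C) = 0%C).
  { rewrite (cauchy_circle_int _ _ r 0 (fun _ => 1%C) Hg).
    - rewrite Cpow_S. ring.
    - rewrite Cmod_0. lra.
    - intros t. apply ccont_const.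
    - intros t. ring. }
  unfold fcoef.
  rewrite (circle_int_ext _ (fun t => (/ r ^ n * (circ r t ^ S n * f (circ r t) * 1))%C)).
  - rewrite circle_int_scal, E; [unfold Cdiv; ring|]. intros t.
    apply ccont_mult; [|apply ccont_const].
    apply (ccont_comp (fun z => (z ^ S n * f z)%C) (circ r)); [apply ccont_circ|].
    apply (C1_cont _ _ _ Hg). unfold disk. rewrite Cmod_circ; lra.
  - intros t. rewrite Z.opp_involutive, cis_of_nat. unfold circ.
    rewrite Cpow_mult_l, !Cpow_S. field; try now apply Cpow_nz.
Qed.

(** For harmonic [G] and [n >= 1] this is the coefficient a_n of z^n, and with the conjugate of [G]
    it is b_n. The radius stays a parameter until the final limit at 1. *)
Definition hcoef (G : C -> C) (r : R) (n : nat) : C :=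
  (fcoef (fun t => G (circ r t)) (Z.of_nat n) / r ^ n)%C.

(** Along the circle, [G] has derivative i (z phi - conj (z psi)). The conjugate term has no
    coefficient at positive frequencies, so integration by parts gives those of z phi from those of
    [G], without an antiderivative of [phi]. *)
Lemma fcoef_pair (G phi psi : C -> C) (r : R) (n : nat) :
  harmonic_pair G phi psi -> 0 < r < 1 ->
  fcoef (fun t => phi (circ r t)) (Z.of_nat n)
  = (INR (S n) * hcoef G r (S n) * r ^ n)%C.
Proof.
  intros [HG [phi' Hphi] [psi' Hpsi]] Hr.
  assert (Hr' : RtoC r <> 0%C) by (intros e; apply RtoC_inj in e; lra).
  assert (HC := ccont_circle G r Hr (C1_cont _ _ _ HG)).
  assert (Hc1 := ccont_circle phi r Hr (C1_cont _ _ _ Hphi)).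
  assert (Hc2 := ccont_circle psi r Hr (C1_cont _ _ _ Hpsi)).
  set (P := fun t => (circ r t * phi (circ r t))%C).
  set (Q := fun t => (circ r t * psi (circ r t))%C).
  assert (HP : forall t, ccont P t)
    by (intros t; apply ccont_mult; [apply ccont_circ|exact (Hc1 t)]).
  assert (HQ : forall t, ccont Q t)
    by (intros t; apply ccont_mult; [apply ccont_circ|exact (Hc2 t)]).
  assert (HPQ : forall t, ccont (fun t => (P t - Cconj (Q t))%C) t).
  { intros t. apply ccont_minus; [exact (HP t)|]. apply ccont_conj. exact (HQ t). }
  assert (HD : forall t, cderiv (fun t => G (circ r t)) t (Ci * (P t - Cconj (Q t)))%C).
  { intros t.
    assert (H := C1_chain _ _ _ (circ r) t _ HG ltac:(unfold disk; rewrite Cmod_circ; lra)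
      (cderiv_circ r t)).
    replace (Ci * (P t - Cconj (Q t)))%C with
      ((phi (circ r t) + Cconj (psi (circ r t))) * RtoC (Re (Ci * circ r t)) +
       Ci * (phi (circ r t) - Cconj (psi (circ r t))) * RtoC (Im (Ci * circ r t)))%C;
      [exact H|].
    unfold P, Q. destruct (circ r t), (phi _), (psi _).
    unfold Ci, Cconj, Cminus, Copp, Cplus, Cmult, RtoC, Re, Im; simpl. f_equal; ring. }
  assert (E := fcoef_derive _ _ (Z.of_nat (S n)) HD
    (fun t => ccont_mult _ _ t (ccont_const Ci t) (HPQ t))
    (f_equal G (circ_2PI r))).
  rewrite fcoef_scal, fcoef_minus, fcoef_conj in E; try assumption.
  2:{ intros t. apply ccont_conj. exact (HQ t). }
  unfold Q in E. rewrite (fcoef_hol_neg psi psi' r (S n)) in E by (easy || lia).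
  assert (E2 : fcoef (fun t => phi (circ r t)) (Z.of_nat n) = (fcoef P (Z.of_nat (S n)) / r)%C).
  { rewrite (fcoef_ext _ (fun t => (/ r * (circ r t * cis (- (1)) t * phi (circ r t)))%C)).
    - rewrite fcoef_scal.
      + unfold fcoef, P.
        rewrite (circle_int_ext (fun t => (circ r t * cis (- (1)) t * phi (circ r t) * cis (- Z.of_nat n) t)%C)
          (fun t => (circ r t * phi (circ r t) * cis (- Z.of_nat (S n)) t)%C)).
        * field. split; first [exact Hr' | apply RtoC_2PI_neq_0].
        * intros t. replace (- Z.of_nat (S n))%Z with (- (1) + - Z.of_nat n)%Z by lia.
          rewrite cis_add. ring.
      + intros t. apply ccont_mult; [|exact (Hc1 t)].
        apply ccont_mult; [apply ccont_circ|apply ccont_cis].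
    - intros t. unfold circ at 2.
      transitivity (/ r * (r * (cis 1 t * cis (- (1)) t)) * phi (circ r t))%C; [|ring].
      rewrite cis_opp. field; easy. }
  rewrite E2. unfold hcoef. rewrite INR_IZR_INZ.
  replace (fcoef P (Z.of_nat (S n)))
    with (IZR (Z.of_nat (S n)) * fcoef (fun t => G (circ r t)) (Z.of_nat (S n)))%C.
  - rewrite Cpow_S. field. split; [now apply Cpow_nz|easy].
  - assert (Hi := Ci_sqr).
    transitivity (- Ci * (Ci * IZR (Z.of_nat (S n)) * fcoef (fun t => G (circ r t)) (Z.of_nat (S n))))%C.
    + transitivity (- (Ci * Ci) * (IZR (Z.of_nat (S n)) * fcoef (fun t => G (circ r t)) (Z.of_nat (S n))))%C;
        [rewrite Hi; ring|ring].
    + rewrite <- E. replace (Cconj 0) with (RtoC 0) by (unfold Cconj, RtoC; simpl; f_equal; ring).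
      transitivity (- (Ci * Ci) * fcoef P (Z.of_nat (S n)))%C; [ring|rewrite Hi; ring].
Qed.

Lemma pair_series (G phi psi : C -> C) (r : R) (z : C) :
  harmonic_pair G phi psi -> Cmod z < r < 1 ->
  exists K, forall N,
  Cmod (z * phi z - csum (fun n => INR (S n) * hcoef G r (S n) * z ^ S n) N)%C
  <= K * (Cmod z / r) ^ N.
Proof.
  intros HG Hz. assert (Hr : 0 < r < 1) by (generalize (Cmod_ge_0 z); lra).
  destruct (hp_phi _ _ _ HG) as [phi' Hphi].
  destruct (hol_taylor phi phi' r z Hphi Hz) as [K HK].
  assert (Hr' : RtoC r <> 0%C) by (intros e; apply RtoC_inj in e; lra).
  exists (Cmod z * K). intros N.
  rewrite (csum_ext _ (fun n => z * ((z / r) ^ n * fcoef (fun t => phi (circ r t)) (Z.of_nat n)))%C).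
  - rewrite csum_scal. replace (z * phi z - _)%C with
      (z * (phi z - csum (fun n => (z / r) ^ n * fcoef (fun t => phi (circ r t)) (Z.of_nat n)) N))%C by ring.
    rewrite Cmod_mult, Rmult_assoc. apply Rmult_le_compat_l; [apply Cmod_ge_0|apply HK].
  - intros n. rewrite (fcoef_pair G phi psi r n HG Hr). unfold Cdiv.
    rewrite Cpow_mult_l, Cpow_inv, Cpow_S by easy. field; try now apply Cpow_nz.
Qed.

(** At the centre the remainder of the one-term expansion is a multiple of [0^1], so the expansion
    is exact. *)
Lemma pair_coef_1 (G phi psi : C -> C) (r : R) :
  harmonic_pair G phi psi -> 0 < r < 1 -> hcoef G r 1 = phi 0%C.
Proof.
  intros HG Hr. destruct (hp_phi _ _ _ HG) as [phi' Hphi].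
  destruct (hol_taylor phi phi' r 0%C Hphi) as [K HK]; [rewrite Cmod_0; lra|].
  assert (E := fcoef_pair G phi psi r 0 HG Hr).
  specialize (HK 1%nat). simpl csum in HK.
  rewrite Cmod_0 in HK. unfold Rdiv in HK. rewrite Rmult_0_l, pow_i, Rmult_0_r in HK by lia.
  change (fcoef (fun t => phi (circ r t)) 0%Z) with (fcoef (fun t => phi (circ r t)) (Z.of_nat 0)) in HK.
  rewrite E in HK. change (INR 1) with 1 in HK. change (INR 1) with 1 in HK.
  assert (E0 : (phi 0%C - hcoef G r 1)%C = 0%C).
  { apply Cmod_eq_0, Rle_antisym; [|apply Cmod_ge_0].
    eapply Rle_trans; [|exact HK]. right. f_equal. simpl. ring. }
  symmetry. now apply Ceq_minus.
Qed.

Lemma Cmod_hcoef (G : C -> C) (r : R) (n : nat) : 0 < r ->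
  Cmod (hcoef G r n) = Cmod (fcoef (fun t => G (circ r t)) (Z.of_nat n)) / r ^ n.
Proof.
  intros Hr. unfold hcoef. rewrite Cmod_div, Cmod_pow, Cmod_R, Rabs_pos_eq; try lra.
  apply Cpow_nz. intros e. apply RtoC_inj in e. lra.
Qed.

Lemma fcoef_conj_circ (G : C -> C) (r : R) (n : nat) :
  (forall t, ccont (fun t => G (circ r t)) t) ->
  Cmod (fcoef (fun t => Cconj (G (circ r t))) (Z.of_nat n))
  = Cmod (fcoef (fun t => G (circ r t)) (- Z.of_nat n)).
Proof. intros H. rewrite fcoef_conj by exact H. apply Cmod_conj. Qed.

Lemma sum_le_sqrt2 (x y B : R) : x ^ 2 + y ^ 2 <= B -> x + y <= sqrt (2 * B).
Proof.
  intros H. apply Rle_trans with (sqrt ((x + y) ^ 2)).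
  - rewrite <- Rsqr_pow2, sqrt_Rsqr_abs. apply Rle_abs.
  - apply sqrt_le_1_alt. generalize (pow2_ge_0 (x - y)). lra.
Qed.

Lemma hcoef_bound (G phi psi : C -> C) (r M : R) (n : nat) :
  harmonic_pair G phi psi -> 0 < r < 1 -> (1 <= n)%nat ->
  (forall z, disk 1 z -> Cmod (G z) <= M) ->
  (Cmod (hcoef G r n) + Cmod (hcoef (fun z => Cconj (G z)) r n)) * r ^ n <= sqrt (2 * M ^ 2).
Proof.
  intros HG Hr Hn HM.
  assert (HC := ccont_circle G r Hr (C1_cont _ _ _ (hp_C1 _ _ _ HG))).
  rewrite !Cmod_hcoef by lra. rewrite fcoef_conj_circ by exact HC.
  assert (Hb := bessel_bounded (Z.of_nat n :: (- Z.of_nat n)%Z :: nil)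
    (fun t => G (circ r t)) M).
  assert (0 < r ^ n) by (apply pow_lt; lra).
  replace ((_ + _) * r ^ n) with (Cmod (fcoef (fun t => G (circ r t)) (Z.of_nat n)) +
    Cmod (fcoef (fun t => G (circ r t)) (- Z.of_nat n))) by (field; lra).
  apply sum_le_sqrt2. cbn [fold_right] in Hb. rewrite Rplus_0_r in Hb. apply Hb; try easy.
  - repeat constructor; simpl; lia.
  - intros t. apply HM. unfold disk. rewrite Cmod_circ; lra.
Qed.

(** The bound for [n = 1] reads [s * r <= q] for every [r < 1]. If [q < s], it fails at the midpoint
    of [q / s] and 1. *)
Lemma hcoef_bound_first (G phi psi : C -> C) (M : R) :
  harmonic_pair G phi psi -> 0 <= M -> (forall z, disk 1 z -> Cmod (G z) <= M) ->
  Cmod (phi 0%C) + Cmod (psi 0%C) <= sqrt (2 * M ^ 2).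
Proof.
  intros HG HM0 HM. set (s := Cmod (phi 0%C) + Cmod (psi 0%C)).
  assert (Hs : 0 <= s) by (unfold s; generalize (Cmod_ge_0 (phi 0%C)) (Cmod_ge_0 (psi 0%C)); lra).
  assert (Hq : 0 <= sqrt (2 * M ^ 2)) by apply sqrt_pos.
  apply Rnot_lt_le. intros h.
  set (q := sqrt (2 * M ^ 2)) in *.
  set (r := (q / s + 1) / 2).
  assert (Hqs : 0 <= q / s < 1).
  { split; [apply Rdiv_le_0_compat; lra|].
    apply Rmult_lt_reg_r with s; [lra|]. unfold Rdiv. rewrite Rmult_assoc, Rinv_l; lra. }
  assert (Hr : 0 < r < 1) by (unfold r; lra).
  generalize (hcoef_bound G phi psi r M 1 HG Hr (le_n 1) HM).
  rewrite (pair_coef_1 G phi psi r HG Hr), (pair_coef_1 _ psi phi r (hp_conj _ _ _ HG) Hr).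
  fold s q. rewrite pow_1. assert (q = q / s * s) by (field; lra).
  assert (q / s < r) by (unfold r; lra). nra.
Qed.

(** Bessel for the frequencies 1, -1, n, -n, which are distinct as [n >= 2]. The first two use up at
    least [r^2], because |a_1|^2 = 1 + |b_1|^2 >= 1. *)
Lemma hcoef_bound_jacobian (G phi psi : C -> C) (r M : R) (n : nat) :
  harmonic_pair G phi psi -> 0 < r < 1 -> (2 <= n)%nat ->
  (forall z, disk 1 z -> Cmod (G z) <= M) ->
  Cmod (phi 0%C) ^ 2 - Cmod (psi 0%C) ^ 2 = 1 ->
  (Cmod (hcoef G r n) + Cmod (hcoef (fun z => Cconj (G z)) r n)) * r ^ n
  <= sqrt (2 * (M ^ 2 - r ^ 2)).
Proof.
  intros HG Hr Hn HM HJ.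
  assert (HC := ccont_circle G r Hr (C1_cont _ _ _ (hp_C1 _ _ _ HG))).
  assert (E1 : Cmod (fcoef (fun t => G (circ r t)) 1) = r * Cmod (phi 0%C)).
  { rewrite <- (pair_coef_1 G phi psi r HG Hr), Cmod_hcoef by lra.
    change (Z.of_nat 1) with 1%Z. field. lra. }
  assert (E2 : Cmod (fcoef (fun t => G (circ r t)) (- (1))) = r * Cmod (psi 0%C)).
  { rewrite <- (pair_coef_1 _ psi phi r (hp_conj _ _ _ HG) Hr), Cmod_hcoef by lra.
    rewrite fcoef_conj_circ by exact HC. change (Z.of_nat 1) with 1%Z. field. lra. }
  rewrite !Cmod_hcoef by lra. rewrite fcoef_conj_circ by exact HC.
  assert (Hb := bessel_bounded (1 :: - (1) :: Z.of_nat n :: - Z.of_nat n :: nil)%Z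
    (fun t => G (circ r t)) M).
  assert (0 < r ^ n) by (apply pow_lt; lra).
  replace ((_ + _) * r ^ n) with (Cmod (fcoef (fun t => G (circ r t)) (Z.of_nat n)) +
    Cmod (fcoef (fun t => G (circ r t)) (- Z.of_nat n))) by (field; lra).
  apply sum_le_sqrt2. cbn [fold_right] in Hb. rewrite E1, E2, Rplus_0_r in Hb.
  assert (Hb' := Hb ltac:(repeat constructor; simpl; lia) HC).
  assert (r ^ 2 <= (r * Cmod (phi 0%C)) ^ 2).
  { generalize (Cmod_ge_0 (psi 0%C)). intros. assert (1 <= Cmod (phi 0%C) ^ 2) by nra. nra. }
  assert (0 <= (r * Cmod (psi 0%C)) ^ 2) by apply pow2_ge_0.
  assert (forall t, Cmod (G (circ r t)) <= M)
    by (intros t; apply HM; unfold disk; rewrite Cmod_circ; lra).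
  specialize (Hb' H2). lra.
Qed.

(** * Lipschitz estimates *)

Fixpoint rsum (u : nat -> R) (N : nat) : R :=
  match N with O => 0 | S n => rsum u n + u n end.

Lemma rsum_scal (c : R) (u : nat -> R) (N : nat) :
  rsum (fun n => c * u n) N = c * rsum u N.
Proof. induction N as [|N IH]; simpl; [ring|]. rewrite IH. ring. Qed.

Lemma rsum_plus (u v : nat -> R) (N : nat) :
  rsum (fun n => u n + v n) N = rsum u N + rsum v N.
Proof. induction N as [|N IH]; simpl; [ring|]. rewrite IH. ring. Qed.

Lemma csum_minus_bound (u v : nat -> C) (l : nat -> R) (N : nat) :
  (forall n, Cmod (u n - v n) <= l n) -> Cmod (csum u N - csum v N) <= rsum l N.
Proof.
  intros H. induction N as [|N IH]; simpl.
  - replace (0 - 0)%C with (RtoC 0) by ring. rewrite Cmod_0. lra.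
  - replace (csum u N + u N - (csum v N + v N))%C
      with ((csum u N - csum v N) + (u N - v N))%C by ring.
    eapply Rle_trans; [apply Cmod_triangle|]. generalize (H N). lra.
Qed.

(** Multiplied by [(1 - x)^3] the finite sum has a closed form, [1 + x] minus a nonnegative term,
    which makes the bound uniform in [N]. *)
Lemma rsum_square (x : R) (N : nat) : 0 <= x < 1 ->
  rsum (fun n => INR (S n) ^ 2 * x ^ n) N <= (1 + x) / (1 - x) ^ 3.
Proof.
  intros Hx. assert (H3 : 0 < (1 - x) ^ 3) by (apply pow_lt; lra).
  apply Rmult_le_reg_r with ((1 - x) ^ 3); [easy|].
  unfold Rdiv. rewrite Rmult_assoc, Rinv_l, Rmult_1_r by lra.
  assert (E : rsum (fun n => INR (S n) ^ 2 * x ^ n) N * (1 - x) ^ 3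
    = 1 + x - x ^ N * ((INR N + 1 - INR N * x) ^ 2 + x)).
  { induction N as [|N IH]; [simpl; ring|]. cbn [rsum].
    rewrite Rmult_plus_distr_r, IH, S_INR. simpl. ring. }
  rewrite E. assert (0 <= x ^ N) by (apply pow_le; lra).
  assert (0 <= (INR N + 1 - INR N * x) ^ 2) by apply pow2_ge_0. nra.
Qed.

Lemma rsum_linear (x : R) (N : nat) : 0 <= x < 1 ->
  rsum (fun n => INR (S n) * x ^ n) N <= / (1 - x) ^ 2.
Proof.
  intros Hx. assert (H3 : 0 < (1 - x) ^ 2) by (apply pow_lt; lra).
  apply Rmult_le_reg_r with ((1 - x) ^ 2); [easy|]. rewrite Rinv_l by lra.
  assert (E : rsum (fun n => INR (S n) * x ^ n) N * (1 - x) ^ 2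
    = 1 - x ^ N * (INR N * (1 - x) + 1)).
  { induction N as [|N IH]; [simpl; ring|]. cbn [rsum].
    rewrite Rmult_plus_distr_r, IH, S_INR. simpl. ring. }
  rewrite E. assert (0 <= x ^ N) by (apply pow_le; lra).
  assert (0 <= INR N * (1 - x)) by (apply Rmult_le_pos; [apply pos_INR|lra]). nra.
Qed.

(** Index 0 of the expansion is the linear part L; blanking it keeps the indexing of the other
    terms. *)
Definition drop_first {A : Type} (z : A) (u : nat -> A) (n : nat) : A :=
  match n with O => z | S _ => u n end.

Lemma csum_drop_first (u : nat -> C) (N : nat) :
  csum (drop_first (RtoC 0) u) (S N) = (csum u (S N) - u 0%nat)%C.
Proof.
  induction N as [|N IH]; [simpl; ring|].
  change (csum ?v (S (S N))) with (csum v (S N) + v (S N))%C.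
  rewrite IH. simpl drop_first. ring.
Qed.

Lemma rsum_drop_first (u : nat -> R) (N : nat) :
  rsum (drop_first 0 u) (S N) = rsum u (S N) - u 0%nat.
Proof.
  induction N as [|N IH]; [simpl; ring|].
  change (rsum ?v (S (S N))) with (rsum v (S N) + v (S N)).
  rewrite IH. simpl drop_first. ring.
Qed.

Lemma limit_dist (F1 F2 : C) (u v : nat -> C) (K1 K2 x1 x2 L : R) :
  0 <= x1 < 1 -> 0 <= x2 < 1 ->
  (forall N, Cmod (F1 - csum u (S N)) <= K1 * x1 ^ N) ->
  (forall N, Cmod (F2 - csum v (S N)) <= K2 * x2 ^ N) ->
  (forall N, Cmod (csum u (S N) - csum v (S N)) <= L) ->
  Cmod (F1 - F2) <= L.
Proof.
  intros Hx1 Hx2 H1 H2 HL.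
  assert (HK1 : 0 <= K1).
  { generalize (H1 0%nat) (Cmod_ge_0 (F1 - csum u 1)). simpl. lra. }
  assert (HK2 : 0 <= K2).
  { generalize (H2 0%nat) (Cmod_ge_0 (F2 - csum v 1)). simpl. lra. }
  set (x := Rmax x1 x2).
  assert (Hx : 0 <= x < 1).
  { unfold x. split; [eapply Rle_trans; [|apply Rmax_l]; lra|apply Rmax_lub_lt; lra]. }
  cut (Cmod (F1 - F2) - L <= 0); [lra|].
  apply (geometric_zero x _ (K1 + K2) Hx). intros N.
  assert (x1 ^ N <= x ^ N) by (apply pow_incr; split; [lra|apply Rmax_l]).
  assert (x2 ^ N <= x ^ N) by (apply pow_incr; split; [lra|apply Rmax_r]).
  generalize (H1 N) (H2 N) (HL N).
  generalize (Cmod_triangle (F1 - csum u (S N)) (csum u (S N) - csum v (S N))).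
  generalize (Cmod_triangle (F1 - csum u (S N) + (csum u (S N) - csum v (S N))) (csum v (S N) - F2)).
  rewrite (Cmod_minus_sym (csum v (S N)) F2).
  replace (F1 - csum u (S N) + (csum u (S N) - csum v (S N)) + (csum v (S N) - F2))%C
    with (F1 - F2)%C by ring.
  nra.
Qed.

(** The passage from circles of radius [r < 1] to the unit circle: only the bound depends on [r],
    not the quantity being bounded. *)
Lemma le_at_left (A q : R) (K : R -> R) : q < 1 -> continuous K 1 ->
  (forall r, q < r < 1 -> A <= K r) -> A <= K 1.
Proof.
  intros Hq HK H. apply Rnot_lt_le. intros h.
  assert (Hn : locally (K 1) (fun y => y < A)) by (apply open_lt; easy).
  destruct (HK _ Hn) as [d Hd].
  set (r := Rmax ((q + 1) / 2) (1 - d / 2)).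
  assert (Hr : (q + 1) / 2 <= r /\ 1 - d / 2 <= r < 1).
  { unfold r. split; [apply Rmax_l|split; [apply Rmax_r|]].
    destruct d as [d Hd']. simpl. apply Rmax_lub_lt; lra. }
  assert (K r < A).
  { apply Hd. change (Rabs (r - 1) < d). destruct d as [d Hd']. simpl in *.
    rewrite Rabs_left; lra. }
  generalize (H r). lra.
Qed.

Lemma Cpow_lip (q : R) (z w : C) (k : nat) : Cmod z <= q -> Cmod w <= q ->
  Cmod (z ^ k - w ^ k) <= INR k * q ^ (k - 1) * Cmod (z - w).
Proof.
  intros Hz Hw. assert (Hq : 0 <= q) by (generalize (Cmod_ge_0 z); lra).
  induction k as [|k IH].
  - simpl. replace (1 - 1)%C with (RtoC 0) by ring. rewrite Cmod_0. lra.
  - replace (z ^ S k - w ^ S k)%C with (z * (z ^ k - w ^ k) + (z - w) * w ^ k)%C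
      by (rewrite !Cpow_S; ring).
    eapply Rle_trans; [apply Cmod_triangle|]. rewrite !Cmod_mult, Cmod_pow.
    replace (S k - 1)%nat with k by lia.
    assert (H1 : Cmod w ^ k <= q ^ k) by (apply pow_incr; split; [apply Cmod_ge_0|easy]).
    assert (H2 : Cmod z * Cmod (z ^ k - w ^ k) <= INR k * q ^ k * Cmod (z - w)).
    { apply Rle_trans with (q * (INR k * q ^ (k - 1) * Cmod (z - w))).
      - apply Rmult_le_compat; try apply Cmod_ge_0; easy.
      - right. destruct k as [|k]; [simpl; ring|].
        replace (S k - 1)%nat with k by lia. simpl pow. ring. }
    rewrite S_INR. generalize (Cmod_ge_0 (z - w)). nra.
Qed.

Definition mono (m n : nat) (z : C) : C := (RtoC (Cmod z ^ (2 * m)) * z ^ n)%C.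

(** As a product of powers of z and its conjugate, the weighted monomial inherits a Lipschitz bound
    from [Cpow_lip]. *)
Lemma mono_eq (m n : nat) (z : C) : mono m n z = (z ^ (m + n) * Cconj z ^ m)%C.
Proof.
  unfold mono. rewrite pow_mult, RtoC_pow, Cmod2_conj, Cpow_mult_l, Cpow_add_r. ring.
Qed.

Lemma mono_lip (q : R) (m n : nat) (z w : C) : (1 <= n)%nat -> Cmod z <= q -> Cmod w <= q ->
  Cmod (mono m n z - mono m n w)
  <= (2 * INR m + INR n) * q ^ (2 * m + n - 1) * Cmod (z - w).
Proof.
  intros Hn Hz Hw. assert (Hq : 0 <= q) by (generalize (Cmod_ge_0 z); lra).
  rewrite !mono_eq.
  replace (z ^ (m + n) * Cconj z ^ m - w ^ (m + n) * Cconj w ^ m)%C with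
    (z ^ (m + n) * (Cconj z ^ m - Cconj w ^ m) + (z ^ (m + n) - w ^ (m + n)) * Cconj w ^ m)%C
    by ring.
  eapply Rle_trans; [apply Cmod_triangle|].
  rewrite !Cmod_mult, !Cmod_pow, !Cmod_conj.
  assert (H1 := Cpow_lip q z w (m + n) Hz Hw).
  assert (H2 := Cpow_lip q (Cconj z) (Cconj w) m).
  rewrite <- Cminus_conj, !Cmod_conj in H2. specialize (H2 Hz Hw).
  assert (H3 : Cmod z ^ (m + n) <= q ^ (m + n)) by (apply pow_incr; split; [apply Cmod_ge_0|easy]).
  assert (H4 : Cmod w ^ m <= q ^ m) by (apply pow_incr; split; [apply Cmod_ge_0|easy]).
  assert (P3 : 0 <= Cmod z ^ (m + n)) by (apply pow_le, Cmod_ge_0).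
  assert (P4 : 0 <= Cmod w ^ m) by (apply pow_le, Cmod_ge_0).
  apply Rle_trans with (q ^ (m + n) * (INR m * q ^ (m - 1) * Cmod (z - w))
    + INR (m + n) * q ^ (m + n - 1) * Cmod (z - w) * q ^ m).
  - apply Rplus_le_compat; apply Rmult_le_compat; try apply Cmod_ge_0; easy.
  - right. rewrite plus_INR.
    replace (2 * m + n - 1)%nat with (m + n - 1 + m)%nat by lia.
    rewrite (pow_add q (m + n - 1)).
    (* For [m = 0] the truncated exponent [m - 1] is wrong, but the factor [INR m] vanishes. *)
    assert (E : INR m * (q ^ (m + n) * q ^ (m - 1)) = INR m * (q ^ (m + n - 1) * q ^ m)).
    { destruct m as [|m]; [simpl; ring|]. f_equal. rewrite <- !pow_add. f_equal. lia. }
    transitivity (INR m * (q ^ (m + n) * q ^ (m - 1)) * Cmod (z - w)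
      + (INR m + INR n) * (q ^ (m + n - 1) * q ^ m) * Cmod (z - w)); [ring|].
    rewrite E. ring.
Qed.

Lemma Cmod_mono (m n : nat) (z : C) : Cmod (mono m n z) = Cmod z ^ (2 * m + n).
Proof.
  unfold mono. rewrite Cmod_mult, Cmod_R, Cmod_pow, Rabs_pos_eq, pow_add; [easy|].
  apply pow_le, Cmod_ge_0.
Qed.

(** Index [n] stands for frequency [n + 1] in |z|^(2m) D(G), as D kills constants. *)
Definition series_term (a b : nat -> C) (m : nat) (z : C) (n : nat) : C :=
  (INR (S n) * (a (S n) * mono m (S n) z - Cconj (b (S n) * mono m (S n) z)))%C.

(** The bound is arranged so that summing over [n] calls for [rsum_linear] and [rsum_square] at
    [q / r]. *)
Lemma series_term_lip (a b : nat -> C) (m n : nat) (q r A : R) (z w : C) :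
  0 < r -> Cmod z <= q -> Cmod w <= q ->
  (Cmod (a (S n)) + Cmod (b (S n))) * r ^ S n <= A ->
  Cmod (series_term a b m z n - series_term a b m w n)
  <= A / r * q ^ (2 * m) * Cmod (z - w)
     * (2 * INR m * (INR (S n) * (q / r) ^ n) + INR (S n) ^ 2 * (q / r) ^ n).
Proof.
  intros Hr Hz Hw HA. assert (Hq : 0 <= q) by (generalize (Cmod_ge_0 z); lra).
  unfold series_term. set (j := S n) in *.
  replace (INR j * (a j * mono m j z - Cconj (b j * mono m j z))
    - INR j * (a j * mono m j w - Cconj (b j * mono m j w)))%C with
    (INR j * (a j * (mono m j z - mono m j w) - Cconj (b j * (mono m j z - mono m j w))))%C
    by (rewrite !Cmult_conj, Cminus_conj; ring).
  rewrite Cmod_mult, Cmod_R, Rabs_pos_eq by apply pos_INR.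
  assert (H1 := mono_lip q m j z w ltac:(lia) Hz Hw).
  set (d := Cmod (mono m j z - mono m j w)) in *.
  assert (H2 : Cmod (a j * (mono m j z - mono m j w) - Cconj (b j * (mono m j z - mono m j w)))
    <= (Cmod (a j) + Cmod (b j)) * d).
  { eapply Rle_trans; [apply Cmod_triangle|].
    rewrite Cmod_opp, Cmod_conj, !Cmod_mult. fold d. lra. }
  assert (Hrj : 0 < r ^ j) by now apply pow_lt.
  assert (H3 : Cmod (a j) + Cmod (b j) <= A / r ^ j).
  { apply Rmult_le_reg_r with (r ^ j); [easy|].
    unfold Rdiv. rewrite Rmult_assoc, Rinv_l; lra. }
  assert (H0 : 0 <= Cmod (a j) + Cmod (b j))
    by (generalize (Cmod_ge_0 (a j)) (Cmod_ge_0 (b j)); lra).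
  assert (Hd : 0 <= d) by apply Cmod_ge_0.
  apply Rle_trans with (INR j * (A / r ^ j *
    ((2 * INR m + INR j) * q ^ (2 * m + j - 1) * Cmod (z - w)))).
  - apply Rmult_le_compat_l; [apply pos_INR|]. eapply Rle_trans; [exact H2|].
    apply Rmult_le_compat; easy.
  - right. replace (2 * m + j - 1)%nat with (2 * m + n)%nat by lia.
    rewrite pow_add. unfold Rdiv. rewrite Rpow_mult_distr, pow_inv.
    unfold j. rewrite <- tech_pow_Rmult. field. split; try apply pow_nonzero; lra.
Qed.

Lemma series_term_bound (a b : nat -> C) (m n : nat) (q r A : R) (z : C) :
  0 < r -> Cmod z <= q ->
  (Cmod (a (S n)) + Cmod (b (S n))) * r ^ S n <= A ->
  Cmod (series_term a b m z n - 0) <= A / r * q ^ (2 * m) * Cmod z * (INR (S n) * (q / r) ^ n).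
Proof.
  intros Hr Hz HA. assert (Hq : 0 <= q) by (generalize (Cmod_ge_0 z); lra).
  unfold series_term. set (j := S n) in *.
  replace (INR j * (a j * mono m j z - Cconj (b j * mono m j z)) - 0)%C with
    (INR j * (a j * mono m j z - Cconj (b j * mono m j z)))%C by ring.
  rewrite Cmod_mult, Cmod_R, Rabs_pos_eq by apply pos_INR.
  set (d := Cmod z ^ (2 * m + j)).
  assert (H2 : Cmod (a j * mono m j z - Cconj (b j * mono m j z))
    <= (Cmod (a j) + Cmod (b j)) * d).
  { eapply Rle_trans; [apply Cmod_triangle|].
    rewrite Cmod_opp, Cmod_conj, !Cmod_mult, Cmod_mono. fold d. lra. }
  assert (H1 : d <= q ^ (2 * m + n) * Cmod z).
  { unfold d. replace (2 * m + j)%nat with (2 * m + n + 1)%nat by lia.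
    rewrite (pow_add _ (2 * m + n)), pow_1. apply Rmult_le_compat_r; [apply Cmod_ge_0|].
    apply pow_incr. split; [apply Cmod_ge_0|easy]. }
  assert (Hrj : 0 < r ^ j) by now apply pow_lt.
  assert (H3 : Cmod (a j) + Cmod (b j) <= A / r ^ j).
  { apply Rmult_le_reg_r with (r ^ j); [easy|].
    unfold Rdiv. rewrite Rmult_assoc, Rinv_l; lra. }
  assert (H0 : 0 <= Cmod (a j) + Cmod (b j))
    by (generalize (Cmod_ge_0 (a j)) (Cmod_ge_0 (b j)); lra).
  assert (Hd : 0 <= d) by apply pow_le, Cmod_ge_0.
  apply Rle_trans with (INR j * (A / r ^ j * (q ^ (2 * m + n) * Cmod z))).
  - apply Rmult_le_compat_l; [apply pos_INR|]. eapply Rle_trans; [exact H2|].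
    apply Rmult_le_compat; easy.
  - right. rewrite pow_add. unfold Rdiv. rewrite Rpow_mult_distr, pow_inv.
    unfold j. rewrite <- tech_pow_Rmult. field. split; try apply pow_nonzero; lra.
Qed.

Definition pair_Dop (phi psi : C -> C) (z : C) : C := (z * phi z - Cconj (z * psi z))%C.

Lemma pair_Dop_series (G phi psi : C -> C) (m : nat) (r : R) (z : C) :
  harmonic_pair G phi psi -> Cmod z < r < 1 ->
  exists K, forall N,
  Cmod (RtoC (Cmod z ^ (2 * m)) * pair_Dop phi psi z
    - csum (series_term (hcoef G r) (hcoef (fun z => Cconj (G z)) r) m z) N)%C
  <= K * (Cmod z / r) ^ N.
Proof.
  intros HG Hz.
  destruct (pair_series G phi psi r z HG Hz) as [K1 H1].
  destruct (pair_series _ psi phi r z (hp_conj _ _ _ HG) Hz) as [K2 H2].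
  set (a := hcoef G r) in *. set (b := hcoef (fun z => Cconj (G z)) r) in *.
  set (s := Cmod z ^ (2 * m)).
  assert (Hs : 0 <= s) by apply pow_le, Cmod_ge_0.
  assert (E : forall N, csum (series_term a b m z) N = (RtoC s *
    (csum (fun n => INR (S n) * a (S n) * z ^ S n) N
     - Cconj (csum (fun n => INR (S n) * b (S n) * z ^ S n) N)))%C).
  { assert (Ec : forall x : R, Cconj (RtoC x) = RtoC x)
      by (intros x; unfold Cconj, RtoC; simpl; f_equal; ring).
    induction N as [|N IH]; cbn [csum]; [rewrite Ec; ring|].
    rewrite IH, Cplus_conj. unfold series_term, mono. fold s.
    rewrite !Cmult_conj, !Ec. ring. }
  exists (s * (K1 + K2)). intros N. rewrite E. unfold pair_Dop.
  set (u := csum _ N). set (v := csum (fun n => INR (S n) * b (S n) * z ^ S n)%C N).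
  replace (RtoC s * (z * phi z - Cconj (z * psi z)) - RtoC s * (u - Cconj v))%C
    with (RtoC s * ((z * phi z - u) - Cconj (z * psi z - v)))%C
    by (rewrite Cminus_conj; ring).
  rewrite Cmod_mult, Cmod_R, Rabs_pos_eq by easy. rewrite Rmult_assoc.
  apply Rmult_le_compat_l; [easy|]. eapply Rle_trans; [apply Cmod_triangle|].
  rewrite Cmod_opp, Cmod_conj. generalize (H1 N) (H2 N). fold u v. lra.
Qed.

Lemma pair_Dop_series_S (G phi psi : C -> C) (m : nat) (r : R) (z : C) :
  harmonic_pair G phi psi -> Cmod z < r < 1 ->
  exists K, forall N,
  Cmod (RtoC (Cmod z ^ (2 * m)) * pair_Dop phi psi z
    - csum (series_term (hcoef G r) (hcoef (fun z => Cconj (G z)) r) m z) (S N))%C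
  <= K * (Cmod z / r) ^ N.
Proof.
  intros HG Hz. destruct (pair_Dop_series G phi psi m r z HG Hz) as [K HK].
  exists (K * (Cmod z / r)). intros N. rewrite Rmult_assoc. apply (HK (S N)).
Qed.

Lemma ratio_bounds (x r : R) : 0 <= x -> x < r -> 0 <= x / r < 1.
Proof.
  intros Hx Hr. split; [apply Rdiv_le_0_compat; lra|].
  apply Rmult_lt_reg_r with r; [lra|]. unfold Rdiv. rewrite Rmult_assoc, Rinv_l; lra.
Qed.

(** Termwise bounds with coefficients from the circle of radius [r] are summed, passed to the limit
    in [N], and then taken to [r = 1], where the constant becomes [lip_term q m]. *)
Lemma higher_lip (G phi psi : C -> C) (m : nat) (q M : R) (z w : C) :
  harmonic_pair G phi psi -> (forall z, disk 1 z -> Cmod (G z) <= M) ->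
  q < 1 -> disk q z -> disk q w ->
  Cmod (RtoC (Cmod z ^ (2 * m)) * pair_Dop phi psi z
        - RtoC (Cmod w ^ (2 * m)) * pair_Dop phi psi w)
  <= sqrt (2 * M ^ 2) * lip_term q m * Cmod (z - w).
Proof.
  intros HG HM Hq Hz Hw. unfold disk in Hz, Hw.
  assert (Hq0 : 0 < q) by (generalize (Cmod_ge_0 z); lra).
  set (A := sqrt (2 * M ^ 2)).
  set (K := fun r => A / r * q ^ (2 * m) * Cmod (z - w)
      * (2 * INR m * / (1 - q / r) ^ 2 + (1 + q / r) / (1 - q / r) ^ 3)).
  replace (A * lip_term q m * Cmod (z - w)) with (K 1) by (unfold K; unfold lip_term; field; lra).
  apply (le_at_left _ q K); [easy| |].
  - apply (ex_derive_continuous (fun r => A / r * q ^ (2 * m) * Cmod (z - w)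
      * (2 * INR m * / (1 - q / r) ^ 2 + (1 + q / r) / (1 - q / r) ^ 3))).
    auto_derive. rewrite Rinv_1.
    repeat split; try lra; repeat apply Rmult_integral_contrapositive_currified; lra.
  - intros r Hr.
    destruct (pair_Dop_series_S G phi psi m r z HG) as [K1 H1]; [lra|].
    destruct (pair_Dop_series_S G phi psi m r w HG) as [K2 H2]; [lra|].
    assert (Hx := ratio_bounds q r ltac:(lra) ltac:(lra)).
    assert (HA : 0 <= A / r * q ^ (2 * m) * Cmod (z - w)).
    { apply Rmult_le_pos; [|apply Cmod_ge_0].
      apply Rmult_le_pos; [apply Rdiv_le_0_compat; [apply sqrt_pos|lra]|apply pow_le; lra]. }
    eapply (limit_dist _ _ _ _ K1 K2 _ _ _ (ratio_bounds _ r (Cmod_ge_0 z) ltac:(lra))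
      (ratio_bounds _ r (Cmod_ge_0 w) ltac:(lra)) H1 H2).
    intros N. eapply Rle_trans.
    + apply csum_minus_bound. intros n. apply (series_term_lip _ _ m n q r A); try lra.
      apply (hcoef_bound G phi psi); try easy; [lra|lia].
    + rewrite rsum_scal, rsum_plus, rsum_scal.
      apply Rmult_le_compat_l; [easy|].
      generalize (rsum_square (q / r) (S N) Hx) (rsum_linear (q / r) (S N) Hx) (pos_INR m).
      nra.
Qed.

Lemma higher_bound (G phi psi : C -> C) (m : nat) (q M : R) (z : C) :
  harmonic_pair G phi psi -> (forall z, disk 1 z -> Cmod (G z) <= M) ->
  q < 1 -> disk q z ->
  Cmod (RtoC (Cmod z ^ (2 * m)) * pair_Dop phi psi z)
  <= sqrt (2 * M ^ 2) * (q ^ (2 * m) / (1 - q) ^ 2) * Cmod z.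
Proof.
  intros HG HM Hq Hz. unfold disk in Hz.
  assert (Hq0 : 0 < q) by (generalize (Cmod_ge_0 z); lra).
  set (A := sqrt (2 * M ^ 2)).
  set (K := fun r => A / r * q ^ (2 * m) * Cmod z * / (1 - q / r) ^ 2).
  replace (A * (q ^ (2 * m) / (1 - q) ^ 2) * Cmod z) with (K 1) by (unfold K; field; lra).
  apply (le_at_left _ q K); [easy| |].
  - apply (ex_derive_continuous (fun r => A / r * q ^ (2 * m) * Cmod z * / (1 - q / r) ^ 2)).
    auto_derive. rewrite Rinv_1.
    repeat split; try lra; repeat apply Rmult_integral_contrapositive_currified; lra.
  - intros r Hr.
    destruct (pair_Dop_series_S G phi psi m r z HG) as [K1 H1]; [lra|].
    assert (Hx := ratio_bounds q r ltac:(lra) ltac:(lra)).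
    assert (HA : 0 <= A / r * q ^ (2 * m) * Cmod z).
    { apply Rmult_le_pos; [|apply Cmod_ge_0].
      apply Rmult_le_pos; [apply Rdiv_le_0_compat; [apply sqrt_pos|lra]|apply pow_le; lra]. }
    assert (E0 : forall N, csum (fun _ => RtoC 0) N = 0%C)
      by (induction N as [|N IH]; simpl; [easy|rewrite IH; ring]).
    (* Comparison with the zero series lets [limit_dist] bound a modulus in place of a
       difference. *)
    match goal with |- Cmod ?x <= _ => replace (Cmod x) with (Cmod (x - 0)) by (f_equal; ring) end.
    eapply (limit_dist _ 0%C _ (fun _ => RtoC 0) K1 0 _ 0 _
      (ratio_bounds _ r (Cmod_ge_0 z) ltac:(lra)) ltac:(lra) H1).
    { intros N. rewrite E0. replace (0 - 0)%C with (RtoC 0) by ring. rewrite Cmod_0. lra. }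
    intros N. eapply Rle_trans.
    + apply csum_minus_bound. intros n. apply (series_term_bound _ _ m n q r A); try lra.
      apply (hcoef_bound G phi psi); try easy; [lra|lia].
    + rewrite rsum_scal. apply Rmult_le_compat_l; [easy|].
      apply (rsum_linear (q / r) (S N) Hx).
Qed.

Definition pair_remainder (phi psi : C -> C) (z : C) : C :=
  (pair_Dop phi psi z - (phi 0%C * z - Cconj (psi 0%C * z)))%C.

Lemma pair_remainder_series (G phi psi : C -> C) (r : R) (z : C) :
  harmonic_pair G phi psi -> Cmod z < r < 1 ->
  exists K, forall N,
  Cmod (pair_remainder phi psi z - csum (drop_first (RtoC 0)
    (series_term (hcoef G r) (hcoef (fun z => Cconj (G z)) r) 0 z)) (S N))%C
  <= K * (Cmod z / r) ^ N.
Proof.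
  intros HG Hz. assert (Hr : 0 < r < 1) by (generalize (Cmod_ge_0 z); lra).
  destruct (pair_Dop_series_S G phi psi 0 r z HG Hz) as [K HK].
  exists K. intros N. rewrite csum_drop_first.
  eapply Rle_trans; [|apply (HK N)]. right. f_equal. unfold pair_remainder, series_term at 2, mono.
  rewrite (pair_coef_1 G phi psi r HG Hr), (pair_coef_1 _ psi phi r (hp_conj _ _ _ HG) Hr).
  rewrite Cpow_1_r. simpl (Cmod z ^ (2 * 0)). change (INR 1) with 1.
  replace (1 * z)%C with z by ring. ring.
Qed.

(** Without the linear term only frequencies at least 2 remain, for which the bound improved by the
    Jacobian condition holds. The omitted term accounts for the [- 1]. *)
Lemma first_lip (G phi psi : C -> C) (q M : R) (z w : C) :
  harmonic_pair G phi psi -> (forall z, disk 1 z -> Cmod (G z) <= M) ->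
  Cmod (phi 0%C) ^ 2 - Cmod (psi 0%C) ^ 2 = 1 ->
  q < 1 -> disk q z -> disk q w ->
  Cmod (pair_remainder phi psi z - pair_remainder phi psi w)
  <= sqrt (2 * M ^ 2 - 2) * ((1 + q) / (1 - q) ^ 3 - 1) * Cmod (z - w).
Proof.
  intros HG HM HJ Hq Hz Hw. unfold disk in Hz, Hw.
  assert (Hq0 : 0 < q) by (generalize (Cmod_ge_0 z); lra).
  set (K := fun r => sqrt (2 * (M ^ 2 - r ^ 2)) * (/ r * Cmod (z - w)
      * ((1 + q / r) / (1 - q / r) ^ 3 - 1))).
  replace (sqrt (2 * M ^ 2 - 2) * ((1 + q) / (1 - q) ^ 3 - 1) * Cmod (z - w)) with (K 1) by (unfold K; replace (2 * (M ^ 2 - 1 ^ 2)) with (2 * M ^ 2 - 2) by ring; field; lra).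
  apply (le_at_left _ q K); [easy| |].
  (* The root is treated by continuity alone: for [M = 1] its argument vanishes at [r = 1], where
     [sqrt] is not differentiable. *)
  - apply continuous_Rmult.
    + apply (continuous_comp (fun r => 2 * (M ^ 2 - r ^ 2)) sqrt); [|apply continuous_sqrt].
      apply (ex_derive_continuous (fun r => 2 * (M ^ 2 - r ^ 2))). auto_derive. easy.
    + apply (ex_derive_continuous (fun r => / r * Cmod (z - w)
        * ((1 + q / r) / (1 - q / r) ^ 3 - 1))).
      auto_derive. rewrite Rinv_1.
      repeat split; try lra; repeat apply Rmult_integral_contrapositive_currified; lra.
  - intros r Hr. set (A := sqrt (2 * (M ^ 2 - r ^ 2))).
    destruct (pair_remainder_series G phi psi r z HG) as [K1 H1]; [lra|].
    destruct (pair_remainder_series G phi psi r w HG) as [K2 H2]; [lra|].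
    assert (Hx := ratio_bounds q r ltac:(lra) ltac:(lra)).
    assert (HA : 0 <= A / r * Cmod (z - w)).
    { apply Rmult_le_pos; [|apply Cmod_ge_0]. apply Rdiv_le_0_compat; [apply sqrt_pos|lra]. }
    eapply (limit_dist _ _ _ _ K1 K2 _ _ _ (ratio_bounds _ r (Cmod_ge_0 z) ltac:(lra))
      (ratio_bounds _ r (Cmod_ge_0 w) ltac:(lra)) H1 H2).
    intros N. eapply Rle_trans.
    + apply csum_minus_bound with
        (l := drop_first 0 (fun n => A / r * Cmod (z - w) * (INR (S n) ^ 2 * (q / r) ^ n))).
      intros [|n]; simpl drop_first.
      * replace (0 - 0)%C with (RtoC 0) by ring. rewrite Cmod_0. lra.
      * eapply Rle_trans; [apply (series_term_lip _ _ 0 (S n) q r A); try lra|].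
        -- apply (hcoef_bound_jacobian G phi psi); try easy; [lra|lia].
        -- right. simpl (2 * 0)%nat. rewrite pow_O. change (INR 0) with 0. simpl. ring.
    + rewrite rsum_drop_first, rsum_scal.
      replace (INR 1 ^ 2 * (q / r) ^ 0) with 1 by (simpl; ring).
      generalize (rsum_square (q / r) (S N) Hx). intros HS.
      replace (K r) with
        (A / r * Cmod (z - w) * ((1 + q / r) / (1 - q / r) ^ 3 - 1)) by (unfold K; fold A; unfold Rdiv; ring).
      rewrite <- Rmult_minus_distr_l. apply Rmult_le_compat_l; lra.
Qed.

Lemma first_bound (G phi psi : C -> C) (q M : R) (z : C) :
  harmonic_pair G phi psi -> (forall z, disk 1 z -> Cmod (G z) <= M) ->
  Cmod (phi 0%C) ^ 2 - Cmod (psi 0%C) ^ 2 = 1 ->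
  q < 1 -> disk q z ->
  Cmod (pair_remainder phi psi z)
  <= sqrt (2 * M ^ 2 - 2) * (/ (1 - q) ^ 2 - 1) * Cmod z.
Proof.
  intros HG HM HJ Hq Hz. unfold disk in Hz.
  assert (Hq0 : 0 < q) by (generalize (Cmod_ge_0 z); lra).
  set (K := fun r => sqrt (2 * (M ^ 2 - r ^ 2)) * (/ r * Cmod z * (/ (1 - q / r) ^ 2 - 1))).
  replace (sqrt (2 * M ^ 2 - 2) * (/ (1 - q) ^ 2 - 1) * Cmod z) with (K 1) by (unfold K; replace (2 * (M ^ 2 - 1 ^ 2)) with (2 * M ^ 2 - 2) by ring; field; lra).
  apply (le_at_left _ q K); [easy| |].
  - apply continuous_Rmult.
    + apply (continuous_comp (fun r => 2 * (M ^ 2 - r ^ 2)) sqrt); [|apply continuous_sqrt].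
      apply (ex_derive_continuous (fun r => 2 * (M ^ 2 - r ^ 2))). auto_derive. easy.
    + apply (ex_derive_continuous (fun r => / r * Cmod z * (/ (1 - q / r) ^ 2 - 1))).
      auto_derive. rewrite Rinv_1.
      repeat split; try lra; repeat apply Rmult_integral_contrapositive_currified; lra.
  - intros r Hr. set (A := sqrt (2 * (M ^ 2 - r ^ 2))).
    destruct (pair_remainder_series G phi psi r z HG) as [K1 H1]; [lra|].
    assert (Hx := ratio_bounds q r ltac:(lra) ltac:(lra)).
    assert (HA : 0 <= A / r * Cmod z).
    { apply Rmult_le_pos; [|apply Cmod_ge_0]. apply Rdiv_le_0_compat; [apply sqrt_pos|lra]. }
    assert (E0 : forall N, csum (fun _ => RtoC 0) N = 0%C)
      by (induction N as [|N IH]; simpl; [easy|rewrite IH; ring]).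
    replace (Cmod (pair_remainder phi psi z)) with (Cmod (pair_remainder phi psi z - 0)) by (f_equal; ring).
    eapply (limit_dist _ 0%C _ (fun _ => RtoC 0) K1 0 _ 0 _
      (ratio_bounds _ r (Cmod_ge_0 z) ltac:(lra)) ltac:(lra) H1).
    { intros N. rewrite E0. replace (0 - 0)%C with (RtoC 0) by ring. rewrite Cmod_0. lra. }
    intros N. eapply Rle_trans.
    + apply csum_minus_bound with
        (l := drop_first 0 (fun n => A / r * Cmod z * (INR (S n) * (q / r) ^ n))).
      intros [|n]; simpl drop_first.
      * replace (0 - 0)%C with (RtoC 0) by ring. rewrite Cmod_0. lra.
      * eapply Rle_trans; [apply (series_term_bound _ _ 0 (S n) q r A); try lra|].
        -- apply (hcoef_bound_jacobian G phi psi); try easy; [lra|lia].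
        -- right. simpl (2 * 0)%nat. rewrite pow_O. simpl. ring.
    + rewrite rsum_drop_first, rsum_scal.
      replace (INR 1 * (q / r) ^ 0) with 1 by (simpl; ring).
      generalize (rsum_linear (q / r) (S N) Hx). intros HS.
      replace (K r) with
        (A / r * Cmod z * (/ (1 - q / r) ^ 2 - 1)) by (unfold K; fold A; unfold Rdiv; ring).
      rewrite <- Rmult_minus_distr_l. apply Rmult_le_compat_l; lra.
Qed.

(** * The operator D and the theorem *)

Lemma Cmod_sum_n_m_minus (u v : nat -> C) (l : nat -> R) (n m : nat) :
  (forall k, (n <= k <= m)%nat -> Cmod (u k - v k) <= l k) ->
  Cmod (sum_n_m u n m - sum_n_m v n m) <= sum_n_m l n m.
Proof.
  intros H. induction m as [|m IH].
  - destruct n as [|n].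
    + rewrite !sum_n_n. apply H. lia.
    + rewrite !sum_n_m_zero by lia. change (Cmod (0 - 0) <= 0).
      replace (0 - 0)%C with (RtoC 0) by ring. rewrite Cmod_0. lra.
  - destruct (Nat.le_gt_cases n (S m)) as [h|h].
    + rewrite !sum_n_Sm by lia.
      change (Cmod (sum_n_m u n m + u (S m) - (sum_n_m v n m + v (S m)))
        <= sum_n_m l n m + l (S m)).
      replace (sum_n_m u n m + u (S m) - (sum_n_m v n m + v (S m)))%C
        with ((sum_n_m u n m - sum_n_m v n m) + (u (S m) - v (S m)))%C by ring.
      eapply Rle_trans; [apply Cmod_triangle|].
      apply Rplus_le_compat; [apply IH; intros; apply H; lia|apply H; lia].
    + rewrite !sum_n_m_zero by lia. change (Cmod (0 - 0) <= 0).
      replace (0 - 0)%C with (RtoC 0) by ring. rewrite Cmod_0. lra.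
Qed.

Lemma Cmod_sum_n_m (u : nat -> C) (l : nat -> R) (n m : nat) :
  (forall k, (n <= k <= m)%nat -> Cmod (u k) <= l k) ->
  Cmod (sum_n_m u n m) <= sum_n_m l n m.
Proof.
  intros H.
  assert (E0 : sum_n_m (fun _ : nat => RtoC 0) n m = RtoC 0)
    by apply (sum_n_m_const_zero (G := C_AbelianGroup)).
  replace (sum_n_m u n m) with (sum_n_m u n m - sum_n_m (fun _ => RtoC 0) n m)%C
    by (rewrite E0; ring).
  apply (Cmod_sum_n_m_minus u (fun _ => RtoC 0)). intros k Hk.
  replace (u k - 0)%C with (u k) by ring. now apply H.
Qed.

Lemma sum_n_m_le_loc (u v : nat -> R) (n m : nat) :
  (forall k, (n <= k <= m)%nat -> u k <= v k) -> sum_n_m u n m <= sum_n_m v n m.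
Proof.
  intros H. induction m as [|m IH].
  - destruct n as [|n]; [rewrite !sum_n_n; apply H; lia|].
    rewrite !sum_n_m_zero by lia. apply Rle_refl.
  - destruct (Nat.le_gt_cases n (S m)) as [h|h].
    + rewrite !sum_n_Sm by lia. apply Rplus_le_compat; [apply IH; intros|]; apply H; lia.
    + rewrite !sum_n_m_zero by lia. apply Rle_refl.
Qed.

Lemma sum_n_m_Rplus (u v : nat -> R) (n m : nat) :
  sum_n_m (fun k => u k + v k) n m = sum_n_m u n m + sum_n_m v n m.
Proof. apply (sum_n_m_plus (G := R_AbelianGroup)). Qed.

Lemma sum_n_m_Rmult (c : R) (u : nat -> R) (n m : nat) :
  sum_n_m (fun k => c * u k) n m = c * sum_n_m u n m.
Proof. apply (sum_n_m_mult_l (K := R_Ring)). Qed.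

Lemma sum_n_m_Rext (u v : nat -> R) (n m : nat) :
  (forall k, (n <= k <= m)%nat -> u k = v k) -> sum_n_m u n m = sum_n_m v n m.
Proof. apply sum_n_m_ext_loc. Qed.

Lemma partials_mult (f g : C -> C) (z a b a' b' : C) :
  partials f z a b -> partials g z a' b' ->
  partials (fun z => (f z * g z)%C) z (a * g z + f z * a')%C (b * g z + f z * b')%C.
Proof.
  intros [H1 H2] [H3 H4]. assert (Ez : (Re z, Im z) = z) by now destruct z.
  split.
  - assert (H := cderiv_mult _ _ _ _ _ H1 H3). cbv beta in H. rewrite Ez in H. exact H.
  - assert (H := cderiv_mult _ _ _ _ _ H2 H4). cbv beta in H. rewrite Ez in H. exact H.
Qed.

Lemma partials_plus (f g : C -> C) (z a b a' b' : C) :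
  partials f z a b -> partials g z a' b' ->
  partials (fun z => (f z + g z)%C) z (a + a')%C (b + b')%C.
Proof.
  intros [H1 H2] [H3 H4]. split;
    [exact (cderiv_plus _ _ _ _ _ H1 H3)|exact (cderiv_plus _ _ _ _ _ H2 H4)].
Qed.

(** The expansion of [f] is given on the unit disk only, and partials at an interior point see just
    short segments around it. *)
Lemma partials_ext_disk (f g : C -> C) (z a b : C) :
  (forall y, disk 1 y -> f y = g y) -> disk 1 z -> partials f z a b -> partials g z a b.
Proof.
  intros E Hz [[H1 H2] [H3 H4]].
  destruct (proj1 (locally_C z (disk 1)) (disk_locally 1 z Hz)) as [e [He Hd]].
  assert (Hx : locally (Re z) (fun t => disk 1 (t, Im z))).
  { exists (mkposreal e He). intros t Ht. apply Hd.
    change (Rabs (t - Re z) < e) in Ht. eapply Rle_lt_trans; [apply Cmod_le_abs|].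
    destruct z as [x y]. simpl in *. unfold Re, Im in *. simpl in *.
    replace (y + - y) with 0 by ring. rewrite Rabs_R0. unfold Rminus in Ht. lra. }
  assert (Hy : locally (Im z) (fun t => disk 1 (Re z, t))).
  { exists (mkposreal e He). intros t Ht. apply Hd.
    change (Rabs (t - Im z) < e) in Ht. eapply Rle_lt_trans; [apply Cmod_le_abs|].
    destruct z as [x y]. simpl in *. unfold Re, Im in *. simpl in *.
    replace (x + - x) with 0 by ring. rewrite Rabs_R0. unfold Rminus in Ht. lra. }
  split; split.
  - apply (is_derive_ext_loc (fun s => Re (f (s, Im z)))); [|exact H1].
    refine (filter_imp _ _ _ Hx). intros t Ht. now rewrite E.
  - apply (is_derive_ext_loc (fun s => Im (f (s, Im z)))); [|exact H2].
    refine (filter_imp _ _ _ Hx). intros t Ht. now rewrite E.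
  - apply (is_derive_ext_loc (fun s => Re (f (Re z, s)))); [|exact H3].
    refine (filter_imp _ _ _ Hy). intros t Ht. now rewrite E.
  - apply (is_derive_ext_loc (fun s => Im (f (Re z, s)))); [|exact H4].
    refine (filter_imp _ _ _ Hy). intros t Ht. now rewrite E.
Qed.

(** The even power is a polynomial in the coordinates, hence differentiable at 0 too. For [m = 0]
    the factor [INR m] makes the truncated [pred m] harmless. *)
Lemma partials_Cmod_even (m : nat) (z : C) :
  partials (fun y => RtoC (Cmod y ^ (2 * m))) z
    (RtoC (2 * Re z * (INR m * (Cmod z ^ 2) ^ pred m)))
    (RtoC (2 * Im z * (INR m * (Cmod z ^ 2) ^ pred m))).
Proof.
  assert (E : forall y, (Re y ^ 2 + Im y ^ 2) ^ m = Cmod y ^ (2 * m))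
    by (intros y; now rewrite pow_mult, Cmod2_alt).
  apply partials_ext with (fun y => RtoC ((Re y ^ 2 + Im y ^ 2) ^ m)).
  { intros y. now rewrite E. }
  rewrite Cmod2_alt. destruct z as [x y].
  split; split; unfold RtoC, Re, Im; simpl fst; simpl snd; try apply is_derive_Rconst;
    auto_derive; try easy; simpl; ring.
Qed.

Lemma Dop_partials (f : C -> C) (z a b : C) : partials f z a b ->
  Dop f z = (Ci * (Im z * a - Re z * b))%C.
Proof.
  intros H. destruct (partials_unique f z a b H) as [Ea Eb].
  unfold Dop, dz, dzbar. rewrite Ea, Eb.
  assert (H2 := two_neq_0).
  transitivity (((z - Cconj z) * a - Ci * (z + Cconj z) * b) / 2)%C; [field; easy|].
  destruct z as [x y], a, b. unfold Cdiv. rewrite <- RtoC_inv by lra.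
  unfold Re, Im, Ci, Cconj, RtoC, Cminus, Copp, Cplus, Cmult; simpl. f_equal; field.
Qed.

(* [Dop] is the derivation [i (y d/dx - x d/dy)], which kills [|z|^2]. *)
Lemma partials_weighted_sum (H phi psi : nat -> C -> C) (n : nat) (z : C) : disk 1 z ->
  (forall k, (1 <= k <= n)%nat -> harmonic_pair (H k) (phi k) (psi k)) ->
  exists a b,
  partials (fun y => sum_n_m (fun k => (RtoC (Cmod y ^ (2 * (k - 1))) * H k y)%C) 1 n) z a b /\
  (Ci * (Im z * a - Re z * b))%C
    = sum_n_m (fun k => (RtoC (Cmod z ^ (2 * (k - 1))) * pair_Dop (phi k) (psi k) z)%C) 1 n /\
  ((1 <= n)%nat -> z = 0%C -> a = (phi 1%nat 0 + Cconj (psi 1%nat 0))%C /\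
     b = (Ci * (phi 1%nat 0 - Cconj (psi 1%nat 0)))%C).
Proof.
  intros Hz. induction n as [|n IH]; intros HH.
  - exists 0%C, 0%C. split; [|split; [|lia]].
    + apply partials_ext with (fun _ => 0%C).
      * intros y. rewrite sum_n_m_zero by lia. reflexivity.
      * split; apply cderiv_const.
    + rewrite sum_n_m_zero by lia. change zero with (RtoC 0). ring.
  - destruct IH as [a [b [Hp [Hd H0]]]]; [intros; apply HH; lia|].
    set (w := fun y => RtoC (Cmod y ^ (2 * (S n - 1)))).
    set (s := INR (S n - 1) * (Cmod z ^ 2) ^ pred (S n - 1)).
    assert (Hw : partials w z (RtoC (2 * Re z * s)) (RtoC (2 * Im z * s)))
      by apply partials_Cmod_even.
    assert (HHn := C1_partials _ _ _ (hp_C1 _ _ _ (HH (S n) ltac:(lia))) z Hz).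
    assert (Hm := partials_mult _ _ _ _ _ _ _ Hw HHn).
    eexists; eexists. split; [|split].
    + eapply partials_ext; [|apply (partials_plus _ _ _ _ _ _ _ Hp Hm)].
      intros y. rewrite sum_n_Sm by lia. reflexivity.
    + rewrite sum_n_Sm by lia. rewrite <- Hd.
      change plus with Cplus. fold (w z). unfold pair_Dop.
      rewrite Cmult_conj.
      destruct z as [x y], (w (x, y)), (H (S n) (x, y)), (phi (S n) (x, y)), (psi (S n) (x, y)), a, b.
      unfold Re, Im, Ci, Cconj, RtoC, Cminus, Copp, Cplus, Cmult; simpl. f_equal; ring.
    (* At the origin the weights with k >= 2 vanish together with their partials, so only the
       unweighted term contributes there. *)
    + intros _ Ez. destruct n as [|n].
      * assert (Ea : a = 0%C /\ b = 0%C).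
        { assert (Hp0 : partials (fun _ => 0%C) z a b).
          { eapply partials_ext; [|exact Hp]. intros y. cbv beta.
            rewrite sum_n_m_zero by lia. reflexivity. }
          destruct (partials_unique _ _ _ _ Hp0) as [<- <-].
          apply partials_unique. split; apply cderiv_const. }
        destruct Ea as [-> ->]. unfold s, w. simpl (1 - 1)%nat. simpl (2 * 0)%nat.
        rewrite pow_O, Ez. change (INR 0) with 0.
        rewrite !Rmult_0_l, !Rmult_0_r.
        replace (Cmod 0 ^ 0) with 1 by reflexivity. split; ring.
      * destruct H0 as [-> ->]; [lia|easy|].
        assert (Ew : w z = 0%C).
        { unfold w. rewrite Ez, Cmod_0, pow_i by lia. easy. }
        rewrite Ew, Ez. unfold Re, Im. simpl fst. simpl snd.
        rewrite !Rmult_0_r, !Rmult_0_l. split; ring.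
Qed.

Lemma Cmod_minus_of_squares (x y M : R) : 0 <= x -> 0 <= y -> x ^ 2 - y ^ 2 = 1 ->
  1 <= M -> x + y <= sqrt (2 * M ^ 2) -> / (sqrt 2 * M) <= x - y.
Proof.
  intros Hx Hy H HM HB.
  rewrite sqrt_mult, sqrt_pow2 in HB by nra.
  assert (0 < x + y) by nra.
  assert (E : x - y = / (x + y)).
  { apply Rmult_eq_reg_r with (x + y); [rewrite Rinv_l; nra|lra]. }
  rewrite E. apply Rinv_le_contravar; easy.
Qed.

Theorem theorem3 (p : nat) (M : R) (f : C -> C) (G : nat -> C -> C)
  (hp : (1 <= p)%nat) (hM : 1 <= M)
  (hf : p_harmonic p f)
  (hfG : forall z : C, disk 1 z ->
     f z = sum_n_m (fun k : nat =>
             (RtoC (Cmod z ^ (2 * (k - 1))) * G (p - k + 1)%nat z)%C) 1 p)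
  (hG : forall k : nat, (1 <= k <= p)%nat ->
     harmonic (G (p - k + 1)%nat) /\
     (forall z : C, disk 1 z -> Cmod (G (p - k + 1)%nat z) <= M))
  (hf0 : f 0%C = 0%C) (hG0 : G p 0%C = 0%C) (hJ : Jacobian f 0%C - 1 = 0) :
  exists rho : R,
    (0 < rho < 1) /\
    lambda0 M
      - T M / (1 - rho) ^ 2
        * sum_n_m (fun k : nat => (2 * INR k - 1) * rho ^ (2 * (k - 1))) 2 p
      - sum_n_m (fun k : nat => 2 * T M * rho ^ (2 * k - 1) / (1 - rho) ^ 3) 1 p
      - 16 * M / PI ^ 2 * s0 * atan rho = 0 /\
    univalent_on (disk rho) (Dop f) /\
    contains_univalent_disk (disk rho) (Dop f)
      (rho * (lambda0 M
        - sum_n_m (fun k : nat => T M * rho ^ (2 * (k - 1)) / (1 - rho) ^ 2) 2 p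
        - 16 * M / PI ^ 2 * s0 * atan rho)).
Proof.
  destruct (radius_exists p M hp hM) as [rho [Hrho Eq]].
  assert (HK := radius_contraction p M rho hp hM Hrho Eq).
  (* Reindexing by the weight: [H 1] is [G p], the only component that contributes to the linear
     part. *)
  set (H := fun k => G (p - k + 1)%nat).
  set (phi := fun k => dz (H k)). set (psi := fun k z => Cconj (dzbar (H k) z)).
  assert (HH : forall k, (1 <= k <= p)%nat -> harmonic_pair (H k) (phi k) (psi k))
    by (intros k Hk; apply harmonic_is_pair, hG; easy).
  assert (HM : forall k, (1 <= k <= p)%nat -> forall z, disk 1 z -> Cmod (H k z) <= M)
    by (intros k Hk; apply hG; easy).
  assert (H1p : (1 <= 1 <= p)%nat) by lia.
  assert (HD : forall z, disk 1 z -> Dop f z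
    = sum_n_m (fun k => (RtoC (Cmod z ^ (2 * (k - 1))) * pair_Dop (phi k) (psi k) z)%C) 1 p).
  { intros z Hz.
    destruct (partials_weighted_sum H phi psi p z Hz HH) as [a [b [Hp [<- _]]]].
    apply Dop_partials. eapply partials_ext_disk; [|exact Hz|exact Hp].
    intros y Hy. symmetry. now apply hfG. }
  (* The Jacobian of [f] at 0 is that of [G p], since the weighted components have vanishing
     partials there. *)
  assert (HJ : Cmod (phi 1%nat 0) ^ 2 - Cmod (psi 1%nat 0) ^ 2 = 1).
  { assert (H0 : disk 1 0) by (unfold disk; rewrite Cmod_0; lra).
    destruct (partials_weighted_sum H phi psi p 0%C H0 HH) as [a [b [Hp [_ Hab]]]].
    destruct (Hab hp eq_refl) as [Ea Eb].
    assert (Hpf : partials f 0 a b).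
    { eapply partials_ext_disk; [|exact H0|exact Hp]. intros y Hy. symmetry. now apply hfG. }
    destruct (partials_unique _ _ _ _ Hpf) as [Fa Fb].
    unfold Jacobian in hJ.
    replace (dz f 0%C) with (phi 1%nat 0%C) in hJ.
    - replace (dzbar f 0%C) with (Cconj (psi 1%nat 0%C)) in hJ.
      + rewrite Cmod_conj in hJ. lra.
      + unfold dzbar at 1. rewrite Fa, Fb, Ea, Eb.
        transitivity (((phi 1%nat 0 + Cconj (psi 1%nat 0))
          + (Ci * Ci) * (phi 1%nat 0 - Cconj (psi 1%nat 0))) / 2)%C;
          [rewrite Ci_sqr; field; apply two_neq_0|field; apply two_neq_0].
    - unfold dz at 1. rewrite Fa, Fb, Ea, Eb.
      transitivity (((phi 1%nat 0 + Cconj (psi 1%nat 0))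
        - (Ci * Ci) * (phi 1%nat 0 - Cconj (psi 1%nat 0))) / 2)%C;
        [rewrite Ci_sqr; field; apply two_neq_0|field; apply two_neq_0]. }
  set (T1 := sqrt (2 * M ^ 2 - 2)) in *.
  set (A := sqrt (2 * M ^ 2)).
  assert (EA : A = sqrt 2 * M) by (unfold A; rewrite sqrt_mult, sqrt_pow2; nra).
  set (lam := Cmod (phi 1%nat 0) - Cmod (psi 1%nat 0)).
  assert (Hlam : / (sqrt 2 * M) <= lam).
  { apply Cmod_minus_of_squares; try apply Cmod_ge_0; try easy.
    apply (hcoef_bound_first (H 1%nat)); [now apply HH|lra|now apply HM]. }
  set (K := T1 * ((1 + rho) / (1 - rho) ^ 3 - 1)
    + A * sum_n_m (fun k => lip_term rho (k - 1)) 2 p).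
  set (beta := fun k => rho ^ (2 * (k - 1)) / (1 - rho) ^ 2).
  set (B := T1 * (/ (1 - rho) ^ 2 - 1) + A * sum_n_m beta 2 p).
  assert (HKlam : K < lam) by (unfold K; rewrite EA; lra).
  assert (HT1 : 0 <= T1) by apply sqrt_pos.
  assert (HA : 0 <= A) by apply sqrt_pos.
  assert (Hr2 : 0 < (1 - rho) ^ 2) by (apply pow_lt; lra).
  assert (Hr3 : 0 < (1 - rho) ^ 3) by (apply pow_lt; lra).
  assert (Hbeta : forall k, 0 <= beta k)
    by (intros k; apply Rdiv_le_0_compat; [apply pow_le; lra|easy]).
  assert (Hsplit : forall k, lip_term rho k = rho ^ (2 * k) / (1 - rho) ^ 2
    + rho ^ (2 * k) * (2 * INR k / (1 - rho) ^ 2 + 2 * rho / (1 - rho) ^ 3))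
    by (intros k; unfold lip_term; field; lra).
  (* [R / rho] is the part of [K - B] obtained with [T M] in place of the
     Parseval constants [T1] and [A]. *)
  set (R0 := lambda0 M
    - sum_n_m (fun k : nat => T M * rho ^ (2 * (k - 1)) / (1 - rho) ^ 2) 2 p
    - 16 * M / PI ^ 2 * s0 * atan rho).
  assert (HR : R0 <= K - B).
  { set (gam := fun k => rho ^ (2 * (k - 1))
      * (2 * INR (k - 1) / (1 - rho) ^ 2 + 2 * rho / (1 - rho) ^ 3)).
    assert (E1 : sum_n_m (fun k => lip_term rho (k - 1)) 2 p
      = sum_n_m beta 2 p + sum_n_m gam 2 p).
    { rewrite <- sum_n_m_Rplus. apply sum_n_m_ext. intros k. apply Hsplit. }
    (* Writing 2k - 1 = 1 + 2(k - 1) separates the size of a weighted term from the excess [gam] of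
       its Lipschitz constant over that size. With the equation, [R0] becomes [T M] times
       [2 * rho / (1 - rho)^3] plus the sum of [gam]; the isolated k = 1 term of the second sum
       supplies the first summand. *)
    assert (E2 : T M / (1 - rho) ^ 2
        * sum_n_m (fun k : nat => (2 * INR k - 1) * rho ^ (2 * (k - 1))) 2 p
      + sum_n_m (fun k : nat => 2 * T M * rho ^ (2 * k - 1) / (1 - rho) ^ 3) 2 p
      = sum_n_m (fun k : nat => T M * rho ^ (2 * (k - 1)) / (1 - rho) ^ 2) 2 p
        + T M * sum_n_m gam 2 p).
    { rewrite <- !sum_n_m_Rmult, <- !sum_n_m_Rplus. apply sum_n_m_Rext.
      intros k Hk. unfold gam. replace (2 * k - 1)%nat with (2 * (k - 1) + 1)%nat by lia.
      rewrite pow_add, minus_INR by lia. change (INR 1) with 1. field. lra. }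
    rewrite (sum_Sn_m _ 1 p) in Eq by lia. change plus with Rplus in Eq.
    change (2 * 1 - 1)%nat with 1%nat in Eq. rewrite pow_1 in Eq.
    assert (HT := T_nonneg M hM). assert (HTT := T_le_parseval M hM). fold T1 in HTT.
    assert (HTA : T1 <= A) by (apply sqrt_le_1_alt; lra).
    assert (HS : 0 <= sum_n_m gam 2 p).
    { apply (sum_n_m_ind (fun x => 0 <= x)); [lra|intros; lra|].
      intros k Hk. unfold gam. apply Rmult_le_pos; [apply pow_le; lra|].
      apply Rplus_le_le_0_compat; apply Rdiv_le_0_compat; try easy; [|lra].
      generalize (pos_INR (k - 1)). lra. }
    unfold K, B. rewrite E1.
    replace ((1 + rho) / (1 - rho) ^ 3) with (/ (1 - rho) ^ 2 + 2 * rho / (1 - rho) ^ 3)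
      by (field; lra).
    assert (0 <= (T1 - T M) * (2 * rho / (1 - rho) ^ 3)).
    { apply Rmult_le_pos; [lra|]. apply Rdiv_le_0_compat; lra. }
    assert (0 <= (A - T M) * sum_n_m gam 2 p) by (apply Rmult_le_pos; lra).
    replace (2 * T M * rho / (1 - rho) ^ 3) with (T M * (2 * rho / (1 - rho) ^ 3)) in Eq
      by (field; lra).
    unfold R0. lra. }
  set (E := fun z => (pair_remainder (phi 1%nat) (psi 1%nat) z
    + sum_n_m (fun k => RtoC (Cmod z ^ (2 * (k - 1))) * pair_Dop (phi k) (psi k) z) 2 p)%C).
  assert (Hin : forall z, disk rho z -> disk 1 z) by (unfold disk; intros; lra).
  assert (HN : near_linear (phi 1%nat 0%C) (psi 1%nat 0%C) E (Dop f) rho K B).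
  { assert (HB0 : 0 <= B <= K).
    { assert (1 <= / (1 - rho) ^ 2)
        by (rewrite <- Rinv_1 at 1; apply Rinv_le_contravar; [easy|nra]).
      assert (HBs : 0 <= sum_n_m beta 2 p)
        by (apply (sum_n_m_ind (fun x => 0 <= x)); [lra|intros; lra|auto]).
      assert (HLs : sum_n_m beta 2 p <= sum_n_m (fun k => lip_term rho (k - 1)) 2 p).
      { apply sum_n_m_le_loc. intros k Hk. rewrite Hsplit.
        assert (0 <= rho ^ (2 * (k - 1)) * (2 * INR (k - 1) / (1 - rho) ^ 2 + 2 * rho / (1 - rho) ^ 3)).
        { apply Rmult_le_pos; [apply pow_le; lra|].
          apply Rplus_le_le_0_compat; apply Rdiv_le_0_compat; try easy; [|lra].
          generalize (pos_INR (k - 1)). lra. }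
        unfold beta. lra. }
      assert (/ (1 - rho) ^ 2 <= (1 + rho) / (1 - rho) ^ 3).
      { replace ((1 + rho) / (1 - rho) ^ 3) with (/ (1 - rho) ^ 2 + 2 * rho / (1 - rho) ^ 3)
          by (field; lra).
        assert (0 <= 2 * rho / (1 - rho) ^ 3) by (apply Rdiv_le_0_compat; lra). lra. }
      unfold B, K. split; [nra|]. apply Rplus_le_compat; apply Rmult_le_compat_l; lra. }
    split.
    - fold lam. lra.
    - exact HB0.
    - intros z w Hz Hw. unfold E.
      replace (_ + _ - (_ + _))%C with
        ((pair_remainder (phi 1%nat) (psi 1%nat) z - pair_remainder (phi 1%nat) (psi 1%nat) w)
        + (sum_n_m (fun k => RtoC (Cmod z ^ (2 * (k - 1))) * pair_Dop (phi k) (psi k) z) 2 p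
         - sum_n_m (fun k => RtoC (Cmod w ^ (2 * (k - 1))) * pair_Dop (phi k) (psi k) w) 2 p))%C by ring.
      eapply Rle_trans; [apply Cmod_triangle|]. unfold K. rewrite Rmult_plus_distr_r.
      apply Rplus_le_compat.
      + apply (first_lip (H 1%nat)); auto; lra.
      + rewrite Rmult_assoc, (Rmult_comm (sum_n_m _ 2 p)), <- Rmult_assoc, <- sum_n_m_Rmult.
        apply Cmod_sum_n_m_minus. intros k Hk.
        eapply Rle_trans; [apply (higher_lip (H k) _ _ _ rho M)|]; auto; try lra.
        * apply HH. lia.
        * apply HM. lia.
        * fold A. right. ring.
    - intros z Hz. unfold E. eapply Rle_trans; [apply Cmod_triangle|].
      unfold B. rewrite Rmult_plus_distr_r. apply Rplus_le_compat.
      + apply (first_bound (H 1%nat)); auto; lra.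
      + rewrite Rmult_assoc, (Rmult_comm (sum_n_m _ 2 p)), <- Rmult_assoc, <- sum_n_m_Rmult.
        apply Cmod_sum_n_m. intros k Hk.
        eapply Rle_trans; [apply (higher_bound (H k) _ _ _ rho M)|]; auto; try lra.
        * apply HH. lia.
        * apply HM. lia.
        * fold A. unfold beta. right. ring.
    - intros z Hz. rewrite HD by auto. rewrite sum_Sn_m by lia.
      change plus with Cplus. unfold E, pair_remainder.
      replace (RtoC (Cmod z ^ (2 * (1 - 1)))) with (RtoC 1) by reflexivity. ring. }
  exists rho. split; [easy|split; [exact Eq|split]].
  - intros z1 z2 H1 H2 Ez. apply Ceq_minus, Cmod_eq_0.
    generalize (near_linear_lower _ _ _ _ _ _ _ z1 z2 HN H1 H2) (Cmod_ge_0 (z1 - z2)).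
    rewrite Ez. replace (Dop f z2 - Dop f z2)%C with (RtoC 0) by ring.
    rewrite Cmod_0. fold lam. intros; apply Rle_antisym; nra.
  (* The radius suffices because [R0 <= K - B] and [K < lam]. *)
  - apply (near_linear_univalent_disk _ _ _ _ _ _ _ _ HN). fold lam.
    apply Rmult_le_compat_l; [lra|fold R0; lra].
Qed.
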